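(* Let $Z=\mathbb{R}$ or $Z=\mathbb{T}$, and consider, for either choice of the sign $\pm$, the Cauchy problem $$i\partial_tu+\partial_x^2u=\pm|u|^2u,\qquad t\in[0,T],\ x\in Z,\qquad u(0,x)=\phi(x).$$ Norm inflation occurs for this problem in the following cases: (i) In $D^{[\alpha]}_{p,q}$ for any $1\le q\le\infty$ and $\alpha<\frac1{2q}$, if $\frac32\le p<\infty$. (ii) In $D^{[\alpha]}_{p,q}$ and in $D^s_{p,q}$ for any $1\le q\le\infty$, $\alpha\in\mathbb{R}$ and $s<-\frac23$, if $1\le p<\frac32$.
   Context: $\mathbb{T}=\mathbb{R}/2\pi\mathbb{Z}$, $\langle x\rangle=(1+|x|^2)^{1/2}$, $\hat f$ is the Fourier transform on $Z$ (frequency variable in $\mathbb{R}$ if $Z=\mathbb{R}$, in $\mathbb{Z}$ with counting measure if $Z=\mathbb{T}$), and $\frac1{2q}=0$ for $q=\infty$. For $1\le p<\infty$, $1\le q\le\infty$ and $\alpha,s\in\mathbb{R}$ define $$\|f\|_{D^{[\alpha]}_{p,q}}:=\Big\|N^{-\frac1p}\langle\log N\rangle^\alpha\,\|\hat f\|_{L^p_\xi(\{N\le\langle\xi\rangle<2N\})}\Big\|_{\ell^q_N(2^{\mathbb{Z}_{\ge0}})},$$ $$\|f\|_{D^{s}_{p,q}}:=\Big\|N^{s}\,\|\hat f\|_{L^p_\xi(\{N\le\langle\xi\rangle<2N\})}\Big\|_{\ell^q_N(2^{\mathbb{Z}_{\ge0}})},$$ where $N$ ranges over $2^{\mathbb{Z}_{\ge0}}=\{1,2,4,\dots\}$.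 Norm inflation in $X$ (where $X=D^{[\alpha]}_{p,q}$ or $D^s_{p,q}$) occurs if for any $\delta>0$ there exist $\phi\in H^\infty(Z)=\bigcap_\sigma H^\sigma(Z)$ and $T>0$ with $\|\phi\|_X<\delta$ and $0<T<\delta$ such that the corresponding smooth solution $u$ of the Cauchy problem (which is uniquely defined for smooth $\phi$ locally in time) exists on $[0,T]$ and $\|u(T)\|_X>\delta^{-1}$. *)

(* Defs.v *)
From HB Require Import structures.
From mathcomp Require Import all_boot all_order all_algebra.
From mathcomp Require Export complex.
From mathcomp Require Export all_classical all_reals all_analysis.

Set Implicit Arguments.
Unset Strict Implicit.
Unset Printing Implicit Defensive.

Import Order.TTheory GRing.Theory Num.Theory.
Import ComplexField numFieldNormedType.Exports.

Local Open Scope classical_set_scope.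
Local Open Scope complex_scope.
Local Open Scope ring_scope.

HB.instance Definition _ := isPointed.Build int 0.
HB.instance Definition _ := @isMeasurable.Build default_measure_display
  int discrete_measurable discrete_measurable0
  discrete_measurableC discrete_measurableU.

Section ComplexValued.
Context {R : realType}.
Implicit Types (f g : R -> R[i]).

(* Complex-valued functions are measured, integrated and differentiated through
   their real and imaginary parts. *)
Definition cmeasurable d (T : measurableType d) (f : T -> R[i]) : Prop :=
  measurable_fun [set: T] (fun x => complex.Re (f x)) /\
  measurable_fun [set: T] (fun x => complex.Im (f x)).

Definition cintegral (D : set R) f : R[i] :=
  Rintegral lebesgue_measure D (fun x => complex.Re (f x)) +i*
  Rintegral lebesgue_measure D (fun x => complex.Im (f x)).

Definition cderive (n : nat) f (x : R) : R[i] :=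
  derive1n n (fun y => complex.Re (f y)) x +i*
  derive1n n (fun y => complex.Im (f y)) x.

Definition csmooth f : Prop := forall (n : nat) (x : R),
  derivable (derive1n n (fun y => complex.Re (f y))) x 1 /\
  derivable (derive1n n (fun y => complex.Im (f y))) x 1.

(* The limit is taken inside D, so the derivative is one-sided at an endpoint
   of an interval D. *)
Definition is_derive_within (D : set R) f (t : R) (l : R[i]) : Prop :=
  (fun s => (complex.Re (f s) - complex.Re (f t)) / (s - t))
    @ within D t^' --> complex.Re l /\
  (fun s => (complex.Im (f s) - complex.Im (f t)) / (s - t))
    @ within D t^' --> complex.Im l.

Definition cexpi (x : R) : R[i] := cos x +i* sin x.

End ComplexValued.

Section Domains.
Variable R : realType.

(* The spatial domain Z together with its frequency space. Functions on Z are
   functions on R satisfying fun_on, and fundamental is a set of representatives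
   of Z in R. *)
Record domain := Domain {
  fun_on : set (R -> R[i]);
  fundamental : set R;
  freq_display : measure_display;
  freq : measurableType freq_display;
  freq_measure : {measure set freq -> \bar R};
  freq_val : freq -> R;
  fourier : forall (f : R -> R[i]) (xi : freq), R[i] }.

Definition truncated_fourier (A : R) (f : R -> R[i]) (xi : R) : R[i] :=
  cintegral `[- A, A] (fun x => f x * cexpi (- (x * xi))).

(* Elements of H^infty(R) need not be integrable. By Plancherel's theorem the
   transform of f in L^2(R) is the L^2 limit of the transforms of its
   truncations, and is unique up to a null set. *)
Definition is_fourier_line (f g : R -> R[i]) : Prop :=
  cmeasurable g /\
  (fun A : R => ('N[lebesgue_measure]_2%:E
     [(fun xi => (Normc.normc (truncated_fourier A f xi - g xi))%:E)])%E)
    @ +oo --> 0%E.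

Definition line : domain := {|
  fun_on := [set: R -> R[i]];
  fundamental := [set: R];
  freq_measure := lebesgue_measure;
  freq_val := id;
  fourier := fun f => xget (cst 0) [set g | is_fourier_line f g] |}.

Definition torus : domain := {|
  fun_on := [set f | periodic f (2 * pi)];
  fundamental := `[0, 2 * pi[;
  freq := int;
  freq_measure := counting;
  freq_val := fun k : int => k%:~R;
  fourier := fun f k =>
    cintegral `[0, 2 * pi[ (fun x => f x * cexpi (- (x * k%:~R))) |}.

End Domains.

Arguments fun_on {R} d.
Arguments fundamental {R} d.
Arguments freq {R} d.
Arguments freq_measure {R} d.
Arguments freq_val {R} d.
Arguments fourier {R} d f xi.

Section NormInflation.
Context {R : realType}.
Variable Z : domain R.
Implicit Types (f phi : R -> R[i]) (u : R -> R -> R[i]).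

Definition jap (x : R) : R := Num.sqrt (1 + x ^+ 2).

Definition in_L2 f : Prop :=
  [/\ fun_on Z f, cmeasurable f &
   ('N[lebesgue_measure]_2%:E
     [(fun x => (Normc.normc (f x))%:E) \_ (fundamental Z)] < +oo)%E].

Definition Hnorm (sigma : R) f : \bar R :=
  ('N[freq_measure Z]_2%:E
    [(fun xi =>
       (jap (freq_val Z xi) `^ sigma * Normc.normc (fourier Z f xi))%:E)])%E.

(* A class in the intersection of all H^sigma is represented by its smooth
   member. *)
Definition in_Hinfty f : Prop :=
  [/\ in_L2 f, csmooth f & forall sigma : R, (Hnorm sigma f < +oo)%E].

Definition shell (N : R) : set (freq Z) :=
  [set xi | N <= jap (freq_val Z xi) < 2 * N].

(* N = 2 ^ j ranges over the dyadic numbers, and w N is the weight. *)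
Definition Dnorm (w : R -> R) (p : R) (q : \bar R) f : \bar R :=
  ('N[counting]_q [(fun j : nat => (w (2 ^+ j))%:E *
     'N[freq_measure Z]_(p%:E)
       [(fun xi => (Normc.normc (fourier Z f xi))%:E) \_ (shell (2 ^+ j))])])%E.

Definition Dlog_norm (alpha p : R) (q : \bar R) : (R -> R[i]) -> \bar R :=
  Dnorm (fun N => N `^ (- p^-1) * jap (ln N) `^ alpha) p q.

Definition Dpow_norm (s p : R) (q : \bar R) : (R -> R[i]) -> \bar R :=
  Dnorm (fun N => N `^ s) p q.

(* u t x is the value at time t. A classical solution that is continuous in time
   with values in every H^sigma is smooth in (t, x), by the equation, and is
   determined by phi. *)
Definition smooth_solution (eps : R[i]) (T : R) phi u : Prop :=
  [/\ u 0 = phi,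
      forall t, 0 <= t <= T -> in_Hinfty (u t),
      forall sigma t, 0 <= t <= T ->
        (fun s => Hnorm sigma (fun x => u s x - u t x))
          @ within `[0, T] (nbhs t) --> 0%E &
      forall t x, 0 <= t <= T -> exists2 ut : R[i],
        is_derive_within `[0, T] (fun s => u s x) t ut &
        'i%C * ut + cderive 2 (u t) x = eps * (`|u t x| ^+ 2 * u t x)].

Definition norm_inflation (eps : R[i]) (X : (R -> R[i]) -> \bar R) : Prop :=
  forall delta : R, 0 < delta ->
  exists (phi : R -> R[i]) (T : R) (u : R -> R -> R[i]),
    [/\ in_Hinfty phi /\ (X phi < delta%:E)%E,
        0 < T < delta,
        smooth_solution eps T phi u &
        ((delta^-1)%:E < X (u T))%E].

End NormInflation.

Definition inv_double {R : realType} (q : \bar R) : R :=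
  if q is r%:E%E then (2 * r)^-1 else 0.

(* Main.v *)
Require Import Defs.
From HB Require Import structures.
From mathcomp Require Import all_boot all_order all_algebra.
From mathcomp Require Import complex ring lra.
From mathcomp Require Import all_classical all_reals all_analysis.
From mathcomp Require Import measurable_realfun.

Set Implicit Arguments.
Unset Strict Implicit.
Unset Printing Implicit Defensive.

Import Order.TTheory GRing.Theory Num.Theory.
Import ComplexField numFieldNormedType.Exports.

Local Open Scope classical_set_scope.
Local Open Scope complex_scope.
Local Open Scope ring_scope.

Notation nm := Normc.normc.
Notation conjC := (@conjc _).

Arguments Normc.normc {R} x : simpl never.

Section Modulus.
Context {R : realType}.
Implicit Types (z w : R[i]) (x y : R).

Lemma nmE z : nm z = Num.sqrt (complex.Re z ^+ 2 + complex.Im z ^+ 2).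
Proof. by case: z. Qed.

Lemma nm_ge0 z : 0 <= nm z.
Proof. by rewrite nmE sqrtr_ge0. Qed.

Lemma nm_sqr z : nm z ^+ 2 = complex.Re z ^+ 2 + complex.Im z ^+ 2.
Proof. by rewrite nmE sqr_sqrtr// addr_ge0// sqr_ge0. Qed.

Lemma nm0 : nm (0 : R[i]) = 0. Proof. exact: Normc.normc0. Qed.
Lemma nm1 : nm (1 : R[i]) = 1. Proof. exact: Normc.normc1. Qed.
Lemma nmM z w : nm (z * w) = nm z * nm w. Proof. exact: Normc.normcM. Qed.
Lemma nmD z w : nm (z + w) <= nm z + nm w. Proof. exact: le_normcD. Qed.
Lemma nmN z : nm (- z) = nm z. Proof. exact: normcN. Qed.
Lemma nmB z w : nm (z - w) <= nm z + nm w.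
Proof. by rewrite -(nmN w); exact: nmD. Qed.
Lemma nmBC z w : nm (z - w) = nm (w - z).
Proof. by rewrite -nmN opprB. Qed.
Lemma nm_conj z : nm (conjC z) = nm z.
Proof. by rewrite !nmE; case: z => a b /=; rewrite sqrrN. Qed.

Lemma Re_le_nm z : `|complex.Re z| <= nm z.
Proof. by rewrite nmE -sqrtr_sqr ler_wsqrtr// lerDl sqr_ge0. Qed.
Lemma Im_le_nm z : `|complex.Im z| <= nm z.
Proof. by rewrite nmE -sqrtr_sqr ler_wsqrtr// lerDr sqr_ge0. Qed.

Lemma nm_le_ReIm z : nm z <= `|complex.Re z| + `|complex.Im z|.
Proof.
rewrite -(@ler_pXn2r _ 2)// ?nnegrE ?nm_ge0 ?addr_ge0//.
rewrite nm_sqr -(real_normK (num_real (complex.Re z))).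
rewrite -(real_normK (num_real (complex.Im z))) sqrrD.
by rewrite -addrA lerD2l lerDr mulrn_wge0// mulr_ge0.
Qed.

Lemma nm_real x : nm (x%:C) = `|x|.
Proof. by rewrite nmE /= expr0n addr0 sqrtr_sqr. Qed.

Lemma nm_i : nm ('i%C : R[i]) = 1.
Proof. by rewrite nmE /= expr0n expr1n add0r sqrtr1. Qed.

Lemma cReD z w : complex.Re (z + w) = complex.Re z + complex.Re w.
Proof. by case: z; case: w. Qed.
Lemma cImD z w : complex.Im (z + w) = complex.Im z + complex.Im w.
Proof. by case: z; case: w. Qed.
Lemma cReN z : complex.Re (- z) = - complex.Re z. Proof. by case: z. Qed.
Lemma cImN z : complex.Im (- z) = - complex.Im z. Proof. by case: z. Qed.
Lemma cReM z w : complex.Re (z * w) =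
  complex.Re z * complex.Re w - complex.Im z * complex.Im w.
Proof. by case: z; case: w. Qed.
Lemma cImM z w : complex.Im (z * w) =
  complex.Re z * complex.Im w + complex.Im z * complex.Re w.
Proof. by case: z => a b; case: w => c d /=. Qed.
Lemma cReJ z : complex.Re (conjC z) = complex.Re z. Proof. by case: z. Qed.
Lemma cImJ z : complex.Im (conjC z) = - complex.Im z. Proof. by case: z. Qed.

Lemma conjM z w : conjC (z * w) = conjC z * conjC w.
Proof. exact: rmorphM. Qed.
Lemma conjD z w : conjC (z + w) = conjC z + conjC w.
Proof. exact: rmorphD. Qed.
Lemma conjB z w : conjC (z - w) = conjC z - conjC w.
Proof. exact: rmorphB. Qed.

Lemma mul_conj z : z * conjC z = (nm z ^+ 2)%:C.
Proof.
apply/eqP; rewrite eq_complex cReM cImM cReJ cImJ nm_sqr /=.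
by apply/andP; split; apply/eqP; ring.
Qed.

Lemma normr_sqr_complex z : `|z| ^+ 2 = z * conjC z.
Proof. exact: sqr_normc. Qed.

Lemma cexpiD x y : cexpi (x + y) = cexpi x * cexpi y :> R[i].
Proof.
by apply/eqP; rewrite eq_complex cReM cImM /= cosD sinD [sin x * _ + _]addrC !eqxx.
Qed.

Lemma cexpi0 : cexpi 0 = 1 :> R[i].
Proof. by rewrite /cexpi cos0 sin0. Qed.

Lemma conj_cexpi x : conjC (cexpi x) = cexpi (- x).
Proof. by rewrite /cexpi cosN sinN. Qed.

Lemma nm_cexpi x : nm (cexpi x) = 1.
Proof. by rewrite nmE /= cos2Dsin2 sqrtr1. Qed.

Lemma cexpiN x : cexpi x * cexpi (- x) = 1 :> R[i].
Proof. by rewrite -cexpiD subrr cexpi0. Qed.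

Lemma cos_lip x y : `|cos x - cos y| <= `|x - y|.
Proof.
wlog xy : x y / x <= y.
  by move=> h; case: (leP x y) => [/h//|/ltW /h]; rewrite distrC (distrC y).
have [c _ h] := @MVT_segment R (@cos R) (fun x => - sin x) _ _ xy
  (fun t _ => is_derive_cos t) (@continuous_subspaceT _ _ _ _ (@continuous_cos R)).
by rewrite distrC h normrM normrN distrC ler_piMl// sin_max.
Qed.

Lemma sin_lip x y : `|sin x - sin y| <= `|x - y|.
Proof.
wlog xy : x y / x <= y.
  by move=> h; case: (leP x y) => [/h//|/ltW /h]; rewrite distrC (distrC y).
have [c _ h] := @MVT_segment R (@sin R) (@cos R) _ _ xy
  (fun t _ => is_derive_sin t) (@continuous_subspaceT _ _ _ _ (@continuous_sin R)).
by rewrite distrC h normrM distrC ler_piMl// cos_max.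
Qed.

Lemma cexpi_lip x y : nm (cexpi x - cexpi y) <= 2 * `|x - y|.
Proof.
apply: le_trans (nm_le_ReIm _) _; rewrite cReD cImD cReN cImN /= mulr_natl mulr2n.
by rewrite lerD ?cos_lip ?sin_lip.
Qed.

Lemma sin_sub_le x : `|sin x - x| <= x ^+ 2.
Proof.
wlog x0 : x / 0 <= x.
  move=> h; case: (leP 0 x) => [/h//|xlt]; have := h (- x).
  rewrite sinN -opprD normrN sqrrN; apply; lra.
have dF (z : R) : is_derive z (1 : R) (fun x => sin x - x) (cos z - 1).
  by apply: is_deriveB.
have cF : continuous (fun x : R => sin x - x).
  by move=> z; apply: cvgB; [exact: continuous_sin|exact: cvg_id].
have [c] := @MVT_segment R (fun x => sin x - x) (fun x => cos x - 1) _ _ x0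
  (fun t _ => dF t) (@continuous_subspaceT _ _ _ _ cF).
rewrite in_itv /= => /andP[c0 cx]; rewrite sin0 !subr0 => ->.
rewrite normrM expr2 (ger0_norm x0) ler_wpM2r//.
rewrite -{1}cos0; apply: le_trans (cos_lip _ _) _.
by rewrite subr0 ger0_norm.
Qed.

Lemma cos_sub_le x : `|cos x - 1| <= x ^+ 2.
Proof.
wlog x0 : x / 0 <= x.
  move=> h; case: (leP 0 x) => [/h//|xlt]; have := h (- x).
  by rewrite cosN sqrrN; apply; lra.
have [c] := @MVT_segment R (@cos R) (fun x => - sin x) _ _ x0
  (fun t _ => is_derive_cos t) (@continuous_subspaceT _ _ _ _ (@continuous_cos R)).
rewrite in_itv /= => /andP[c0 cx]; rewrite cos0 subr0 => ->.
rewrite normrM expr2 (ger0_norm x0) ler_wpM2r// normrN.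
have := sin_lip c 0; rewrite sin0 !subr0 => /le_trans; apply.
by rewrite ger0_norm.
Qed.

(** First-order Taylor formula for the exponential, with quadratic error. *)
Lemma cexpi_taylor x : nm (cexpi x - 1 - 'i%C * x%:C) <= 2 * x ^+ 2.
Proof.
apply: le_trans (nm_le_ReIm _) _.
rewrite !cReD !cImD !cReN !cImN cReM cImM /= mulr_natl mulr2n.
rewrite !(mul0r, mul1r, mulr0, subr0, addr0, add0r, oppr0).
by rewrite lerD ?cos_sub_le ?sin_sub_le.
Qed.

Lemma enm_ge0 z : (0 <= (nm z)%:E)%E.
Proof. by rewrite lee_fin nm_ge0. Qed.

End Modulus.

#[global] Hint Resolve nm_ge0 enm_ge0 : core.

(** * Complex-valued measurable functions and their integrals *)

Section ComplexMeasurability.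
Context {R : realType} d (T : measurableType d).
Implicit Types (f g : T -> R[i]) (c : R[i]).

Lemma cmeasurable_cst (c : R[i]) : cmeasurable (fun _ : T => c).
Proof. by split; exact: measurable_cst. Qed.

Lemma cmeasurableD f g : cmeasurable f -> cmeasurable g ->
  cmeasurable (fun x => f x + g x).
Proof.
move=> [f1 f2] [g1 g2]; split.
  by under eq_fun do rewrite cReD; exact: measurable_funD.
by under eq_fun do rewrite cImD; exact: measurable_funD.
Qed.

Lemma cmeasurableN f : cmeasurable f -> cmeasurable (fun x => - f x).
Proof.
move=> [f1 f2]; split.
  by under eq_fun do rewrite cReN; exact: measurableT_comp.
by under eq_fun do rewrite cImN; exact: measurableT_comp.
Qed.

Lemma cmeasurableB f g : cmeasurable f -> cmeasurable g ->
  cmeasurable (fun x => f x - g x).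
Proof. by move=> mf mg; apply: cmeasurableD => //; exact: cmeasurableN. Qed.

Lemma cmeasurableM f g : cmeasurable f -> cmeasurable g ->
  cmeasurable (fun x => f x * g x).
Proof.
move=> [f1 f2] [g1 g2]; split.
  by under eq_fun do rewrite cReM; apply: measurable_funB; exact: measurable_funM.
by under eq_fun do rewrite cImM; apply: measurable_funD; exact: measurable_funM.
Qed.

Lemma cmeasurable_conj f : cmeasurable f -> cmeasurable (fun x => conjC (f x)).
Proof.
move=> [f1 f2]; split; first by under eq_fun do rewrite cReJ.
by under eq_fun do rewrite cImJ; exact: measurableT_comp.
Qed.

Lemma cmeasurable_real (h : T -> R) : measurable_fun setT h ->
  cmeasurable (fun x => (h x)%:C).
Proof. by move=> mh; split => //=; exact: measurable_cst. Qed.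

Lemma cmeasurable_cexpi (h : T -> R) : measurable_fun setT h ->
  cmeasurable (fun x => cexpi (h x)).
Proof.
move=> mh; split => /=.
  by apply: measurableT_comp mh; apply: continuous_measurable_fun;
    exact: continuous_cos.
by apply: measurableT_comp mh; apply: continuous_measurable_fun;
  exact: continuous_sin.
Qed.

Lemma cmeasurable_comp d' (T' : measurableType d') (h : T' -> T) f :
  cmeasurable f -> measurable_fun setT h -> cmeasurable (fun x => f (h x)).
Proof.
by move=> [f1 f2] mh; split;
  [exact: (measurableT_comp f1 mh)|exact: (measurableT_comp f2 mh)].
Qed.

Lemma measurable_nm f : cmeasurable f -> measurable_fun setT (fun x => nm (f x)).
Proof.
move=> [f1 f2]; under eq_fun do rewrite nmE.
have ms : measurable_fun setT (@Num.sqrt R).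
  by apply: continuous_measurable_fun; exact: sqrt_continuous.
have mg : measurable_fun setT
    (fun x => complex.Re (f x) ^+ 2 + complex.Im (f x) ^+ 2).
  by apply: measurable_funD; exact: measurable_funX.
exact: (measurableT_comp ms mg).
Qed.

Lemma measurable_enm f : cmeasurable f ->
  measurable_fun setT (fun x => (nm (f x))%:E).
Proof. by move=> /measurable_nm mf; exact/measurable_EFinP. Qed.

Lemma cvg_ReIm (z_ : R[i]^nat) (z : R[i]) :
  nm (z_ n - z) @[n --> \oo] --> (0 : R) ->
  (complex.Re (z_ n) @[n --> \oo] --> complex.Re z) /\
  (complex.Im (z_ n) @[n --> \oo] --> complex.Im z).
Proof.
have aux (u : R^nat) l : (forall n, `|u n - l| <= nm (z_ n - z)) ->
    nm (z_ n - z) @[n --> \oo] --> (0 : R) -> u n @[n --> \oo] --> l.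
  move=> ule h; apply/cvgrPdist_lt => e e0.
  move/cvgrPdist_lt : h => /(_ e e0); apply: filterS => n.
  rewrite sub0r normrN ger0_norm ?nm_ge0// => /(le_lt_trans _); apply.
  by rewrite distrC.
move=> h; split; apply: (aux _ _ _ h) => n.
  by rewrite -cReN -cReD; exact: Re_le_nm.
by rewrite -cImN -cImD; exact: Im_le_nm.
Qed.

Lemma cmeasurable_cvg (f_ : nat -> T -> R[i]) f :
  (forall n, cmeasurable (f_ n)) ->
  (forall x, nm (f_ n x - f x) @[n --> \oo] --> (0 : R)) -> cmeasurable f.
Proof.
move=> mf h; split.
- apply: (@measurable_fun_cvg _ _ _ _ (fun n x => complex.Re (f_ n x))).
    by move=> n; case: (mf n).
  by move=> x _; case: (cvg_ReIm (h x)).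
- apply: (@measurable_fun_cvg _ _ _ _ (fun n x => complex.Im (f_ n x))).
    by move=> n; case: (mf n).
  by move=> x _; case: (cvg_ReIm (h x)).
Qed.

End ComplexMeasurability.

Section ComplexIntegral.
Context {R : realType} d (T : measurableType d).
Variable mu : {measure set T -> \bar R}.
Implicit Types (f g : T -> R[i]) (c : R[i]).

Definition cint f : R[i] :=
  Rintegral mu setT (fun x => complex.Re (f x)) +i*
  Rintegral mu setT (fun x => complex.Im (f x)).

Definition L1norm f : \bar R := (\int[mu]_x (nm (f x))%:E)%E.

Definition cintegrable f : Prop := cmeasurable f /\ (L1norm f < +oo)%E.

Lemma L1norm_ge0 f : (0 <= L1norm f)%E.
Proof. by apply: integral_ge0 => x _; rewrite lee_fin nm_ge0. Qed.

Lemma le_L1norm f (g : T -> R) : cmeasurable f -> measurable_fun setT g ->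
  (forall x, nm (f x) <= g x) -> (L1norm f <= \int[mu]_x (g x)%:E)%E.
Proof.
move=> mf mg fg; apply: ge0_le_integral => //.
- by move=> x _; rewrite lee_fin nm_ge0.
- exact: measurable_enm.
- exact/measurable_EFinP.
- by move=> x _; rewrite lee_fin.
Qed.

Lemma cintegrable_le f (g : T -> R) : cmeasurable f -> measurable_fun setT g ->
  (forall x, nm (f x) <= g x) -> (\int[mu]_x (g x)%:E < +oo)%E ->
  cintegrable f.
Proof. by move=> mf mg fg; split => //; apply: le_lt_trans (le_L1norm mf mg fg) _. Qed.

Lemma cintegrable_ReIm f : cintegrable f ->
  mu.-integrable setT (EFin \o (fun x => complex.Re (f x))) /\
  mu.-integrable setT (EFin \o (fun x => complex.Im (f x))).
Proof.
move=> [[mf1 mf2] fi].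
have intn : mu.-integrable setT (fun x => (nm (f x))%:E).
  apply/integrableP; split; first exact: measurable_enm.
  by under eq_integral do rewrite gee0_abs ?lee_fin ?nm_ge0//.
split; apply: le_integrable intn => //=.
- exact/measurable_EFinP.
- by move=> x _; rewrite lee_fin (le_trans (Re_le_nm _))// ler_norm.
- exact/measurable_EFinP.
- by move=> x _; rewrite lee_fin (le_trans (Im_le_nm _))// ler_norm.
Qed.

Lemma eq_cint f g : f =1 g -> cint f = cint g.
Proof. by move=> /funext ->. Qed.

Lemma cint0 : cint (fun=> 0) = 0.
Proof. by rewrite /cint /Rintegral /= integral0_eq. Qed.

Lemma cintegrableD f g : cintegrable f -> cintegrable g ->
  cintegrable (fun x => f x + g x).
Proof.
move=> [mf fi] [mg gi].
apply: (@cintegrable_le _ (fun x => nm (f x) + nm (g x))).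
- exact: cmeasurableD.
- by apply: measurable_funD; exact: measurable_nm.
- by move=> x; exact: nmD.
under eq_integral do rewrite EFinD.
rewrite ge0_integralD//; first exact: lte_add_pinfty.
- by move=> x _; rewrite lee_fin nm_ge0.
- exact: measurable_enm.
- by move=> x _; rewrite lee_fin nm_ge0.
- exact: measurable_enm.
Qed.

Lemma L1normZ c f : cmeasurable f ->
  L1norm (fun x => c * f x) = ((nm c)%:E * L1norm f)%E.
Proof.
move=> mf; rewrite /L1norm; under eq_integral do rewrite nmM EFinM.
rewrite ge0_integralZl//; first exact: measurable_enm.
  by move=> x _; exact: enm_ge0.
exact: enm_ge0.
Qed.

Lemma cintegrableZ c f : cintegrable f -> cintegrable (fun x => c * f x).
Proof.
move=> [mf fi]; split; first by apply: cmeasurableM => //; exact: cmeasurable_cst.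
by rewrite L1normZ// lte_mul_pinfty ?lee_fin ?nm_ge0.
Qed.

Lemma cintegrableN f : cintegrable f -> cintegrable (fun x => - f x).
Proof.
move=> [mf fi]; split; first exact: cmeasurableN.
by rewrite /L1norm; under eq_integral do rewrite nmN.
Qed.

Lemma cintD f g : cintegrable f -> cintegrable g ->
  cint (fun x => f x + g x) = cint f + cint g.
Proof.
move=> /cintegrable_ReIm[f1 f2] /cintegrable_ReIm[g1 g2].
apply/eqP; rewrite eq_complex cReD cImD /=; apply/andP; split; apply/eqP.
  by under eq_Rintegral do rewrite cReD; rewrite RintegralD.
by under eq_Rintegral do rewrite cImD; rewrite RintegralD.
Qed.

Lemma cintZ c f : cintegrable f -> cint (fun x => c * f x) = c * cint f.
Proof.
move=> /cintegrable_ReIm[f1 f2].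
have iZ (r : R) (h : T -> R) : mu.-integrable setT (EFin \o h) ->
    mu.-integrable setT (EFin \o (fun x => r * h x)).
  by move=> hi; under [X in mu.-integrable _ X]eq_fun do rewrite /= EFinM;
    exact: integrableZl.
apply/eqP; rewrite eq_complex cReM cImM /=; apply/andP; split; apply/eqP.
  under eq_Rintegral do rewrite cReM.
  by rewrite RintegralB//; [rewrite !RintegralZl|exact: iZ..].
under eq_Rintegral do rewrite cImM.
by rewrite RintegralD//; [rewrite !RintegralZl|exact: iZ..].
Qed.

Lemma cintN f : cintegrable f -> cint (fun x => - f x) = - cint f.
Proof.
move=> fi; rewrite -mulN1r -cintZ//.
by apply: eq_cint => x; rewrite mulN1r.
Qed.

Lemma cintB f g : cintegrable f -> cintegrable g ->
  cint (fun x => f x - g x) = cint f - cint g.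
Proof. by move=> fi gi; rewrite cintD ?cintN//; exact: cintegrableN. Qed.

Lemma cint_conj f : cintegrable f -> cint (fun x => conjC (f x)) = conjC (cint f).
Proof.
move=> /cintegrable_ReIm[f1 f2].
apply/eqP; rewrite eq_complex cReJ cImJ /=; apply/andP; split; apply/eqP.
  by under eq_Rintegral do rewrite cReJ.
under eq_Rintegral do rewrite cImJ -mulN1r.
by rewrite RintegralZl// mulN1r.
Qed.

(** Rotating the value of the integral onto the real axis reduces the estimate
    to the real part. *)
Lemma nm_cint f : cintegrable f -> ((nm (cint f))%:E <= L1norm f)%E.
Proof.
move=> fi; set z := cint f; have [z0|z0] := eqVneq (nm z) 0.
  by rewrite z0 L1norm_ge0.
have nz : 0 < nm z by rewrite lt_neqAle eq_sym z0 nm_ge0.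
have gi := cintegrableZ (conjC z) fi.
have [g1 _] := cintegrable_ReIm gi.
have e : nm z ^+ 2 = Rintegral mu setT (fun x => complex.Re (conjC z * f x)).
  have /(congr1 (@complex.Re R)) := cintZ (conjC z) fi.
  by rewrite -/z mulrC mul_conj /= => ->.
have : (((nm z) ^+ 2)%:E <= (nm z)%:E * L1norm f)%E.
  rewrite e /Rintegral fineK; last exact: integrable_fin_num.
  rewrite -[X in (X%:E * _)%E]nm_conj -L1normZ; last by case: fi.
  apply: le_trans (_ : _ <= \int[mu]_x `|(complex.Re (conjC z * f x))%:E|)%E _.
    by apply: le_trans (lee_abs _) (le_abse_integral _ _ _) => //;
       case/integrableP : g1.
  apply: ge0_le_integral => //.
  - by apply: measurableT_comp => //; case/integrableP : g1.
  - by apply: measurable_enm; case: gi.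
  - by move=> x _; rewrite lee_fin Re_le_nm.
by rewrite expr2 EFinM lee_pmul2l// lte_fin.
Qed.

Lemma nm_cint_le f (K : R) : cmeasurable f -> (L1norm f <= K%:E)%E ->
  nm (cint f) <= K.
Proof.
move=> mf fK; rewrite -lee_fin; apply: le_trans (fK); apply: nm_cint.
by split => //; apply: le_lt_trans fK _; rewrite ltry.
Qed.

(** Dominated convergence, with the conclusion in L1. *)
Lemma cint_cvg (f_ : nat -> T -> R[i]) f (g : T -> R) :
  (forall n, cmeasurable (f_ n)) -> cmeasurable f -> measurable_fun setT g ->
  (forall x, nm (f_ n x - f x) @[n --> \oo] --> (0 : R)) ->
  (forall n x, nm (f_ n x) <= g x) -> (forall x, nm (f x) <= g x) ->
  (\int[mu]_x (g x)%:E < +oo)%E ->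
  nm (cint (f_ n) - cint f) @[n --> \oo] --> (0 : R).
Proof.
move=> mf_ mf mg f_f f_g fg gfin.
have g0 x : 0 <= g x by exact: le_trans (nm_ge0 _) (fg x).
have ig : mu.-integrable setT (EFin \o (fun x => g x + g x)).
  under [X in mu.-integrable _ X]eq_fun do rewrite /= EFinD.
  have ig : mu.-integrable setT (EFin \o g).
    apply/integrableP; split; first exact/measurable_EFinP.
    by under eq_integral do rewrite gee0_abs ?lee_fin//.
  exact: integrableD.
have h : (\int[mu]_x (nm (f_ n x - f x))%:E @[n --> \oo] -->
    \int[mu]_x (cst 0 x))%E.
  apply: (dominated_cvg _ _ _ _ ig) => //=.
  - by move=> n; apply: measurable_enm; exact: cmeasurableB.
  - by move=> x _; exact/cvg_EFin/f_f/nearW.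
  - move=> n x _; rewrite lee_fin ger0_norm ?nm_ge0//.
    by apply: le_trans (nmB _ _) _; rewrite lerD.
rewrite integral0 in h.
have fi n : cintegrable (f_ n) by exact: cintegrable_le gfin.
have fi' : cintegrable f by exact: cintegrable_le gfin.
have dfi n : cintegrable (fun x => f_ n x - f x).
  by apply: cintegrableD => //; exact: cintegrableN.
suff hE : ((nm (cint (f_ n) - cint f))%:E @[n --> \oo] --> (0 : R)%:E)%E.
  exact: (fine_cvg hE).
apply: (@squeeze_cvge _ _ _ _ (cst 0%E) _
  (fun n => \int[mu]_x (nm (f_ n x - f x))%:E)%E) => //; last exact: cvg_cst.
apply: nearW => n; apply/andP; split; first exact: enm_ge0.
by rewrite -cintB//; exact: nm_cint.
Qed.

End ComplexIntegral.

Section ParametricMeasurability.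
Context {R : realType} d1 d2 (T1 : measurableType d1) (T2 : measurableType d2).
Variables (m2 : {sigma_finite_measure set T2 -> \bar R}).

Lemma measurable_integral2 (F : T1 * T2 -> \bar R) : measurable_fun setT F ->
  measurable_fun setT (fun x => \int[m2]_y F (x, y))%E.
Proof.
move=> mF.
have -> : (fun x => \int[m2]_y F (x, y))%E =
    (fun x => \int[m2]_y F^\+ (x, y) - \int[m2]_y F^\- (x, y))%E.
  apply/funext=> x; rewrite [LHS]integralE.
  under eq_integral do rewrite funepos_comp/=.
  by under [X in (_ - X)%E = _]eq_integral do rewrite funeneg_comp/=.
have mp := measurable_funepos mF; have mn := measurable_funeneg mF.
apply: emeasurable_funB.
  by apply: (measurable_fun_fubini_tonelli_F (m2 := m2) F^\+%E mp).
by apply: (measurable_fun_fubini_tonelli_F (m2 := m2) F^\-%E mn).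
Qed.

Lemma measurable_Rintegral2 (f : T1 * T2 -> R) : measurable_fun setT f ->
  measurable_fun setT (fun x => Rintegral m2 setT (fun y => f (x, y))).
Proof.
move=> mf; have mF : measurable_fun setT (EFin \o f) by exact/measurable_EFinP.
exact: (measurableT_comp (@fine_measurable R _ measurableT)
  (measurable_integral2 mF)).
Qed.

Lemma cmeasurable_cint2 (f : T1 * T2 -> R[i]) : cmeasurable f ->
  cmeasurable (fun x => cint m2 (fun y => f (x, y))).
Proof.
by move=> [f1 f2]; split => /=; [exact: (measurable_Rintegral2 f1)|
  exact: (measurable_Rintegral2 f2)].
Qed.

End ParametricMeasurability.

Section ComplexFubini.
Context {R : realType} d1 d2 (T1 : measurableType d1) (T2 : measurableType d2).
Variables (m1 : {sigma_finite_measure set T1 -> \bar R}).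
Variables (m2 : {sigma_finite_measure set T2 -> \bar R}).

Lemma Rintegral_swap (f : T1 * T2 -> R) :
  (m1 \x m2)%E.-integrable setT (EFin \o f) ->
  Rintegral m1 setT (fun x => Rintegral m2 setT (fun y => f (x, y))) =
  Rintegral m2 setT (fun y => Rintegral m1 setT (fun x => f (x, y))).
Proof.
move=> fi; have mf : measurable_fun setT f.
  by apply/measurable_EFinP; case/integrableP : fi.
have e1 : (\int[m1]_x (Rintegral m2 setT (fun y => f (x, y)))%:E =
    \int[m1]_x \int[m2]_y (f (x, y))%:E)%E.
  apply: ae_eq_integral => //.
  - by apply/measurable_EFinP; exact: measurable_Rintegral2.
  - exact: (measurable_fubini_F fi).
  - apply: filterS (ae_integrable1 fi) => x ix _.
    by rewrite /Rintegral fineK//; exact: integrable_fin_num.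
have e2 : (\int[m2]_y (Rintegral m1 setT (fun x => f (x, y)))%:E =
    \int[m2]_y \int[m1]_x (f (x, y))%:E)%E.
  apply: ae_eq_integral => //.
  - apply/measurable_EFinP; apply: (measurable_Rintegral2 m1 (f := fun p => f (p.2, p.1))).
    apply: measurableT_comp => //; exact: measurable_fun_pair measurable_snd measurable_fst.
  - exact: (measurable_fubini_G fi).
  - apply: filterS (ae_integrable2 fi) => x ix _.
    by rewrite /Rintegral fineK//; exact: integrable_fin_num.
by rewrite /Rintegral e1 e2 (Fubini fi).
Qed.

Lemma cint_swap (f : T1 * T2 -> R[i]) : cmeasurable f ->
  (\int[m1]_x \int[m2]_y (nm (f (x, y)))%:E < +oo)%E ->
  cint m1 (fun x => cint m2 (fun y => f (x, y))) =
  cint m2 (fun y => cint m1 (fun x => f (x, y))).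
Proof.
move=> mf ffin.
have fi : cintegrable (m1 \x m2)%E f.
  split => //; rewrite /L1norm fubini_tonelli1//; first exact: measurable_enm.
  by move=> x; rewrite lee_fin nm_ge0.
have [f1 f2] := cintegrable_ReIm fi.
rewrite /cint; congr (_ +i* _).
  exact: (Rintegral_swap f1).
exact: (Rintegral_swap f2).
Qed.

End ComplexFubini.

(** * The convolution algebra of exponentially decaying functions *)

Lemma integralZ_EFin (R : realType) d (T : measurableType d)
    (mu : {measure set T -> \bar R}) (c : R) (g : T -> R) : 0 <= c ->
  measurable_fun setT g -> (forall x, 0 <= g x) ->
  (\int[mu]_x (c * g x)%:E = c%:E * \int[mu]_x (g x)%:E)%E.
Proof.
move=> c0 mg g0; under eq_integral do rewrite EFinM.
rewrite ge0_integralZl//; first exact/measurable_EFinP.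
by move=> x _; rewrite lee_fin.
Qed.

(** What the argument uses of the frequency measure: [S] is the group of
    frequencies that [mu] sees, and [mu] is invariant under translations by [S]
    and under reflection. *)
Record frequency_measure (R : realType) (mu : set R -> \bar R) (S : set R) := {
  freq_null : {ae mu, forall x, S x};
  freq_shift : forall (c : R) (f : R -> \bar R), S c -> measurable_fun setT f ->
    (forall x, 0 <= f x)%E ->
    (\int[mu]_x f (x - c)%R = \int[mu]_x f x)%E;
  freq_refl : forall f : R -> \bar R, measurable_fun setT f ->
    (forall x, 0 <= f x)%E -> (\int[mu]_x f (- x)%R = \int[mu]_x f x)%E;
  freq_exp : forall k : R, 0 < k ->
    (\int[mu]_x (expR (- (k * `|x|)))%:E < +oo)%E }.

Section Convolution.
Context {R : realType}.
Variables (mu : {sigma_finite_measure set R -> \bar R}) (S : set R).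
Hypothesis muS : frequency_measure mu S.
Implicit Types (f g h w : R -> R[i]) (k A B x : R).

Definition wt k x : R := expR (k * `|x|).

Lemma wt_gt0 k x : 0 < wt k x. Proof. exact: expR_gt0. Qed.
Lemma wt_ge0 k x : 0 <= wt k x. Proof. exact/ltW/wt_gt0. Qed.

Lemma wt_ge1 k x : 0 <= k -> 1 <= wt k x.
Proof. by move=> k0; rewrite /wt -expR0 ler_expR mulr_ge0. Qed.

Lemma wtN k x : wt k (- x) = wt k x.
Proof. by rewrite /wt normrN. Qed.

Lemma wt_sub k x b : 0 <= k -> wt k x <= wt k (x - b) * wt k b.
Proof.
move=> k0; rewrite /wt -expRD ler_expR -mulrDr ler_wpM2l//.
by rewrite -{1}(subrK b x) ler_normD.
Qed.

Lemma measurable_wt k : measurable_fun setT (wt k).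
Proof.
apply: (@measurableT_comp _ _ _ _ _ _ (@expR R)) => //.
exact: measurable_funM.
Qed.

(** [A] bounds the weighted supremum of [f] and [B] its weighted L1 norm. *)
Definition nrm k A B f : Prop := [/\ cmeasurable f,
  forall x, wt k x * nm (f x) <= A &
  (\int[mu]_x (wt k x * nm (f x))%:E <= B%:E)%E].

Definition convol f g x : R[i] := cint mu (fun b => f (x - b) * g b).
Definition tilde f x : R[i] := conjC (f (- x)).
Definition phys f x : R[i] := cint mu (fun xi => f xi * cexpi (x * xi)).

Lemma measurable_wnm k f : cmeasurable f ->
  measurable_fun setT (fun x => wt k x * nm (f x)).
Proof.
by move=> mf; apply: measurable_funM; [exact: measurable_wt|exact: measurable_nm].
Qed.

Lemma wnm_ge0 k x (z : R[i]) : 0 <= wt k x * nm z.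
Proof. by rewrite mulr_ge0 ?wt_ge0 ?nm_ge0. Qed.

Lemma nrm_A0 k A B f : nrm k A B f -> 0 <= A.
Proof. by move=> [_ h _]; apply: le_trans (wnm_ge0 k 0 (f 0)) (h 0). Qed.

Lemma nrm_B0 k A B f : nrm k A B f -> 0 <= B.
Proof.
move=> [_ _ h]; rewrite -lee_fin; apply: le_trans h.
by apply: integral_ge0 => x _; rewrite lee_fin wnm_ge0.
Qed.

Lemma nrm_le k A B A' B' f : A <= A' -> B <= B' -> nrm k A B f -> nrm k A' B' f.
Proof.
move=> AA BB [mf fA fB]; split => //; first by move=> x; apply: le_trans AA.
by apply: le_trans fB _; rewrite lee_fin.
Qed.

Lemma nrm_wt_le k k' A B f : k' <= k -> nrm k A B f -> nrm k' A B f.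
Proof.
move=> kk [mf fA fB].
have h x : wt k' x * nm (f x) <= wt k x * nm (f x).
  by rewrite ler_wpM2r ?nm_ge0// /wt ler_expR ler_wpM2r.
split => //; first by move=> x; apply: le_trans (h x) (fA x).
apply: le_trans fB; apply: ge0_le_integral => //.
- by move=> x _; rewrite lee_fin wnm_ge0.
- by apply/measurable_EFinP; exact: measurable_wnm.
- by apply/measurable_EFinP; exact: measurable_wnm.
- by move=> x _; rewrite lee_fin.
Qed.

Lemma nm_le_wt k f x : 0 <= k -> nm (f x) <= wt k x * nm (f x).
Proof. by move=> k0; rewrite ler_peMl// wt_ge1. Qed.

Lemma nrm_sup k A B f : 0 <= k -> nrm k A B f -> forall x, nm (f x) <= A.
Proof. by move=> k0 [_ h _] x; apply: le_trans (nm_le_wt _ _ k0) (h x). Qed.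

Lemma nrm_L1 k A B f : 0 <= k -> nrm k A B f -> (L1norm mu f <= B%:E)%E.
Proof.
move=> k0 [mf _ h]; apply: le_trans h; apply: le_L1norm => //.
  exact: measurable_wnm.
by move=> x; exact: nm_le_wt.
Qed.

Lemma nrm_cintegrable k A B f : 0 <= k -> nrm k A B f -> cintegrable mu f.
Proof.
move=> k0 hf; split; first by case: hf.
by apply: le_lt_trans (nrm_L1 k0 hf) _; rewrite ltry.
Qed.

Lemma nrmD k A B A' B' f g : nrm k A B f -> nrm k A' B' g ->
  nrm k (A + A') (B + B') (fun x => f x + g x).
Proof.
move=> [mf fA fB] [mg gA gB]; have mfg := cmeasurableD mf mg.
have h x : wt k x * nm (f x + g x) <= wt k x * nm (f x) + wt k x * nm (g x).
  by rewrite -mulrDr ler_wpM2l ?wt_ge0 ?nmD.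
split => //; first by move=> x; apply: le_trans (h x) _; rewrite lerD.
rewrite EFinD; apply: le_trans (leeD fB gB).
rewrite -ge0_integralD//; first last.
- by apply/measurable_EFinP; exact: measurable_wnm.
- by move=> x _; rewrite lee_fin wnm_ge0.
- by apply/measurable_EFinP; exact: measurable_wnm.
- by move=> x _; rewrite lee_fin wnm_ge0.
apply: ge0_le_integral => //.
- by move=> x _; rewrite lee_fin wnm_ge0.
- by apply/measurable_EFinP; exact: measurable_wnm.
- by apply: emeasurable_funD; apply/measurable_EFinP; exact: measurable_wnm.
- by move=> x _; rewrite -EFinD lee_fin.
Qed.

(** Multiplication by a measurable function of modulus at most one does not
    increase the norms. *)
Lemma nrm_mul k A B f (m : R -> R[i]) : cmeasurable m ->
  (forall x, nm (m x) <= 1) -> nrm k A B f -> nrm k A B (fun x => m x * f x).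
Proof.
move=> mm m1 [mf fA fB]; have mmf := cmeasurableM mm mf.
have h x : wt k x * nm (m x * f x) <= wt k x * nm (f x).
  by rewrite nmM ler_wpM2l ?wt_ge0// ler_piMl ?nm_ge0// m1.
split => //; first by move=> x; apply: le_trans (h x) (fA x).
apply: le_trans fB; apply: ge0_le_integral => //.
- by move=> x _; rewrite lee_fin wnm_ge0.
- by apply/measurable_EFinP; exact: measurable_wnm.
- by apply/measurable_EFinP; exact: measurable_wnm.
- by move=> x _; rewrite lee_fin.
Qed.

Lemma nrmN k A B f : nrm k A B f -> nrm k A B (fun x => - f x).
Proof.
move=> hf; have -> : (fun x => - f x) = (fun x => (-1) * f x).
  by apply/funext => x; rewrite mulN1r.
apply: (nrm_mul (m := fun=> -1)) hf; first exact: cmeasurable_cst.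
by move=> x; rewrite nmN nm1.
Qed.

Lemma nrmB k A B A' B' f g : nrm k A B f -> nrm k A' B' g ->
  nrm k (A + A') (B + B') (fun x => f x - g x).
Proof. by move=> hf hg; apply: nrmD hf _; exact: nrmN. Qed.

Lemma nrm_tilde k A B f : nrm k A B f -> nrm k A B (tilde f).
Proof.
move=> [mf fA fB]; split.
- apply: cmeasurable_conj; apply: cmeasurable_comp mf _.
  exact: oppr_measurable.
- by move=> x; rewrite /tilde nm_conj -wtN.
rewrite /tilde; under eq_integral do rewrite nm_conj -wtN.
rewrite (freq_refl muS (f := fun x => (wt k x * nm (f x))%:E))//.
- by apply/measurable_EFinP; exact: measurable_wnm.
- by move=> x; rewrite lee_fin wnm_ge0.
Qed.

Lemma cmeasurable_shift f x : cmeasurable f -> cmeasurable (fun b : R => f (x - b)).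
Proof.
move=> mf; apply: cmeasurable_comp mf _.
exact: measurable_funB.
Qed.

Lemma conv_integrable k A B A' B' f g x : 0 <= k -> nrm k A B f ->
  nrm k A' B' g -> cintegrable mu (fun b => f (x - b) * g b).
Proof.
move=> k0 hf hg; have [mf fA _] := hf; have [mg _ gB] := hg.
apply: (@cintegrable_le _ _ _ _ _ (fun b => A * nm (g b))).
- by apply: cmeasurableM => //; exact: cmeasurable_shift.
- by apply: measurable_funM => //; exact: measurable_nm.
- by move=> b; rewrite nmM ler_wpM2r ?nm_ge0// (nrm_sup k0 hf).
rewrite integralZ_EFin ?(nrm_A0 hf)//; last 2 first.
- exact: measurable_nm.
- by move=> b; exact: nm_ge0.
apply: lte_mul_pinfty; rewrite ?lee_fin ?(nrm_A0 hf)//.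
by apply: le_lt_trans (nrm_L1 k0 hg) _; rewrite ltry.
Qed.

Lemma cmeasurable_conv2 d (T : measurableType d) (f g : T * R -> R[i]) :
  cmeasurable f -> cmeasurable g ->
  cmeasurable (fun p : T * R =>
    convol (fun y => f (p.1, y)) (fun y => g (p.1, y)) p.2).
Proof.
move=> mf mg.
apply: (cmeasurable_cint2 mu (f := fun q : (T * R) * R =>
  f (q.1.1, q.1.2 - q.2) * g (q.1.1, q.2))).
have m11 : measurable_fun setT (fun q : (T * R) * R => q.1.1).
  by apply: (measurableT_comp measurable_fst); exact: measurable_fst.
have m12 : measurable_fun setT (fun q : (T * R) * R => q.1.2).
  by apply: (measurableT_comp measurable_snd); exact: measurable_fst.
apply: cmeasurableM.
- apply: (cmeasurable_comp mf); apply: measurable_fun_pair => //.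
  by apply: measurable_funB.
- by apply: (cmeasurable_comp mg); exact: measurable_fun_pair.
Qed.

Lemma cmeasurable_conv f g : cmeasurable f -> cmeasurable g ->
  cmeasurable (convol f g).
Proof.
move=> mf mg.
apply: (cmeasurable_cint2 mu (f := fun q : R * R => f (q.1 - q.2) * g q.2)).
apply: cmeasurableM; first by apply: (cmeasurable_comp mf); exact: measurable_funB.
exact: (cmeasurable_comp mg).
Qed.

(** Tonelli's theorem, and invariance under the translation by almost every
    second variable. *)
Lemma integral_conv (F G : R -> R) : measurable_fun setT F ->
  measurable_fun setT G -> (forall x, 0 <= F x) -> (forall x, 0 <= G x) ->
  (\int[mu]_x \int[mu]_b (F (x - b) * G b)%:E =
   \int[mu]_x (F x)%:E * \int[mu]_x (G x)%:E)%E.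
Proof.
move=> mF mG F0 G0.
have mQ : measurable_fun setT (fun p : R * R => (F (p.1 - p.2) * G p.2)%:E).
  apply/measurable_EFinP; apply: measurable_funM.
    apply: (measurableT_comp mF); apply: measurable_funB;
      [exact: measurable_fst|exact: measurable_snd].
  apply: (measurableT_comp mG); exact: measurable_snd.
rewrite (fubini_tonelli _ mQ)/=; last by move=> p; rewrite lee_fin mulr_ge0.
have mxF y : measurable_fun setT (fun x : R => (F (x - y))%:E).
  by apply/measurable_EFinP; apply: measurableT_comp => //; exact: measurable_funB.
rewrite (_ : (\int[mu]_y _ = \int[mu]_y ((\int[mu]_x (F x)%:E) * (G y)%:E))%E).
  rewrite ge0_integralZl//; first last.
  - by apply: integral_ge0 => x _; rewrite lee_fin.
  - by move=> x _; rewrite lee_fin.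
  - exact/measurable_EFinP.
apply: ae_eq_integral => //.
- apply: (measurable_fun_fubini_tonelli_G (m1 := mu) _ mQ) => p.
  by rewrite lee_fin mulr_ge0.
- by apply: emeasurable_funM => //; exact/measurable_EFinP.
apply: filterS (freq_null muS) => y Sy _.
under eq_integral do rewrite EFinM.
rewrite ge0_integralZr//; first last.
- by rewrite lee_fin.
- by move=> x _; rewrite lee_fin.
rewrite (freq_shift muS (f := EFin \o F))//; exact/measurable_EFinP.
Qed.

(** Young's inequality: the weights are submultiplicative, so the weighted norms
    are submultiplicative for the convolution. *)
Lemma nrm_conv k A B A' B' f g : 0 <= k -> nrm k A B f -> nrm k A' B' g ->
  nrm k (A * B') (B * B') (convol f g).
Proof.
move=> k0 hf hg; have [mf fA fB] := hf; have [mg gA gB] := hg.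
pose F x := wt k x * nm (f x); pose G x := wt k x * nm (g x).
have mF : measurable_fun setT F by exact: measurable_wnm.
have mG : measurable_fun setT G by exact: measurable_wnm.
have F0 x : 0 <= F x by exact: wnm_ge0.
have G0 x : 0 <= G x by exact: wnm_ge0.
have mFG x : measurable_fun setT (fun b : R => (F (x - b) * G b)%:E).
  apply/measurable_EFinP; apply: measurable_funM => //.
  by apply: measurableT_comp => //; exact: measurable_funB.
have h x : ((wt k x * nm (convol f g x))%:E <= \int[mu]_b (F (x - b) * G b)%:E)%E.
  rewrite EFinM; apply: (@le_trans _ _ ((wt k x)%:E *
      \int[mu]_b (nm (f (x - b) * g b))%:E)%E).
    by rewrite lee_pmul2l ?lte_fin ?wt_gt0// nm_cint//; exact: conv_integrable hf hg.
  have mfg : cmeasurable (fun b : R => f (x - b) * g b).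
    by apply: cmeasurableM => //; exact: cmeasurable_shift.
  rewrite -integralZ_EFin ?wt_ge0//; last 2 first.
  - exact: measurable_nm.
  - by move=> b; exact: nm_ge0.
  apply: ge0_le_integral => //.
  - by move=> b _; rewrite lee_fin wnm_ge0.
  - apply/measurable_EFinP; apply: measurable_funM => //; exact: measurable_nm.
  - move=> b _; rewrite lee_fin nmM /F /G mulrACA ler_wpM2r ?mulr_ge0 ?nm_ge0//.
    exact: wt_sub.
split; first exact: cmeasurable_conv.
- move=> x; rewrite -lee_fin; apply: le_trans (h x) _.
  apply: (@le_trans _ _ (A%:E * \int[mu]_b (G b)%:E)%E); last first.
    by rewrite EFinM lee_wpmul2l// lee_fin (nrm_A0 hf).
  rewrite -integralZ_EFin ?(nrm_A0 hf)//.
  apply: ge0_le_integral => //.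
  - by move=> b _; rewrite lee_fin mulr_ge0.
  - by apply/measurable_EFinP; exact: measurable_funM.
  - by move=> b _; rewrite lee_fin ler_wpM2r// fA.
apply: (@le_trans _ _ (\int[mu]_x \int[mu]_b (F (x - b) * G b)%:E)%E).
  apply: ge0_le_integral => //.
  - by move=> x _; rewrite lee_fin wnm_ge0.
  - by apply/measurable_EFinP; apply: measurable_wnm; exact: cmeasurable_conv.
  - apply: (measurable_fun_fubini_tonelli_F (m2 := mu)
      (fun p : R * R => (F (p.1 - p.2) * G p.2)%:E)) => [|p]; last by rewrite lee_fin mulr_ge0.
    apply/measurable_EFinP; apply: measurable_funM.
      apply: (measurableT_comp mF); apply: measurable_funB;
      [exact: measurable_fst|exact: measurable_snd].
    apply: (measurableT_comp mG); exact: measurable_snd.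
rewrite (integral_conv mF mG F0 G0) EFinM; apply: lee_pmul => //;
  apply: integral_ge0 => x _; by rewrite lee_fin.
Qed.

Lemma cint_ae f g : cmeasurable f -> cmeasurable g ->
  {ae mu, forall x, f x = g x} -> cint mu f = cint mu g.
Proof.
move=> [f1 f2] [g1 g2] fg; rewrite /cint /Rintegral; congr (fine _ +i* fine _).
  apply: ae_eq_integral => //; [exact/measurable_EFinP|exact/measurable_EFinP|].
  by apply: filterS fg => x -> _.
apply: ae_eq_integral => //; [exact/measurable_EFinP|exact/measurable_EFinP|].
by apply: filterS fg => x -> _.
Qed.

Lemma integral_shift (c : R) (F : R -> \bar R) : S c -> measurable_fun setT F ->
  (\int[mu]_x F (x - c)%R = \int[mu]_x F x)%E.
Proof.
move=> Sc mF; rewrite [RHS]integralE [LHS]integralE.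
have mp := measurable_funepos mF; have mn := measurable_funeneg mF.
congr (_ - _)%E; first by rewrite -(freq_shift muS Sc mp (funepos_ge0 F));
    apply: eq_integral => x _; rewrite funepos_comp.
by rewrite -(freq_shift muS Sc mn (funeneg_ge0 F));
  apply: eq_integral => x _; rewrite funeneg_comp.
Qed.

Lemma integral_refl (F : R -> \bar R) : measurable_fun setT F ->
  (\int[mu]_x F (- x)%R = \int[mu]_x F x)%E.
Proof.
move=> mF; rewrite [RHS]integralE [LHS]integralE.
have mp := measurable_funepos mF; have mn := measurable_funeneg mF.
congr (_ - _)%E; first by rewrite -(freq_refl muS mp (funepos_ge0 F));
    apply: eq_integral => x _; rewrite funepos_comp.
by rewrite -(freq_refl muS mn (funeneg_ge0 F));
  apply: eq_integral => x _; rewrite funeneg_comp.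
Qed.

Lemma cint_shift c f : S c -> cmeasurable f ->
  cint mu (fun x => f (x - c)) = cint mu f.
Proof.
move=> Sc [f1 f2]; rewrite /cint /Rintegral; congr (fine _ +i* fine _).
  by apply: (integral_shift Sc (F := fun x => (complex.Re (f x))%:E));
    exact/measurable_EFinP.
by apply: (integral_shift Sc (F := fun x => (complex.Im (f x))%:E));
  exact/measurable_EFinP.
Qed.

Lemma cint_refl f : cmeasurable f -> cint mu (fun x => f (- x)) = cint mu f.
Proof.
move=> [f1 f2]; rewrite /cint /Rintegral; congr (fine _ +i* fine _).
  by apply: (integral_refl (F := fun x => (complex.Re (f x))%:E));
    exact/measurable_EFinP.
by apply: (integral_refl (F := fun x => (complex.Im (f x))%:E));
  exact/measurable_EFinP.
Qed.

Lemma cmeasurable_character x : cmeasurable (fun xi : R => cexpi (x * xi)).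
Proof. by apply: cmeasurable_cexpi; exact: measurable_funM. Qed.

Lemma phys_cintegrable f x : cintegrable mu f ->
  cintegrable mu (fun xi => f xi * cexpi (x * xi)).
Proof.
move=> [mf fi]; split.
  by apply: cmeasurableM => //; exact: cmeasurable_character.
by rewrite /L1norm; under eq_integral do rewrite nmM nm_cexpi mulr1.
Qed.

(** Convolution of amplitudes is multiplication of functions. *)
Lemma phys_conv k A B A' B' f g x : 0 <= k -> nrm k A B f -> nrm k A' B' g ->
  phys (convol f g) x = phys f x * phys g x.
Proof.
move=> k0 hf hg; have [mf _ _] := hf; have [mg _ _] := hg.
pose Q (q : R * R) := cexpi (x * q.1) * (f (q.1 - q.2) * g q.2).
have mQ : cmeasurable Q.
  apply: cmeasurableM; first by apply: cmeasurable_cexpi; exact: measurable_funM.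
  apply: cmeasurableM; first by apply: (cmeasurable_comp mf); exact: measurable_funB.
  exact: (cmeasurable_comp mg).
have fin : (\int[mu]_xi \int[mu]_b (nm (Q (xi, b)))%:E < +oo)%E.
  have fi := nrm_cintegrable k0 hf; have gi := nrm_cintegrable k0 hg.
  under eq_integral do under eq_integral do rewrite /Q nmM nm_cexpi mul1r nmM.
  rewrite (integral_conv (F := fun x => nm (f x)) (G := fun x => nm (g x)));
    [|exact: measurable_nm|exact: measurable_nm|move=> *; exact: nm_ge0..].
  apply: lte_mul_pinfty; [exact: L1norm_ge0| |by case: gi].
  by rewrite ge0_fin_numE; [case: fi|exact: L1norm_ge0].
transitivity (cint mu (fun xi => cint mu (fun b => Q (xi, b)))).
  apply: eq_cint => xi; rewrite mulrC /convol -cintZ//.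
  exact: conv_integrable hf hg.
rewrite cint_swap// [phys g x]/phys -cintZ; last first.
  exact/phys_cintegrable/(nrm_cintegrable k0 hg).
apply: cint_ae.
- apply: (cmeasurable_cint2 mu (f := fun p : R * R => Q (p.2, p.1))).
  by apply: (cmeasurable_comp mQ); exact: measurable_fun_pair.
- apply: cmeasurableM; first exact: cmeasurable_cst.
  by apply: cmeasurableM => //; exact: cmeasurable_character.
apply: filterS (freq_null muS) => b Sb.
have fi := phys_cintegrable x (nrm_cintegrable k0 hf).
have -> : phys f x = cint mu (fun xi => f (xi - b) * cexpi (x * (xi - b))).
  have mfe : cmeasurable (fun y => f y * cexpi (x * y)) by case: fi.
  exact: (esym (cint_shift Sb mfe)).
rewrite mulrC -cintZ; last first.
  have [mfe Lfe] := fi; split.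
    by apply: (cmeasurable_comp mfe (h := fun y : R => y - b)); exact: measurable_funB.
  by have := freq_shift muS Sb (measurable_enm mfe) (fun y => enm_ge0 _);
     rewrite /L1norm => ->.
apply: eq_cint => xi; rewrite /Q /= mulrBr cexpiD.
rewrite [in LHS](_ : cexpi (x * xi) =
  cexpi (x * xi) * (cexpi (x * b) * cexpi (- (x * b)))).
  ring.
by rewrite cexpiN mulr1.
Qed.

Lemma phys_tilde f x : cintegrable mu f -> phys (tilde f) x = conjC (phys f x).
Proof.
move=> fi; have [mf _] := fi; rewrite /phys -cint_conj; last exact: phys_cintegrable.
rewrite -[RHS]cint_refl; last first.
  by apply: cmeasurable_conj; apply: cmeasurableM => //; exact: cmeasurable_character.
by apply: eq_cint => xi; rewrite /tilde conjM conj_cexpi mulrN opprK.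
Qed.

Lemma convBl k A B A' B' A'' B'' f f' g x : 0 <= k -> nrm k A B f ->
  nrm k A' B' f' -> nrm k A'' B'' g ->
  convol (fun y => f y - f' y) g x = convol f g x - convol f' g x.
Proof.
move=> k0 hf hf' hg; rewrite /convol -cintB.
- by apply: eq_cint => b; rewrite mulrBl.
- exact: conv_integrable hf hg.
- exact: conv_integrable hf' hg.
Qed.

Lemma convBr k A B A' B' A'' B'' f g g' x : 0 <= k -> nrm k A B f ->
  nrm k A' B' g -> nrm k A'' B'' g' ->
  convol f (fun y => g y - g' y) x = convol f g x - convol f g' x.
Proof.
move=> k0 hf hg hg'; rewrite /convol -cintB.
- by apply: eq_cint => b; rewrite mulrBr.
- exact: conv_integrable hf hg.
- exact: conv_integrable hf hg'.
Qed.

(** The cubic nonlinearity on the frequency side. *)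
Definition tri f : R -> R[i] := convol (convol f f) (tilde f).

Lemma nrm_tri k A B f : 0 <= k -> nrm k A B f ->
  nrm k (A * B * B) (B * B * B) (tri f).
Proof.
by move=> k0 hf; exact: nrm_conv k0 (nrm_conv k0 hf hf) (nrm_tilde hf).
Qed.

(** Telescoping, one factor at a time. *)
Lemma nrm_tri_sub k A B A' B' f g : 0 <= k -> nrm k A B f -> nrm k A B g ->
  nrm k A' B' (fun x => f x - g x) ->
  nrm k (A' * B * B + 2 * (A * B * B')) (3 * (B * B * B'))
    (fun x => tri f x - tri g x).
Proof.
move=> k0 hf hg hfg; set d := fun x => f x - g x in hfg.
have hft := nrm_tilde hf; have hgt := nrm_tilde hg.
have t1 := nrm_conv k0 (nrm_conv k0 hfg hf) hft.
have t2 := nrm_conv k0 (nrm_conv k0 hg hfg) hft.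
have t3 := nrm_conv k0 (nrm_conv k0 hg hg) (nrm_tilde hfg).
have := nrmD (nrmD t1 t2) t3.
have -> : (fun x => convol (convol d f) (tilde f) x + convol (convol g d) (tilde f) x +
    convol (convol g g) (tilde d) x) = (fun x => tri f x - tri g x).
  apply/funext => x.
  have -> : convol d f = (fun y => convol f f y - convol g f y).
    by apply/funext => y; rewrite /d (convBl y k0 hf hg hf).
  have -> : convol g d = (fun y => convol g f y - convol g g y).
    by apply/funext => y; rewrite /d (convBr y k0 hg hf hg).
  have -> : tilde d = (fun y => tilde f y - tilde g y).
    by apply/funext => y; rewrite /tilde /d conjB.
  have hff := nrm_conv k0 hf hf; have hgf := nrm_conv k0 hg hf.
  have hgg := nrm_conv k0 hg hg.
  rewrite (convBl x k0 hff hgf hft) (convBl x k0 hgf hgg hft).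
  by rewrite (convBr x k0 hgg hft hgt) /tri !addrA !subrK.
by apply: nrm_le; rewrite le_eqVlt; apply/orP; left; apply/eqP; ring.
Qed.

Lemma phys_tri k A B f x : 0 <= k -> nrm k A B f ->
  phys (tri f) x = phys f x * phys f x * conjC (phys f x).
Proof.
move=> k0 hf; have hff := nrm_conv k0 hf hf.
rewrite /tri (phys_conv x k0 hff (nrm_tilde hf)) (phys_conv x k0 hf hf).
by rewrite phys_tilde//; exact: nrm_cintegrable hf.
Qed.

End Convolution.

(** * Picard iteration *)

Section TimeIntegral.
Context {R : realType}.
Variables (mu : {sigma_finite_measure set R -> \bar R}) (T : R).
Hypothesis T0 : 0 <= T.
Notation leb := (@lebesgue_measure R).
Implicit Types (g : R -> R[i]) (K t s : R).

(** Indicator of [0, min(t, T)], written so that it is visibly measurable in [s]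
    and [t] together. *)
Definition hv (x : R) : R := \1_`[0, +oo[%classic x.
Definition win t s : R := hv s * hv (Num.min t T - s).

(** The time integral from 0 to t, frozen outside of [0, T]. *)
Definition tint t g : R[i] := cint leb (fun s => (win t s)%:C * g s).

Lemma hvE x : hv x = (0 <= x)%R%:R.
Proof.
by rewrite /hv indicE mem_setE in_itv /= andbT.
Qed.

Lemma measurable_hv : measurable_fun setT hv.
Proof. exact: measurable_indic. Qed.

Lemma winE t s : win t s = ((0 <= s) && (s <= Num.min t T))%R%:R.
Proof. by rewrite /win !hvE subr_ge0; case: (0 <= s); rewrite ?mul0r ?mul1r. Qed.

Lemma win01 t s : 0 <= win t s <= 1.
Proof. by rewrite winE; case: ((0 <= s) && _); rewrite /= ?lexx ?ler01. Qed.

Lemma measurable_win t : measurable_fun setT (win t).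
Proof.
apply: measurable_funM; first exact: measurable_hv.
by apply: measurableT_comp; [exact: measurable_hv|exact: measurable_funB].
Qed.

Lemma win_indic t : win t = \1_(`[0, Num.min t T]%classic).
Proof.
by apply/funext => s; rewrite winE indicE mem_setE in_itv.
Qed.

Lemma integral_win t : (\int[leb]_s (win t s)%:E <= T%:E)%E.
Proof.
rewrite win_indic integral_indic// setIT /= lebesgue_measure_itv /=.
case: ifPn => _; last by rewrite lee_fin.
by rewrite -EFinB lee_fin subr0 ge_min lexx orbT.
Qed.

Lemma cmeasurable_win t g : cmeasurable g ->
  cmeasurable (fun s => (win t s)%:C * g s).
Proof.
by move=> mg; apply: cmeasurableM => //; apply: cmeasurable_real; exact: measurable_win.
Qed.

Lemma nm_win t s (z : R[i]) : nm ((win t s)%:C * z) = win t s * nm z.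
Proof. by rewrite nmM nm_real ger0_norm//; case/andP: (win01 t s). Qed.

Lemma tint_L1 t g K : cmeasurable g -> 0 <= K -> (forall s, nm (g s) <= K) ->
  (L1norm leb (fun s => ((win t s)%:C * g s)%R) <= (T * K)%:E)%E.
Proof.
move=> mg K0 gK.
apply: (@le_trans _ _ (\int[leb]_s (K * win t s)%:E)%E).
  apply: le_L1norm; first exact: cmeasurable_win.
    by apply: measurable_funM => //; exact: measurable_win.
  move=> s; rewrite nm_win mulrC ler_wpM2r//.
  by case/andP: (win01 t s).
rewrite integralZ_EFin//; [|exact: measurable_win|by move=> s; case/andP: (win01 t s)].
by rewrite mulrC EFinM lee_wpmul2l ?lee_fin// integral_win.
Qed.

Lemma tint_cintegrable t g K : cmeasurable g -> 0 <= K ->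
  (forall s, nm (g s) <= K) -> cintegrable leb (fun s => (win t s)%:C * g s).
Proof.
move=> mg K0 gK; split; first exact: cmeasurable_win.
by apply: le_lt_trans (tint_L1 t mg K0 gK) _; rewrite ltry.
Qed.

Lemma nm_tint t g K : cmeasurable g -> 0 <= K -> (forall s, nm (g s) <= K) ->
  nm (tint t g) <= T * K.
Proof.
by move=> mg K0 gK; apply: nm_cint_le; [exact: cmeasurable_win|exact: tint_L1].
Qed.

Lemma tintB t g g' K : cmeasurable g -> cmeasurable g' -> 0 <= K ->
  (forall s, nm (g s) <= K) -> (forall s, nm (g' s) <= K) ->
  tint t (fun s => g s - g' s) = tint t g - tint t g'.
Proof.
move=> mg mg' K0 gK gK'; rewrite /tint -cintB.
- by apply: eq_cint => s; rewrite mulrBr.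
- exact: tint_cintegrable gK.
- exact: tint_cintegrable gK'.
Qed.

Lemma cmeasurable_tint2 (g : R -> R -> R[i]) :
  cmeasurable (fun p : R * R => g p.1 p.2) ->
  cmeasurable (fun p : R * R => tint p.1 (g ^~ p.2)).
Proof.
move=> mg.
apply: (cmeasurable_cint2 leb (f := fun q : (R * R) * R =>
  (win q.1.1 q.2)%:C * g q.2 q.1.2)).
have m11 : measurable_fun setT (fun q : (R * R) * R => q.1.1).
  by apply: (measurableT_comp measurable_fst); exact: measurable_fst.
have m12 : measurable_fun setT (fun q : (R * R) * R => q.1.2).
  by apply: (measurableT_comp measurable_snd); exact: measurable_fst.
apply: cmeasurableM.
  apply: cmeasurable_real; apply: measurable_funM.
    exact: (measurableT_comp measurable_hv).
  apply: (measurableT_comp measurable_hv); apply: measurable_funB => //.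
  exact: measurable_minr.
apply: (cmeasurable_comp mg (h := fun q : (R * R) * R => (q.2, q.1.2))).
exact: measurable_fun_pair.
Qed.

(** Minkowski's integral inequality for the weighted norms, by Tonelli. *)
Lemma nrm_tint k A B t (g : R -> R -> R[i]) :
  cmeasurable (fun p : R * R => g p.1 p.2) -> (forall s, nrm mu k A B (g s)) ->
  nrm mu k (T * A) (T * B) (fun x => tint t (g ^~ x)).
Proof.
move=> mg hg.
have mgs x : cmeasurable (g ^~ x).
  by apply: (cmeasurable_comp mg (h := fun s : R => (s, x))); exact: measurable_fun_pair.
have A0 : 0 <= A by exact: nrm_A0 (hg 0).
have gb x s : nm (g s x) <= A / wt k x.
  by rewrite ler_pdivlMr ?wt_gt0// mulrC; case: (hg s).
have Aw x : 0 <= A / wt k x by rewrite divr_ge0 ?wt_ge0.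
have mt : cmeasurable (fun x => tint t (g ^~ x)).
  apply: (cmeasurable_comp (cmeasurable_tint2 mg) (h := fun x : R => (t, x))).
  exact: measurable_fun_pair.
split => //.
  move=> x; rewrite mulrC -ler_pdivlMr ?wt_gt0// -mulrA.
  exact: nm_tint.
pose Q (p : R * R) := (win t p.1 * (wt k p.2 * nm (g p.1 p.2)))%:E.
have mQ : measurable_fun setT Q.
  apply/measurable_EFinP; apply: measurable_funM.
    exact: (measurableT_comp (measurable_win t)).
  apply: measurable_funM; last exact: measurable_nm.
  exact: (measurableT_comp (measurable_wt k)).
have Q0 p : (0 <= Q p)%E.
  by rewrite lee_fin mulr_ge0 ?wnm_ge0//; case/andP: (win01 t p.1).
apply: (@le_trans _ _ (\int[mu]_x \int[leb]_s Q (s, x))%E).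
  apply: ge0_le_integral => //.
  - by move=> x _; rewrite lee_fin wnm_ge0.
  - by apply/measurable_EFinP; exact: measurable_wnm.
  - exact: (measurable_fun_fubini_tonelli_G (m1 := leb) Q mQ Q0).
  - move=> x _; rewrite EFinM /Q /=.
    apply: (@le_trans _ _ ((wt k x)%:E *
        \int[leb]_s (nm ((win t s)%:C * g s x))%:E)%E).
      rewrite lee_pmul2l ?lte_fin ?wt_gt0//; apply: nm_cint.
      exact: tint_cintegrable (gb x).
    rewrite -integralZ_EFin ?wt_ge0//; first last.
    + by move=> s; exact: nm_ge0.
    + by apply: measurable_nm; exact: cmeasurable_win.
    rewrite le_eqVlt; apply/orP; left; apply/eqP; apply: eq_integral => s _.
    by rewrite nm_win mulrCA.
have -> : (\int[mu]_x \int[leb]_s Q (s, x) = \int[leb]_s \int[mu]_x Q (s, x))%E.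
  exact: esym (fubini_tonelli (m1 := leb) (m2 := mu) Q mQ Q0).
rewrite /Q /=; apply: (@le_trans _ _ (\int[leb]_s (B * win t s)%:E)%E).
  have w0 s : 0 <= win t s by case/andP: (win01 t s).
  apply: ge0_le_integral => //.
  - by move=> s _; apply: integral_ge0 => x _; exact: (Q0 (s, x)).
  - exact: (measurable_fun_fubini_tonelli_F (m2 := mu) Q mQ Q0).
  - by apply/measurable_EFinP; apply: measurable_funM => //; exact: measurable_win.
  - move=> s _; rewrite integralZ_EFin//.
    + rewrite [B * _]mulrC [X in (_ <= X)%E]EFinM lee_wpmul2l ?lee_fin//; by case: (hg s).
    + by apply: measurable_wnm; case: (hg s).
    + by move=> x; exact: wnm_ge0.
rewrite integralZ_EFin ?(nrm_B0 (hg 0))//; last 2 first.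
- exact: measurable_win.
- by move=> s; case/andP: (win01 t s).
by rewrite [T * B]mulrC EFinM lee_wpmul2l ?lee_fin ?(nrm_B0 (hg 0))// integral_win.
Qed.

Lemma tint_lip t t' g K0 K : cmeasurable g -> (forall s, nm (g s) <= K0) ->
  (forall s, `|s - t| <= `|t - t'| -> nm (g s) <= K) ->
  nm (tint t g - tint t' g) <= K * `|t - t'|.
Proof.
move=> mg gK0 gK; have K0' : 0 <= K0 by exact: le_trans (nm_ge0 _) (gK0 0).
have Kp : 0 <= K by apply: le_trans (nm_ge0 _) (gK t _); rewrite subrr normr0.
pose a := Num.min t t'; pose b := Num.max t t'.
have ab : b - a = `|t - t'|.
  by rewrite /a /b; case: (leP t t') => h; [rewrite ler0_norm|rewrite gtr0_norm]; lra.
rewrite /tint -cintB; [|exact: tint_cintegrable gK0|exact: tint_cintegrable gK0].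
have mi : measurable_fun setT (fun s : R => \1_(`[a, b]%classic) s : R).
  exact: measurable_indic.
apply: nm_cint_le; first by apply: cmeasurableB; exact: cmeasurable_win.
apply: (@le_trans _ _ (\int[leb]_s (K * \1_(`[a, b]%classic) s)%:E)%E).
  apply: le_L1norm.
  - by apply: cmeasurableB; exact: cmeasurable_win.
  - exact: measurable_funM.
  move=> s; rewrite -mulrBl nmM mulrC -rmorphB nm_real.
  have [sab|sab] := boolP (s \in `[a, b]).
    rewrite indicE mem_setE sab ler_pM ?nm_ge0//.
      apply: gK; move: sab; rewrite in_itv /= /a /b.
      by case: (leP t t') => h /andP[h1 h2]; rewrite ler_norml;
        [rewrite ler0_norm|rewrite gtr0_norm]; lra.
    rewrite !winE; case: (_ && _); case: (_ && _);
    by rewrite /= ?subrr ?subr0 ?sub0r ?normrN ?normr0 ?normr1 ?ler01.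
  rewrite indicE mem_setE (negbTE sab) mulr0.
  suff -> : win t s = win t' s by rewrite subrr normr0 mulr0.
  move: sab; rewrite in_itv /= !winE !le_min /a /b.
  case: (leP t t') => h; rewrite negb_and -!ltNge => /orP[h'|h'];
  case: (leP s t) => h1; case: (leP s t') => h2 //=; lra.
rewrite integralZ_EFin// integral_indic// setIT /= lebesgue_measure_itv /=.
case: ifPn => _; first by rewrite -EFinB -EFinM lee_fin ab.
by rewrite mule0 lee_fin mulr_ge0.
Qed.

Lemma tint_cst t (c : R[i]) : 0 <= t <= T -> tint t (fun=> c) = t%:C * c.
Proof.
move=> /andP[t0 tT].
have wi : cintegrable leb (fun s => (win t s)%:C * 1).
  apply: (tint_cintegrable t (g := fun=> 1) _ ler01); first exact: cmeasurable_cst.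
  by move=> s; rewrite nm1.
have -> : tint t (fun=> c) = cint leb (fun s => (win t s)%:C * 1) * c.
  rewrite [RHS]mulrC -cintZ//; apply: eq_cint => s; rewrite mulr1; ring.
congr (_ * _); rewrite /cint /=; under eq_Rintegral do rewrite mulr1 mul0r subr0.
under [X in _ +i* X]eq_Rintegral do rewrite mulr0 mul0r addr0.
rewrite /Rintegral integral0 win_indic integral_indic// setIT.
rewrite /= lebesgue_measure_itv /= (min_idPl tT).
congr (_ +i* _); rewrite lte_fin; case: ltP => h /=; first by rewrite oppr0 addr0.
by apply/eqP; rewrite eq_le t0 h.
Qed.

(** Freezing the integrand at an endpoint: the error is the oscillation of the
    integrand times the length of the interval. *)
Lemma tint_taylor t t' g K L : 0 <= t <= T -> 0 <= t' <= T -> cmeasurable g ->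
  (forall s, nm (g s) <= K) -> 0 <= L ->
  (forall s, nm (g s - g t) <= L * `|s - t|) ->
  nm (tint t' g - tint t g - (t' - t)%:C * g t) <= L * `|t' - t| ^+ 2.
Proof.
move=> tT tT' mg gK L0 gL; have K0 : 0 <= K by exact: le_trans (nm_ge0 _) (gK 0).
have mc : cmeasurable (fun _ : R => g t) by exact: cmeasurable_cst.
have -> : tint t' g - tint t g - (t' - t)%:C * g t =
    - (tint t (fun s => g s - g t) - tint t' (fun s => g s - g t)).
  rewrite !(tintB _ mg mc K0)// !tint_cst// rmorphB mulrBl; ring.
rewrite nmN expr2 mulrA distrC; apply: (@tint_lip _ _ _ (K + K)).
- exact: cmeasurableB.
- by move=> s; apply: le_trans (nmB _ _) _; rewrite lerD.
- by move=> s h; apply: le_trans (gL s) _; rewrite ler_wpM2l.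
Qed.

End TimeIntegral.

(** * Sequential continuity of complex-valued functions *)

Section SequentialContinuity.
Context {R : realType}.
Implicit Types (f g : R -> R[i]).

Definition ccvg (z_ : nat -> R[i]) (z : R[i]) : Prop := nm (z_ n - z) @[n --> \oo] --> (0 : R).

Definition seqc f : Prop := forall (x_ : R^nat) (x : R),
  x_ n @[n --> \oo] --> x -> ccvg (f \o x_) (f x).

Lemma cvg0_le (a b : R^nat) : (forall n, 0 <= a n <= b n) ->
  b n @[n --> \oo] --> (0 : R) -> a n @[n --> \oo] --> (0 : R).
Proof.
move=> ab hb.
by apply: (squeeze_cvgr _ (cvg_cst (0 : R)) hb); apply: nearW => n; exact: ab.
Qed.

Lemma ccvgP z_ z : ccvg z_ z <->
  (complex.Re (z_ n) @[n --> \oo] --> complex.Re z) /\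
  (complex.Im (z_ n) @[n --> \oo] --> complex.Im z).
Proof.
split; first exact: cvg_ReIm.
move=> [h1 h2].
apply: (@cvg0_le _ (fun n => `|complex.Re (z_ n) - complex.Re z| +
                             `|complex.Im (z_ n) - complex.Im z|)).
  move=> n; rewrite nm_ge0 /=; apply: le_trans (nm_le_ReIm _) _.
  by rewrite cReD cImD cReN cImN.
rewrite -[X in _ --> X]addr0; apply: cvgD.
  have := cvg_norm (cvgB h1 (cvg_cst (complex.Re z))); rewrite subrr normr0; exact.
have := cvg_norm (cvgB h2 (cvg_cst (complex.Im z))); rewrite subrr normr0; exact.
Qed.

Lemma ccvgM z_ z w_ w : ccvg z_ z -> ccvg w_ w -> ccvg (fun n => z_ n * w_ n) (z * w).
Proof.
move=> /ccvgP[z1 z2] /ccvgP[w1 w2]; apply/ccvgP; split.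
  by under eq_fun do rewrite cReM; rewrite cReM; apply: cvgB; apply: cvgM.
by under eq_fun do rewrite cImM; rewrite cImM; apply: cvgD; apply: cvgM.
Qed.

Lemma ccvgD z_ z w_ w : ccvg z_ z -> ccvg w_ w -> ccvg (fun n => z_ n + w_ n) (z + w).
Proof.
move=> /ccvgP[z1 z2] /ccvgP[w1 w2]; apply/ccvgP; split.
  by under eq_fun do rewrite cReD; rewrite cReD; apply: cvgD.
by under eq_fun do rewrite cImD; rewrite cImD; apply: cvgD.
Qed.

Lemma ccvg_conj z_ z : ccvg z_ z -> ccvg (fun n => conjC (z_ n)) (conjC z).
Proof.
rewrite /ccvg => h; under eq_fun do rewrite -conjB nm_conj; exact: h.
Qed.

Lemma seqcM f g : seqc f -> seqc g -> seqc (fun x => f x * g x).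
Proof. by move=> hf hg x_ x xx; apply: ccvgM; [exact: hf|exact: hg]. Qed.

Lemma seqcD f g : seqc f -> seqc g -> seqc (fun x => f x + g x).
Proof. by move=> hf hg x_ x xx; apply: ccvgD; [exact: hf|exact: hg]. Qed.

Lemma seqc_conj f : seqc f -> seqc (fun x => conjC (f x)).
Proof. by move=> hf x_ x xx; apply: ccvg_conj; exact: hf. Qed.

Lemma seqc_cst (c : R[i]) : seqc (fun=> c).
Proof.
by move=> x_ x _; rewrite /ccvg /=; under eq_fun do rewrite subrr nm0; exact: cvg_cst.
Qed.

Lemma seqc_comp (h : R -> R) f : continuous h -> seqc f -> seqc (f \o h).
Proof.
move=> ch hf x_ x xx; apply: (hf (h \o x_)).
exact: (continuous_cvg _ (ch x) xx).
Qed.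

Lemma seqc_cexpi (h : R -> R) : continuous h -> seqc (fun x => cexpi (h x)).
Proof.
move=> ch; apply: (seqc_comp (f := fun y => cexpi y) ch) => x_ x xx.
apply/ccvgP; split => /=; apply: (continuous_cvg _ _ xx);
  [exact: continuous_cos|exact: continuous_sin].
Qed.

(** Uniform limits. *)
Lemma seqc_lim (f_ : nat -> R -> R[i]) f (e_ : R^nat) : (forall n, seqc (f_ n)) ->
  (forall n x, nm (f_ n x - f x) <= e_ n) -> e_ n @[n --> \oo] --> (0 : R) ->
  seqc f.
Proof.
move=> hf_ hf e0 x_ x xx; apply/cvgrPdist_lt => e ep.
have [n _ hn] : \forall n \near \oo, e_ n < e / 4.
  move/cvgrPdist_lt : e0 => /(_ (e / 4)) /(_ _); rewrite divr_gt0// => /(_ isT).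
  by apply: filterS => n; rewrite sub0r normrN => /(le_lt_trans _); apply; exact: ler_norm.
have {}hn := hn n (leqnn n).
have := hf_ n _ _ xx; move/cvgrPdist_lt => /(_ (e / 4)); rewrite divr_gt0// => /(_ isT).
apply: filterS => m; rewrite !sub0r !normrN !ger0_norm ?nm_ge0//= => hm.
rewrite (_ : f (x_ m) - f x = - (f_ n (x_ m) - f (x_ m)) +
  (f_ n (x_ m) - f_ n x) + (f_ n x - f x)); last by ring.
apply: le_lt_trans (nmD _ _) _.
apply: (@le_lt_trans _ _ (nm (f_ n (x_ m) - f (x_ m)) + nm (f_ n (x_ m) - f_ n x)
   + nm (f_ n x - f x))).
  by rewrite lerD2r; apply: le_trans (nmD _ _) _; rewrite nmN.
have h1 := hf n (x_ m); have h2 := hf n x; lra.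
Qed.

Lemma seqc_cint d (T : measurableType d) (mu : {measure set T -> \bar R})
    (f : R -> T -> R[i]) (g : T -> R) :
  (forall x, cmeasurable (f x)) -> measurable_fun setT g ->
  (forall t, seqc (f ^~ t)) -> (forall x t, nm (f x t) <= g t) ->
  (\int[mu]_t (g t)%:E < +oo)%E -> seqc (fun x => cint mu (f x)).
Proof.
move=> mf mg cf fg gfin x_ x xx.
by apply: (cint_cvg (g := g)) => // t; exact: cf.
Qed.

(** A sequence with geometrically small increments; the limit is the infimum of
    the decreasing sequence of upper bounds. *)
Lemma geom_lim (u : R^nat) (C q : R) : 0 <= C -> 0 <= q <= 2^-1 ->
  (forall n, `|u n.+1 - u n| <= C * q ^+ n.+1) ->
  exists l, forall n, `|u n - l| <= 2 * C * q ^+ n.+1.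
Proof.
move=> C0 /andP[q0 q2] hu.
pose a n := u n + 2 * C * q ^+ n.+1; pose b n := u n - 2 * C * q ^+ n.+1.
have q1 n : 2 * (C * q ^+ n.+2) <= C * q ^+ n.+1.
  have qn : 0 <= C * q ^+ n.+1 by rewrite mulr_ge0 ?exprn_ge0.
  rewrite [q ^+ n.+2]exprS (_ : 2 * (C * (q * q ^+ n.+1)) =
    (2 * q) * (C * q ^+ n.+1)); last by ring.
  by rewrite ler_piMl//; lra.
have Cq n : 0 <= C * q ^+ n.+1 by rewrite mulr_ge0 ?exprn_ge0.
have na n : a n.+1 <= a n.
  by have := hu n; have := q1 n; rewrite /a ler_norml => h1 /andP[h2 h3]; lra.
have nb n : b n <= b n.+1.
  by have := hu n; have := q1 n; rewrite /b ler_norml => h1 /andP[h2 h3]; lra.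
have ha m n : (m <= n)%N -> a n <= a m.
  by elim: n => [|n IH]; [rewrite leqn0 => /eqP ->|
    rewrite leq_eqVlt => /predU1P[->//|]; rewrite ltnS => /IH; apply: le_trans].
have hb m n : (m <= n)%N -> b m <= b n.
  elim: n => [|n IH]; [by rewrite leqn0 => /eqP ->|].
  by rewrite leq_eqVlt => /predU1P[->//|]; rewrite ltnS => /IH h; apply: le_trans h _.
have hba m n : b m <= a n.
  have ba k : b k <= a k by have := Cq k; rewrite /a /b; lra.
  case/orP: (leq_total m n) => h; first by apply: le_trans (hb _ _ h) _.
  by apply: le_trans (ba m) _; exact: ha.
have ne : [set a n | n in [set: nat]] !=set0 by exists (a 0%N); exists 0%N.
exists (inf [set a n | n in [set: nat]]) => n.
have h1 : b n <= inf [set a n | n in [set: nat]].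
  by apply: lb_le_inf => // _ [m _ <-].
have h2 : inf [set a n | n in [set: nat]] <= a n.
  by apply: ge_inf; [exists (b 0%N) => _ [m _ <-]|exists n].
move: h1 h2; rewrite /a /b ler_norml => h1 h2; lra.
Qed.

Lemma cgeom_lim (u : nat -> R[i]) (C q : R) : 0 <= C -> 0 <= q <= 2^-1 ->
  (forall n, nm (u n.+1 - u n) <= C * q ^+ n.+1) ->
  exists l, forall n, nm (u n - l) <= 4 * C * q ^+ n.+1.
Proof.
move=> C0 q0 hu.
have [a ha] : exists l, forall n, `|complex.Re (u n) - l| <= 2 * C * q ^+ n.+1.
  apply: geom_lim => // n; apply: le_trans (hu n).
  by rewrite -cReN -cReD; exact: Re_le_nm.
have [b hb] : exists l, forall n, `|complex.Im (u n) - l| <= 2 * C * q ^+ n.+1.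
  apply: geom_lim => // n; apply: le_trans (hu n).
  by rewrite -cImN -cImD; exact: Im_le_nm.
exists (a +i* b) => n; apply: le_trans (nm_le_ReIm _) _.
rewrite cReD cImD cReN cImN /=; have := ha n; have := hb n; lra.
Qed.

Lemma geom_cvg0 (C q : R) : 0 <= q <= 2^-1 -> C * q ^+ n @[n --> \oo] --> (0 : R).
Proof.
move=> /andP[q0 q2]; rewrite -[X in _ --> X](mulr0 C); apply: cvgMr.
apply: cvg_expr; rewrite ger0_norm//; lra.
Qed.

Lemma le_geom (x y C q : R) : 0 <= q <= 2^-1 -> (forall n, x <= y + C * q ^+ n) ->
  x <= y.
Proof.
move=> q0 h; have hc : y + C * q ^+ n @[n --> \oo] --> y.
  by rewrite -[X in _ --> X]addr0; apply: cvgD; [exact: cvg_cst|exact: geom_cvg0].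
rewrite -(cvg_lim _ hc)//; apply: limr_ge; first by apply/cvg_ex; exists y.
exact: nearW.
Qed.

End SequentialContinuity.

(** * The cubic equation in the interaction representation *)

Section Interaction.
Context {R : realType}.
Variables (mu : {sigma_finite_measure set R -> \bar R}) (S : set R).
Hypothesis muS : frequency_measure mu S.
Variables (T : R) (eps : R[i]).
Hypothesis T0 : 0 <= T.
Hypothesis eps1 : nm eps <= 1.
Notation leb := (@lebesgue_measure R).
Notation nrm := (nrm mu).
Implicit Types (v : R -> R -> R[i]) (s t x k A B : R).

(** Symbol of the free evolution at time [s]. *)
Definition ph s x : R[i] := cexpi (- (s * x ^+ 2)).

(** Time derivative of the amplitude when the free evolution is factored out. *)
Definition rhs v s x : R[i] :=
  - 'i%C * eps * conjC (ph s x) * tri mu (fun y => ph s y * v s y) x.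

Lemma cmeasurable_ph : cmeasurable (fun p : R * R => ph p.1 p.2).
Proof.
apply: cmeasurable_cexpi; apply: measurable_funN; apply: measurable_funM => //.
exact: measurable_funX.
Qed.

Lemma cmeasurable_section (f : R * R -> R[i]) s : cmeasurable f ->
  cmeasurable (fun x => f (s, x)).
Proof.
move=> mf; apply: (cmeasurable_comp mf (h := fun x : R => (s, x))).
exact: measurable_fun_pair.
Qed.

Lemma nm_ph s x : nm (ph s x) = 1. Proof. exact: nm_cexpi. Qed.

Lemma cmeasurable_rhs v : cmeasurable (fun p : R * R => v p.1 p.2) ->
  cmeasurable (fun p : R * R => rhs v p.1 p.2).
Proof.
move=> mv.
have mw : cmeasurable (fun p : R * R => ph p.1 p.2 * v p.1 p.2).
  by apply: cmeasurableM => //; exact: cmeasurable_ph.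
apply: cmeasurableM.
  apply: cmeasurableM; first exact: cmeasurable_cst.
  by apply: cmeasurable_conj; exact: cmeasurable_ph.
have m1 := cmeasurable_conv2 mu mw mw.
have m2 : cmeasurable (fun p : R * R => conjC (ph p.1 (- p.2) * v p.1 (- p.2))).
  apply: cmeasurable_conj.
  apply: (cmeasurable_comp mw (h := fun p : R * R => (p.1, - p.2))).
  by apply: measurable_fun_pair => //; exact: measurable_funN.
exact: (cmeasurable_conv2 mu m1 m2).
Qed.

Lemma factor_le1 s x : nm (- 'i%C * eps * conjC (ph s x)) <= 1.
Proof. by rewrite !nmM nmN nm_i nm_conj nm_ph mul1r mulr1. Qed.

Lemma cmeasurable_factor s : cmeasurable (fun x => - 'i%C * eps * conjC (ph s x)).
Proof.
apply: cmeasurableM; first exact: cmeasurable_cst.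
by apply: cmeasurable_conj; exact: (cmeasurable_section s cmeasurable_ph).
Qed.

Lemma nrm_ph k A B (f : R -> R[i]) s : nrm k A B f ->
  nrm k A B (fun y => ph s y * f y).
Proof.
apply: nrm_mul; first exact: (cmeasurable_section s cmeasurable_ph).
by move=> x; rewrite nm_ph.
Qed.

Lemma nrm_rhs k A B v s : 0 <= k -> nrm k A B (v s) ->
  nrm k (A * B * B) (B * B * B) (rhs v s).
Proof.
move=> k0 hv; apply: nrm_mul; [exact: cmeasurable_factor|exact: factor_le1|].
exact: (nrm_tri muS k0 (nrm_ph s hv)).
Qed.

Lemma nrm_rhs_sub k A B A' B' v v' s : 0 <= k ->
  nrm k A B (v s) -> nrm k A B (v' s) ->
  nrm k A' B' (fun x => v s x - v' s x) ->
  nrm k (A' * B * B + 2 * (A * B * B')) (3 * (B * B * B'))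
    (fun x => rhs v s x - rhs v' s x).
Proof.
move=> k0 hv hv' hd.
have -> : (fun x => rhs v s x - rhs v' s x) = (fun x =>
   - 'i%C * eps * conjC (ph s x) * (tri mu (fun y => ph s y * v s y) x -
    tri mu (fun y => ph s y * v' s y) x)).
  by apply/funext => x; rewrite /rhs mulrBr.
apply: nrm_mul; [exact: cmeasurable_factor|exact: factor_le1|].
apply: (nrm_tri_sub muS k0 (nrm_ph s hv) (nrm_ph s hv')).
have -> : (fun x => ph s x * v s x - ph s x * v' s x) =
    (fun x => ph s x * (v s x - v' s x)) by apply/funext => x; rewrite mulrBr.
exact: nrm_ph.
Qed.

(** Giving up half of the exponential rate, a weighted supremum bound controls
    the weighted L1 norm. *)
Lemma nrm_of_sup k a (f : R -> R[i]) : 0 < k -> cmeasurable f ->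
  (forall x, wt k x * nm (f x) <= a) ->
  nrm (k / 2) a (a * fine (\int[mu]_x (expR (- (k / 2 * `|x|)))%:E)%E) f.
Proof.
move=> k0 mf fa; have k2 : 0 < k / 2 by rewrite divr_gt0.
have a0 : 0 <= a by apply: le_trans (wnm_ge0 k 0 (f 0)) (fa 0).
have wk x : wt k x = wt (k / 2) x * wt (k / 2) x.
  by rewrite /wt -expRD -mulrDl; congr (expR (_ * _)); lra.
have iw x : expR (- (k / 2 * `|x|)) * wt (k / 2) x = 1 by rewrite /wt -expRD addNr expR0.
have h x : wt (k / 2) x * nm (f x) <= a * expR (- (k / 2 * `|x|)).
  rewrite (_ : wt (k / 2) x * nm (f x) =
      wt k x * nm (f x) * expR (- (k / 2 * `|x|))); first by rewrite ler_wpM2r ?expR_ge0.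
  rewrite wk -[LHS]mulr1 -[X in _ * X](iw x); ring.
split => //.
  move=> x; apply: le_trans (h x) _; rewrite ler_piMr// -[leRHS]expR0 ler_expR.
  by rewrite oppr_le0 mulr_ge0// ltW.
have mE : measurable_fun setT (fun x : R => expR (- (k / 2 * `|x|))).
  by have := measurable_wt (- (k / 2)); rewrite /wt; under eq_fun do rewrite mulNr.
have fin := freq_exp muS k2.
rewrite EFinM fineK; last first.
  by rewrite ge0_fin_numE//; apply: integral_ge0 => x _; rewrite lee_fin expR_ge0.
rewrite -integralZ_EFin//.
apply: ge0_le_integral => //.
- by move=> x _; rewrite lee_fin wnm_ge0.
- by apply/measurable_EFinP; exact: measurable_wnm.
- by apply/measurable_EFinP; exact: measurable_funM.
- by move=> x _; rewrite lee_fin.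
Qed.

Lemma seqc_ph s : seqc (ph s).
Proof.
apply: (seqc_cexpi (h := fun x => - (s * x ^+ 2))) => x.
apply: cvgN; apply: cvgM; first exact: cvg_cst.
by rewrite expr2; apply: cvgM; exact: cvg_id.
Qed.

Lemma seqc_conv k A B A' B' (f g : R -> R[i]) : 0 <= k -> nrm k A B f ->
  nrm k A' B' g -> seqc f -> seqc (convol mu f g).
Proof.
move=> k0 hf hg cf; have [mf _ _] := hf; have [mg _ _] := hg.
apply: (seqc_cint (g := fun b => A * nm (g b))).
- by move=> x; apply: cmeasurableM => //; exact: cmeasurable_shift.
- by apply: measurable_funM => //; exact: measurable_nm.
- move=> b; apply: (seqcM (f := fun x => f (x - b))); last exact: seqc_cst.
  apply: (seqc_comp (h := fun x : R => x - b)) cf.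
  by move=> x; apply: cvgB; [exact: cvg_id|exact: cvg_cst].
- by move=> x b; rewrite nmM ler_wpM2r ?nm_ge0// (nrm_sup k0 hf).
rewrite integralZ_EFin ?(nrm_A0 hf)//; first last.
- by move=> b; exact: nm_ge0.
- exact: measurable_nm.
apply: lte_mul_pinfty; rewrite ?lee_fin ?(nrm_A0 hf)//.
by apply: le_lt_trans (nrm_L1 k0 hg) _; rewrite ltry.
Qed.

Lemma seqc_rhs k A B v s : 0 <= k -> nrm k A B (v s) -> seqc (v s) ->
  seqc (rhs v s).
Proof.
move=> k0 hv cv; have cw : seqc (fun y => ph s y * v s y).
  by apply: seqcM => //; exact: seqc_ph.
apply: seqcM.
  by apply: seqcM; [exact: seqc_cst|apply: seqc_conj; exact: seqc_ph].
have hw := nrm_ph s hv.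
apply: (seqc_conv k0 (nrm_conv muS k0 hw hw) (nrm_tilde muS hw)).
exact: (seqc_conv k0 hw hw cw).
Qed.

Variables (phi : R -> R[i]).

Definition pstep v t x : R[i] := phi x + tint T t (rhs v ^~ x).
Definition picard n : R -> R -> R[i] := iter n pstep (fun _ => phi).

Lemma picardS n t x :
  picard n.+1 t x = phi x + tint T t (rhs (picard n) ^~ x).
Proof. by []. Qed.

Section Convergence.
Variables (k A B : R).
Hypothesis k0 : 0 < k.
Hypothesis hphi : nrm k A B phi.
Hypothesis cphi : seqc phi.
Let q := 12 * T * B ^+ 2.
Hypothesis q2 : q <= 2^-1.

Let k00 : 0 <= k. Proof. exact: ltW. Qed.
Let A0 : 0 <= A. Proof. exact: nrm_A0 hphi. Qed.
Let B0 : 0 <= B. Proof. exact: nrm_B0 hphi. Qed.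
Let q0 : 0 <= q. Proof. by rewrite !mulr_ge0 ?sqr_ge0. Qed.
Let q02 : 0 <= q <= 2^-1. Proof. by rewrite q0. Qed.

Lemma cmeasurable_pstep v : cmeasurable (fun p : R * R => v p.1 p.2) ->
  cmeasurable (fun p : R * R => pstep v p.1 p.2).
Proof.
move=> mv; apply: cmeasurableD.
  by apply: (cmeasurable_comp (h := snd)) => //; case: hphi.
exact: cmeasurable_tint2 (cmeasurable_rhs mv).
Qed.

Lemma cmeasurable_picard n : cmeasurable (fun p : R * R => picard n p.1 p.2).
Proof.
elim: n => [|n IH]; last exact: cmeasurable_pstep.
by apply: (cmeasurable_comp (h := snd)) => //; case: hphi.
Qed.

Lemma rhs_time_bound a b v : 0 < k -> cmeasurable (fun p : R * R => v p.1 p.2) ->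
  (forall t, nrm k a b (v t)) -> forall x,
  cmeasurable (rhs v ^~ x) /\ (forall s, nm (rhs v s x) <= a * b * b).
Proof.
move=> _ mv hv x; split.
  apply: (cmeasurable_comp (cmeasurable_rhs mv) (h := fun s : R => (s, x))).
  exact: measurable_fun_pair.
by move=> s; exact: (nrm_sup k00 (nrm_rhs k00 (hv s)) x).
Qed.

(** Both norms of the increments decay geometrically with ratio [q]. *)
Lemma picard_bounds n :
  (forall t, nrm k (A * (2 - q ^+ n)) (B * (2 - q ^+ n)) (picard n t)) /\
  (forall t, nrm k (A * q ^+ n.+1) (B * q ^+ n.+1)
    (fun x => picard n.+1 t x - picard n t x)).
Proof.
have qn m : 0 <= q ^+ m by rewrite exprn_ge0.
elim: n => [|n [IH1 IH2]].
  split=> [t|t]; first by rewrite expr0 (_ : 2 - 1 = 1) ?mulr1//; lra.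
  have -> : (fun x => picard 1 t x - picard 0 t x) =
      (fun x => tint T t (rhs (picard 0) ^~ x)).
    by apply/funext => x; rewrite /picard /= /pstep addrC addKr.
  have h := nrm_tint T0 t (cmeasurable_rhs (cmeasurable_picard 0))
    (fun s => nrm_rhs k00 (v := picard 0) (s := s) hphi).
  apply: nrm_le h; rewrite expr1 /q.
    rewrite (_ : T * (A * B * B) = A * (T * B ^+ 2)); last by ring.
    by rewrite ler_wpM2l// -mulrA ler_peMl ?mulr_ge0 ?sqr_ge0//; lra.
  rewrite (_ : T * (B * B * B) = B * (T * B ^+ 2)); last by ring.
  by rewrite ler_wpM2l// -mulrA ler_peMl ?mulr_ge0 ?sqr_ge0//; lra.
have q1 m : 2 * q ^+ m.+1 <= q ^+ m.
  by rewrite exprS mulrA ler_piMl// -ler_pdivlMl// mulr1.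
have IH1' t : nrm k (A * (2 - q ^+ n.+1)) (B * (2 - q ^+ n.+1)) (picard n.+1 t).
  have := nrmD (IH1 t) (IH2 t).
  have -> : (fun x => picard n t x + (picard n.+1 t x - picard n t x)) = picard n.+1 t.
    by apply/funext => x; rewrite addrC subrK.
  by apply: nrm_le; rewrite -mulrDr ler_wpM2l//; have := q1 n; lra.
split => // t.
have hm m : (forall t, nrm k (A * (2 - q ^+ m)) (B * (2 - q ^+ m)) (picard m t)) ->
    forall t, nrm k (2 * A) (2 * B) (picard m t).
  move=> h s; apply: nrm_le (h s); rewrite mulrC ler_wpM2r//; have := qn m; lra.
have bn := hm _ IH1; have bn1 := hm _ IH1'.
have -> : (fun x => picard n.+2 t x - picard n.+1 t x) =
    (fun x => tint T t (fun s => rhs (picard n.+1) s x - rhs (picard n) s x)).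
  apply/funext => x.
  have [m1 h1] := rhs_time_bound k0 (cmeasurable_picard n.+1) bn1 x.
  have [m2 h2] := rhs_time_bound k0 (cmeasurable_picard n) bn x.
  rewrite (tintB T0 t m1 m2 _ h1 h2); last by rewrite !mulr_ge0.
  by rewrite picardS (picardS n t x) opprD addrACA subrr add0r.
have md : cmeasurable (fun p : R * R =>
    rhs (picard n.+1) p.1 p.2 - rhs (picard n) p.1 p.2).
  by apply: cmeasurableB; apply: cmeasurable_rhs; exact: cmeasurable_picard.
have hd s := nrm_rhs_sub k00 (bn1 s) (bn s) (IH2 s).
have := nrm_tint T0 t (g := fun s x => rhs (picard n.+1) s x - rhs (picard n) s x) md hd.
apply: nrm_le; rewrite [q ^+ n.+2]exprS; move: (q ^+ n.+1) => p;
  by rewrite /q le_eqVlt; apply/orP; left; apply/eqP; ring.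
Qed.

Lemma picard_nrm n t : nrm k (2 * A) (2 * B) (picard n t).
Proof.
have qn : 0 <= q ^+ n by rewrite exprn_ge0.
have [h _] := picard_bounds n; apply: nrm_le (h t);
  by rewrite mulrC ler_wpM2r//; lra.
Qed.

Lemma seqc_picard n t : seqc (picard n t).
Proof.
elim: n t => [//|n IH] t; rewrite /picard iterS -/(picard n) /pstep.
apply: seqcD => //.
have hb := rhs_time_bound k0 (cmeasurable_picard n) (picard_nrm n).
set K := 2 * A * (2 * B) * (2 * B) in hb.
have K0 : 0 <= K by rewrite !mulr_ge0.
apply: (@seqc_cint _ _ _ leb (fun x s => (win T t s)%:C * rhs (picard n) s x)
  (fun s => K * win T t s)).
- by move=> x; apply: cmeasurable_win; case: (hb x).
- by apply: measurable_funM => //; exact: measurable_win.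
- move=> s; apply: (seqcM (f := fun=> (win T t s)%:C)); first exact: seqc_cst.
  exact: seqc_rhs k00 (picard_nrm n s) (IH s).
- move=> x s; rewrite nm_win mulrC ler_wpM2r//; first by case/andP: (win01 T t s).
  by case: (hb x).
rewrite integralZ_EFin//; [|exact: measurable_win|by move=> s; case/andP: (win01 T t s)].
apply: (@le_lt_trans _ _ (K%:E * T%:E)%E); last by rewrite -EFinM ltry.
by rewrite lee_wpmul2l ?lee_fin// integral_win.
Qed.

(** Local existence: a solution of the Duhamel equation, close to the second
    Picard iterate. *)
Lemma interaction_solution : exists v : R -> R -> R[i],
  [/\ cmeasurable (fun p : R * R => v p.1 p.2),
      forall t x, wt k x * nm (v t x) <= 3 * A,
      forall t, seqc (v t),
      forall t x, v t x = phi x + tint T t (rhs v ^~ x) &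
      forall t x, wt k x * nm (v t x - picard 1 t x) <= 4 * A * q ^+ 2].
Proof.
have inc n t x : nm (picard n.+1 t x - picard n t x) <= A / wt k x * q ^+ n.+1.
  rewrite mulrAC ler_pdivlMr ?wt_gt0// mulrC.
  by have [_ /(_ t)[_ h _]] := picard_bounds n.
have Aw x : 0 <= A / wt k x by rewrite divr_ge0 ?wt_ge0.
have /choice[v0 hv0] : forall p : R * R, exists l, forall n,
    nm (picard n p.1 p.2 - l) <= 4 * (A / wt k p.2) * q ^+ n.+1.
  by move=> p; apply: cgeom_lim => // n; exact: inc.
pose v t x := v0 (t, x).
have hv n t x : wt k x * nm (picard n t x - v t x) <= 4 * A * q ^+ n.+1.
  rewrite mulrC -ler_pdivlMr ?wt_gt0//; apply: le_trans (hv0 (t, x) n) _.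
  by rewrite /= le_eqVlt; apply/orP; left; apply/eqP; ring.
have hv' n t x : nm (picard n t x - v t x) <= 4 * A * q ^+ n.+1.
  exact: le_trans (nm_le_wt (fun=> picard n t x - v t x) x k00) (hv n t x).
have gc C : C * q ^+ n.+1 @[n --> \oo] --> (0 : R).
  under eq_fun do rewrite exprS mulrA; exact: geom_cvg0.
have mv : cmeasurable (fun p : R * R => v p.1 p.2).
  apply: (cmeasurable_cvg cmeasurable_picard) => p.
  by apply: cvg0_le (gc (4 * A)) => n; rewrite nm_ge0 /=.
have v3 t x : wt k x * nm (v t x) <= 3 * A.
  have h := hv 0%N t x; rewrite expr1 in h.
  have h' : wt k x * nm (phi x) <= A by case: hphi.
  rewrite (_ : v t x = phi x - (picard 0 t x - v t x)); last first.
    by rewrite /picard /=; ring.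
  apply: (@le_trans _ _ (wt k x * nm (phi x) + wt k x * nm (picard 0 t x - v t x))).
    by rewrite -mulrDr ler_wpM2l ?wt_ge0// nmB.
  have h2 : 4 * A * q <= 2 * A.
    rewrite (_ : 4 * A * q = 2 * A * (2 * q)); last by ring.
    by rewrite ler_piMr ?mulr_ge0// -ler_pdivlMl// mulr1.
  by move: h h' h2; move: (4 * A * q) => c; lra.
exists v; split => //.
- move=> t; apply: (seqc_lim (seqc_picard ^~ t) _ (gc (4 * A))) => n x.
  exact: hv'.
- move=> t x; apply/eqP; rewrite -subr_eq0; apply/eqP.
  apply: Normc.eq0_normc; apply/eqP; rewrite eq_le nm_ge0 andbT.
  set I := fine (\int[mu]_y (expR (- (k / 2 * `|y|)))%:E)%E.
  pose a := 3 * A; pose b := 3 * A * I.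
  have k2 : 0 <= k / 2 by rewrite divr_ge0.
  have I0 : 0 <= I.
    by apply: fine_ge0; apply: integral_ge0 => y _; rewrite lee_fin expR_ge0.
  have nv s : nrm (k / 2) a b (v s).
    by apply: nrm_of_sup => //; exact: (cmeasurable_section s mv).
  have np n s : nrm (k / 2) a b (picard n s).
    apply: nrm_of_sup => //; first exact: (cmeasurable_section s (cmeasurable_picard n)).
    move=> y; have [_ h _] := picard_nrm n s; apply: le_trans (h y) _.
    by rewrite ler_wpM2r//; lra.
  have nd n s : nrm (k / 2) (4 * A * q ^+ n.+1) (4 * A * q ^+ n.+1 * I)
      (fun y => picard n s y - v s y).
    apply: nrm_of_sup => //; apply: cmeasurableB.
      exact: (cmeasurable_section s (cmeasurable_picard n)).
    exact: (cmeasurable_section s mv).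
  pose C := 4 * A * q * b * b + 2 * (a * b * (4 * A * q * I)).
  have dr n s : nm (rhs (picard n) s x - rhs v s x) <= C * q ^+ n.
    have := nrm_sup k2 (nrm_rhs_sub k2 (np n s) (nv s) (nd n s)) x.
    rewrite exprS /C => /le_trans; apply; rewrite le_eqVlt; apply/orP; left.
    by apply/eqP; ring.
  have mr w : cmeasurable (fun p : R * R => w p.1 p.2) -> cmeasurable (rhs w ^~ x).
    move=> mw; apply: (cmeasurable_comp (cmeasurable_rhs mw) (h := fun s : R => (s, x))).
    exact: measurable_fun_pair.
  have rb w : (forall s, nrm (k / 2) a b (w s)) -> forall s, nm (rhs w s x) <= a * b * b.
    by move=> hw s; exact: (nrm_sup k2 (nrm_rhs k2 (hw s)) x).
  have abb : 0 <= a * b * b by exact: le_trans (nm_ge0 _) (rb _ nv 0).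
  have C0 : 0 <= C.
    by have := dr 0%N 0; rewrite expr0 mulr1 => /(le_trans (nm_ge0 _)).
  apply: (@le_geom _ _ 0 (4 * A * q ^+ 2 + T * C) q q02) => n; rewrite add0r.
  set z := tint T t (rhs v ^~ x).
  rewrite (_ : v t x - (phi x + z) = - (picard n.+1 t x - v t x) +
    tint T t (fun s => rhs (picard n) s x - rhs v s x)); last first.
    rewrite (tintB T0 t (mr _ (cmeasurable_picard n)) (mr _ mv) abb (rb _ (np n)) (rb _ nv)).
    rewrite picardS -/z; move: (tint T t _) => y; clearbody z.
    move: (v t x) (phi x) => c d; ring.
  apply: le_trans (nmD _ _) _; rewrite nmN mulrDl lerD//.
    by apply: le_trans (hv' n.+1 t x) _; rewrite exprS exprS expr2 !mulrA.
  rewrite -mulrA; apply: nm_tint => //.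
    by apply: cmeasurableB; apply: mr => //; exact: cmeasurable_picard.
  by rewrite mulr_ge0// exprn_ge0.
- by move=> t x; rewrite nmBC; exact: hv.
Qed.

End Convergence.

End Interaction.

(** * Regularity of Fourier integrals with exponentially decaying amplitude *)

Section Regularity.
Context {R : realType}.
Variables (mu : {sigma_finite_measure set R -> \bar R}) (S : set R).
Hypothesis muS : frequency_measure mu S.
Implicit Types (f g : R -> R[i]) (k C x t s h : R).

Definition edec f : Prop := cmeasurable f /\
  exists k C, 0 < k /\ forall x, wt k x * nm (f x) <= C.

Lemma edec_mul (m : R -> R[i]) f : cmeasurable m ->
  (forall x, nm (m x) <= 1) -> edec f -> edec (fun x => m x * f x).
Proof.
move=> mm m1 [mf [k [C [k0 fC]]]]; split; first exact: cmeasurableM.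
exists k, C; split => // x; apply: le_trans (fC x).
by rewrite ler_wpM2l ?wt_ge0// nmM ler_piMl ?nm_ge0.
Qed.

Lemma edecD f g : edec f -> edec g -> edec (fun x => f x + g x).
Proof.
move=> [mf [k [C [k0 fC]]]] [mg [k' [C' [k0' gC]]]]; split; first exact: cmeasurableD.
exists (Num.min k k'), (C + C'); split; first by rewrite lt_min k0.
move=> x; have w1 : wt (Num.min k k') x <= wt k x.
  by rewrite ler_expR ler_wpM2r// ge_min lexx.
have w2 : wt (Num.min k k') x <= wt k' x.
  by rewrite ler_expR ler_wpM2r// ge_min lexx orbT.
apply: (@le_trans _ _ (wt (Num.min k k') x * (nm (f x) + nm (g x)))).
  by rewrite ler_wpM2l ?wt_ge0// nmD.
rewrite mulrDr lerD//; first by apply: le_trans (fC x); rewrite ler_wpM2r ?nm_ge0.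
by apply: le_trans (gC x); rewrite ler_wpM2r ?nm_ge0.
Qed.

Lemma edecN f : edec f -> edec (fun x => - f x).
Proof.
move=> [mf [k [C [k0 fC]]]]; split; first exact: cmeasurableN.
by exists k, C; split => // x; rewrite nmN.
Qed.

(** One power of the frequency costs an arbitrarily small part of the rate. *)
Lemma absx_wt k x : 0 < k -> `|x| * wt (k / 2) x <= 2 / k * wt k x.
Proof.
move=> k0; have k2 : 0 < k / 2 by rewrite divr_gt0.
have -> : wt k x = wt (k / 2) x * wt (k / 2) x.
  by rewrite /wt -expRD -mulrDl; congr (expR (_ * _)); lra.
rewrite mulrA ler_wpM2r ?wt_ge0//.
have h : k / 2 * `|x| <= wt (k / 2) x.
  by rewrite /wt; have := @expR_ge1Dx R (k / 2 * `|x|); lra.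
rewrite (_ : 2 / k = (k / 2)^-1); last by rewrite invf_div.
by rewrite ler_pdivlMl.
Qed.

Lemma sqrx_wt k x : 0 < k -> x ^+ 2 * wt (k / 2) x <= (4 / k) ^+ 2 * wt k x.
Proof.
move=> k0; have k2 : 0 < k / 2 by rewrite divr_gt0.
have e (a : R) : wt a x = wt (a / 2) x * wt (a / 2) x.
  by rewrite /wt -expRD -mulrDl; congr (expR (_ * _)); lra.
have h := absx_wt x k2; rewrite (_ : 2 / (k / 2) = 4 / k) in h; last first.
  by field; rewrite gt_eqF.
rewrite (e k) (e (k / 2)) -(real_normK (num_real x)) !expr2 mulrACA [leRHS]mulrACA.
have a0 : 0 <= `|x| * wt (k / 2 / 2) x by rewrite mulr_ge0 ?wt_ge0.
by rewrite -(e (k / 2)); apply: ler_pM.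
Qed.

Lemma edec_mulX f : edec f -> edec (fun x => x%:C * f x).
Proof.
move=> [mf [k [C [k0 fC]]]]; split.
  by apply: cmeasurableM => //; exact: cmeasurable_real.
exists (k / 2), (2 / k * C); split; first by rewrite divr_gt0.
move=> x; rewrite nmM nm_real mulrA [wt _ _ * _]mulrC.
apply: (@le_trans _ _ (2 / k * wt k x * nm (f x))).
  by rewrite ler_wpM2r ?nm_ge0// absx_wt.
by rewrite -mulrA ler_wpM2l// divr_ge0// ltW.
Qed.

Lemma edec_cintegrable f : edec f -> cintegrable mu f.
Proof.
move=> [mf [k [C [k0 fC]]]]; have := nrm_of_sup muS k0 mf fC.
by apply: nrm_cintegrable; rewrite divr_ge0// ltW.
Qed.

Lemma nrm_edec k A B f : 0 < k -> nrm mu k A B f -> edec f.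
Proof. by move=> k0 [mf fA _]; split => //; exists k, A. Qed.

(** The derivative on the frequency side. *)
Definition mulIX f x : R[i] := 'i%C * x%:C * f x.

Lemma edec_mulIX f : edec f -> edec (mulIX f).
Proof.
move=> hf; have -> : mulIX f = (fun x => 'i%C * (x%:C * f x)).
  by apply/funext => x; rewrite /mulIX mulrA.
apply: (edec_mul (m := fun=> 'i%C)); first exact: cmeasurable_cst.
  by move=> x; rewrite nm_i.
exact: edec_mulX.
Qed.

Lemma phys_taylor f : edec f -> exists C, forall x h,
  nm (phys mu f (x + h) - phys mu f x - h%:C * phys mu (mulIX f) x) <= C * h ^+ 2.
Proof.
move=> hf; have hX := edec_mulIX hf; have hXX := edec_mulX (edec_mulX hf).
have [mf _] := hf; have [mX _] := hX; have [mXX fXX] := edec_cintegrable hXX.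
exists (2 * fine (L1norm mu (fun x => x%:C * (x%:C * f x)))) => x h.
have i1 := phys_cintegrable (x + h) (edec_cintegrable hf).
have i2 := phys_cintegrable x (edec_cintegrable hf).
have i3 := phys_cintegrable x (edec_cintegrable hX).
rewrite /phys -cintB// -cintZ// -cintB//; [|exact: cintegrableD i1 (cintegrableN i2)
  |exact: cintegrableZ].
have [md _] := cintegrableD (cintegrableD i1 (cintegrableN i2))
  (cintegrableN (cintegrableZ h%:C i3)).
apply: nm_cint_le => //.
rewrite mulrAC EFinM fineK ?ge0_fin_numE ?L1norm_ge0// -integralZ_EFin; first last.
- by move=> xi; exact: nm_ge0.
- exact: measurable_nm.
- by rewrite mulr_ge0 ?sqr_ge0.
apply: le_L1norm => //; first by apply: measurable_funM => //; exact: measurable_nm.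
move=> xi; rewrite /mulIX mulrDl cexpiD.
rewrite (_ : _ - _ - _ = f xi * cexpi (x * xi) *
  (cexpi (h * xi) - 1 - 'i%C * (h * xi)%:C)); last by rewrite rmorphM; ring.
rewrite nmM nmM nm_cexpi mulr1 !nmM !nm_real mulrA mulrA mulrC.
apply: le_trans (ler_wpM2r (nm_ge0 _) (cexpi_taylor _)) _.
rewrite ler_wpM2r ?nm_ge0// le_eqVlt; apply/orP; left; apply/eqP.
rewrite exprMn -(real_normK (num_real xi)); ring.
Qed.

Lemma is_derive_taylor (F : R -> R) x l C :
  (forall h, `|F (x + h) - F x - h * l| <= C * h ^+ 2) -> is_derive x 1 F l.
Proof.
move=> hF; suff hl : h^-1 *: ((F \o shift x) (h *: 1) - F x) @[h --> 0^'] --> l.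
  by split; [apply/cvg_ex; exists l|exact: cvg_lim hl].
apply/cvgrPdist_le => e e0; have C0 : 0 <= C.
  by have := hF 1; rewrite expr1n mulr1; apply: le_trans.
have C1 : 0 < C + 1 by lra.
near=> h.
have h0 : h != 0 by near: h; exact: nbhs_dnbhs_neq.
rewrite distrC /= [h%:A]mulr1 [h + x]addrC.
have -> : h^-1 *: (F (x + h) - F x) - l = h^-1 * (F (x + h) - F x - h * l).
  by rewrite mulrBr mulrA mulVf// mul1r.
rewrite normrM normfV ler_pdivrMl ?normr_gt0//.
apply: le_trans (hF h) _; rewrite -(real_normK (num_real h)) expr2 mulrCA.
rewrite ler_wpM2l//.
have : `|h| <= e / (C + 1).
  by near: h; apply: dnbhs0_le; rewrite divr_gt0.
rewrite ler_pdivlMr// => hh; apply: le_trans hh; rewrite mulrC ler_wpM2l//; lra.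
Unshelve. all: by end_near.
Qed.

Lemma is_derive_phys f x : edec f ->
  is_derive x 1 (fun y => complex.Re (phys mu f y)) (complex.Re (phys mu (mulIX f) x)) /\
  is_derive x 1 (fun y => complex.Im (phys mu f y)) (complex.Im (phys mu (mulIX f) x)).
Proof.
move=> /phys_taylor[C hC]; split; apply: (is_derive_taylor (C := C)) => h;
  apply: le_trans (hC x h).
  by apply: le_trans (Re_le_nm _); rewrite !(cReD, cReN, cReM)/= mul0r subr0.
by apply: le_trans (Im_le_nm _); rewrite !(cImD, cImN, cImM)/= mul0r addr0.
Qed.

Lemma edec_iter_mulIX n f : edec f -> edec (iter n mulIX f).
Proof. by move=> hf; elim: n => //= n; exact: edec_mulIX. Qed.

Lemma derive1n_phys n f : edec f ->
  (forall x, derive1n n (fun y => complex.Re (phys mu f y)) x =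
    complex.Re (phys mu (iter n mulIX f) x)) /\
  (forall x, derive1n n (fun y => complex.Im (phys mu f y)) x =
    complex.Im (phys mu (iter n mulIX f) x)).
Proof.
move=> hf; elim: n => [//|n [IH1 IH2]]; have hn := edec_iter_mulIX n hf.
split => x; rewrite derive1nS derive1E.
  have [h _] := is_derive_phys x hn; rewrite iterS -(@derive_val _ _ _ _ _ _ _ h).
  by congr ('D_1 _ x); apply/funext => y; exact: IH1.
have [_ h] := is_derive_phys x hn; rewrite iterS -(@derive_val _ _ _ _ _ _ _ h).
by congr ('D_1 _ x); apply/funext => y; exact: IH2.
Qed.

Lemma csmooth_phys f : edec f -> csmooth (phys mu f).
Proof.
move=> hf n x; have [h1 h2] := derive1n_phys n hf.
have [[d1 _] [d2 _]] := is_derive_phys x (edec_iter_mulIX n hf).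
have e1 : derive1n n (fun y => complex.Re (phys mu f y)) =
    (fun y => complex.Re (phys mu (iter n mulIX f) y)) by apply/funext; exact: h1.
have e2 : derive1n n (fun y => complex.Im (phys mu f y)) =
    (fun y => complex.Im (phys mu (iter n mulIX f) y)) by apply/funext; exact: h2.
by rewrite e1 e2.
Qed.

Lemma cderive2_phys f x : edec f ->
  cderive 2 (phys mu f) x = phys mu (mulIX (mulIX f)) x.
Proof.
move=> hf; have [h1 h2] := derive1n_phys 2 hf.
by rewrite /cderive h1 h2; case: (phys _ _ _).
Qed.

End Regularity.

(** * From amplitudes to smooth solutions *)

(** A domain whose Fourier transform inverts Fourier integrals with exponentially
    decaying continuous amplitude. The last two fields compare the density of the
    frequencies with Lebesgue measure. *)
Record admissible (R : realType) (Z : domain R)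
    (mu : {sigma_finite_measure set R -> \bar R})
    (S : set R) := {
  adm_freq : frequency_measure mu S;
  adm_val : measurable_fun setT (freq_val Z);
  adm_transfer : forall f : R -> \bar R, measurable_fun setT f ->
    (forall x, 0 <= f x)%E ->
    (\int[freq_measure Z]_xi f (freq_val Z xi) = \int[mu]_x f x)%E;
  adm_fourier : forall w : R -> R[i], edec w -> seqc w ->
    [/\ fun_on Z (phys mu w),
      ('N[lebesgue_measure]_2%:E [(fun x => (nm (phys mu w x))%:E) \_ (fundamental Z)]
         < +oo)%E,
      cmeasurable (fourier Z (phys mu w)) &
      {ae freq_measure Z, forall xi,
         fourier Z (phys mu w) xi = (2 * pi)%:C * w (freq_val Z xi)}];
  adm_lower : forall (n : nat) (r : R), 0 <= r ->
    (r%:E <= mu [set x : R | (n%:R <= x <= n%:R + r)%R])%E;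
  adm_upper : forall (n : nat) (r : R), 0 <= r ->
    (mu [set x : R | (n%:R - r <= x <= n%:R + r)%R] <= (2 * r + 1)%:E)%E }.

Section LnormReal.
Context {R : realType} d (T : measurableType d).
Variable mu : {measure set T -> \bar R}.
Implicit Types (f g : T -> R) (p : R).

Lemma LnormE p f : 0 < p -> (forall x, 0 <= f x) ->
  ('N[mu]_(p%:E) [(fun x => (f x)%:E)] = (\int[mu]_x (f x `^ p)%:E) `^ p^-1)%E.
Proof.
move=> p0 f0; rewrite unlock; congr (_ `^ _)%E; apply: eq_integral => x _.
by rewrite gee0_abs ?lee_fin// poweR_EFin.
Qed.

Lemma le_Lnorm_ae p f g : 0 < p -> measurable_fun setT f -> measurable_fun setT g ->
  (forall x, 0 <= f x) -> (forall x, 0 <= g x) ->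
  {ae mu, forall x, f x <= g x} ->
  ('N[mu]_(p%:E) [(fun x => (f x)%:E)] <= 'N[mu]_(p%:E) [(fun x => (g x)%:E)])%E.
Proof.
move=> p0 mf mg f0 g0 fg; rewrite !LnormE//.
have i0 h : (0 <= \int[mu]_x (h x `^ p)%:E)%E.
  by apply: integral_ge0 => x _; rewrite lee_fin powR_ge0.
have mp h : measurable_fun setT h -> measurable_fun setT (fun x : T => (h x `^ p)%:E).
  by move=> mh; apply/measurable_EFinP; exact: (measurableT_comp (measurable_powR p)).
apply: gt0_ler_poweR; rewrite ?invr_ge0 ?(ltW p0)//.
- by rewrite in_itv /= i0 leey.
- by rewrite in_itv /= i0 leey.
apply: ae_ge0_le_integral => //.
- by move=> x _; rewrite lee_fin powR_ge0.
- exact: mp.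
- by move=> x _; rewrite lee_fin powR_ge0.
- exact: mp.
apply: filterS fg => x fgx _; rewrite lee_fin ge0_ler_powR ?nnegrE//; exact: ltW.
Qed.

Lemma eq_Lnorm_ae p f g : 0 < p -> measurable_fun setT f -> measurable_fun setT g ->
  (forall x, 0 <= f x) -> (forall x, 0 <= g x) ->
  {ae mu, forall x, f x = g x} ->
  ('N[mu]_(p%:E) [(fun x => (f x)%:E)] = 'N[mu]_(p%:E) [(fun x => (g x)%:E)])%E.
Proof.
move=> p0 mf mg f0 g0 fg; apply/eqP; rewrite eq_le.
by rewrite !le_Lnorm_ae//; apply: filterS fg => x ->.
Qed.

End LnormReal.

Section JapaneseBracket.
Context {R : realType}.
Implicit Types x s : R.

Lemma jap_ge1 x : 1 <= jap x.
Proof. by rewrite /jap -{1}sqrtr1 ler_wsqrtr// lerDl sqr_ge0. Qed.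

Lemma jap_gt0 x : 0 < jap x. Proof. exact: lt_le_trans ltr01 (jap_ge1 x). Qed.

Lemma jap_le x : jap x <= 1 + `|x|.
Proof.
rewrite /jap -[leRHS]ger0_norm ?addr_ge0// -sqrtr_sqr ler_wsqrtr//.
rewrite sqrrD expr1n mul1r real_normK ?num_real//.
by rewrite -addrA lerD2l lerDr mulrn_wge0.
Qed.

Lemma measurable_jap : measurable_fun setT (@jap R).
Proof.
have ms : measurable_fun setT (@Num.sqrt R).
  by apply: continuous_measurable_fun; exact: sqrt_continuous.
by apply: (measurableT_comp ms); apply: measurable_funD => //; exact: measurable_funX.
Qed.

(** Exponential weights dominate all the Sobolev weights. *)
Lemma jap_powR_wt s k : 0 < k -> exists2 c : R, 0 <= c &
  forall x, jap x `^ s <= c * wt k x.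
Proof.
move=> k0; have [s0|s0] := leP s 0.
  exists 1 => // x; rewrite mul1r; apply: (@le_trans _ _ 1); last exact/wt_ge1/ltW.
  by rewrite -(powRr0 (jap x)); exact: ler_powR (jap_ge1 x) _ _ s0.
exists ((1 + s / k) `^ s); first exact: powR_ge0.
move=> x; have sk : 0 <= s / k by rewrite divr_ge0// ltW.
have e : wt k x = wt (k / s) x `^ s.
  by rewrite /wt -expRM; congr expR; field; rewrite gt_eqF.
rewrite e -powRM ?wt_ge0 ?addr_ge0// ge0_ler_powR ?nnegrE ?(ltW s0)//.
- exact/ltW/jap_gt0.
- by rewrite mulr_ge0 ?addr_ge0 ?wt_ge0.
apply: le_trans (jap_le x) _.
apply: (@le_trans _ _ ((1 + s / k) * (1 + k / s * `|x|))).
  rewrite mulrDl mul1r mulrDr mulr1 mulrA.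
  have -> : s / k * (k / s) = 1 by rewrite mulrA mulfVK ?divff// gt_eqF.
  have : 0 <= k / s * `|x| by rewrite mulr_ge0// divr_ge0// ltW.
  lra.
by rewrite ler_wpM2l ?addr_ge0// /wt expR_ge1Dx.
Qed.

End JapaneseBracket.

Section Sobolev.
Context {R : realType}.
Variables (Z : domain R) (mu : {sigma_finite_measure set R -> \bar R}) (S : set R).
Hypothesis adm : admissible Z mu S.
Let muS := adm_freq adm.
Implicit Types (w : R -> R[i]) (k C x p s : R).

Lemma pi2_ge0 : 0 <= 2 * pi :> R.
Proof. by rewrite mulr_ge0// pi_ge0. Qed.

(** Weighted norms of the Fourier transform, computed on the amplitude. *)
Lemma Lnorm_fourier p (m : R -> R) w : 0 < p -> measurable_fun setT m ->
  (forall x, 0 <= m x) -> edec w -> seqc w ->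
  ('N[freq_measure Z]_(p%:E)
     [(fun xi => (m (freq_val Z xi) * nm (fourier Z (phys mu w) xi))%:E)] =
   'N[mu]_(p%:E) [(fun x => (m x * (2 * pi * nm (w x)))%:E)])%E.
Proof.
move=> p0 mm m0 hw cw; have [_ _ mF aeF] := adm_fourier adm hw cw.
have [mw _] := hw; have mn := measurable_nm mw.
have mg : measurable_fun setT (fun x => m x * (2 * pi * nm (w x))).
  by apply: measurable_funM => //; exact: measurable_funM.
have g0 x : 0 <= m x * (2 * pi * nm (w x)).
  by rewrite mulr_ge0// mulr_ge0 ?pi2_ge0 ?nm_ge0.
transitivity ('N[freq_measure Z]_(p%:E)
   [(fun xi => (m (freq_val Z xi) * (2 * pi * nm (w (freq_val Z xi))))%:E)])%E.
  apply: eq_Lnorm_ae => //.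
  - apply: measurable_funM; last exact: measurable_nm.
    exact: (measurableT_comp mm (adm_val adm)).
  - exact: (measurableT_comp mg (adm_val adm)).
  - by move=> xi; rewrite mulr_ge0 ?nm_ge0.
  apply: filterS aeF => xi ->; rewrite nmM nm_real ger0_norm//; exact: pi2_ge0.
rewrite !LnormE//; congr (_ `^ _)%E.
apply: (adm_transfer adm (f := fun x => ((m x * (2 * pi * nm (w x))) `^ p)%:E)).
  by apply/measurable_EFinP; exact: (measurableT_comp (measurable_powR p)).
by move=> x; rewrite lee_fin powR_ge0.
Qed.

Lemma Hnorm_le s k : 0 < k -> exists2 K : R, 0 <= K & forall w C,
  cmeasurable w -> seqc w -> (forall x, wt k x * nm (w x) <= C) ->
  (Hnorm Z s (phys mu w) <= (C * K)%:E)%E.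
Proof.
move=> k0; have k2 : 0 < k / 2 by rewrite divr_gt0.
have [c c0 hc] := jap_powR_wt s k2.
pose I := fine (\int[mu]_x (expR (- (k * `|x|)))%:E)%E.
have fin := freq_exp muS k0.
have I0 : 0 <= I by apply: fine_ge0; apply: integral_ge0 => x _; rewrite lee_fin expR_ge0.
have IE : (\int[mu]_x (expR (- (k * `|x|)))%:E = I%:E)%E.
  by rewrite fineK// ge0_fin_numE//; apply: integral_ge0 => x _; rewrite lee_fin expR_ge0.
have K0 : 0 <= c * (2 * pi) by rewrite mulr_ge0 ?pi2_ge0.
exists (c * (2 * pi) * Num.sqrt I); first by rewrite mulr_ge0 ?sqrtr_ge0.
move=> w C mw cw hw; have C0 : 0 <= C by apply: le_trans (wnm_ge0 k 0 (w 0)) (hw 0).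
have dw : edec w by split => //; exists k, C.
have mJ : measurable_fun setT (fun x : R => jap x `^ s).
  exact: (measurableT_comp (measurable_powR s) (@measurable_jap R)).
rewrite /Hnorm (Lnorm_fourier (m := fun x => jap x `^ s))//; last first.
  by move=> x; exact: powR_ge0.
have mE : measurable_fun setT (fun x : R => expR (- (k * `|x|))).
  by have := measurable_wt (- k); rewrite /wt; under eq_fun do rewrite mulNr.
have n2E : (\int[mu]_x ((jap x `^ s * (2 * pi * nm (w x))) `^ 2)%:E <=
    ((C * (c * (2 * pi))) ^+ 2 * I)%:E)%E.
  rewrite EFinM -IE -integralZ_EFin ?sqr_ge0//.
  apply: ge0_le_integral => //.
  - by move=> x _; rewrite lee_fin powR_ge0.
  - apply/measurable_EFinP; apply: (measurableT_comp (measurable_powR 2)).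
    by apply: measurable_funM => //; apply: measurable_funM => //; exact: measurable_nm.
  - by apply/measurable_EFinP; exact: measurable_funM.
  move=> x _; rewrite lee_fin powR_mulrn; last first.
    by rewrite mulr_ge0 ?powR_ge0// mulr_ge0 ?pi2_ge0 ?nm_ge0.
  have -> : expR (- (k * `|x|)) = expR (- (k / 2 * `|x|)) ^+ 2.
    by rewrite expr2 -expRD; congr expR; lra.
  rewrite -exprMn ler_pXn2r// ?nnegrE; last 2 first.
  - by rewrite mulr_ge0 ?powR_ge0// mulr_ge0 ?pi2_ge0 ?nm_ge0.
  - by rewrite mulr_ge0 ?expR_ge0// mulr_ge0.
  have e1 : expR (- (k / 2 * `|x|)) * wt (k / 2) x = 1 by rewrite /wt -expRD addNr expR0.
  have e2 : wt k x = wt (k / 2) x * wt (k / 2) x.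
    by rewrite /wt -expRD -mulrDl; congr (expR (_ * _)); lra.
  apply: (@le_trans _ _ (c * wt (k / 2) x * (2 * pi * nm (w x)))).
    by rewrite ler_wpM2r// mulr_ge0 ?pi2_ge0 ?nm_ge0.
  rewrite (_ : c * wt (k / 2) x * (2 * pi * nm (w x)) =
    wt k x * nm (w x) * (c * (2 * pi) * expR (- (k / 2 * `|x|)))); last first.
    by rewrite e2 -[LHS]mulr1 -[X in _ * X]e1; ring.
  rewrite [leRHS](_ : _ = C * (c * (2 * pi) * expR (- (k / 2 * `|x|)))); last by ring.
  by rewrite ler_wpM2r// mulr_ge0 ?expR_ge0.
rewrite LnormE//; last first.
  by move=> x; rewrite mulr_ge0 ?powR_ge0// mulr_ge0 ?pi2_ge0 ?nm_ge0.
have i0 : (0 <= \int[mu]_x ((jap x `^ s * (2 * pi * nm (w x))) `^ 2)%:E)%E.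
  by apply: integral_ge0 => x _; rewrite lee_fin powR_ge0.
apply: (@le_trans _ _ ((((C * (c * (2 * pi))) ^+ 2 * I)%:E) `^ 2^-1)%E).
  apply: gt0_ler_poweR => //; rewrite in_itv /= ?i0 ?leey//.
  by rewrite lee_fin mulr_ge0 ?sqr_ge0 ?leey.
have CK : 0 <= C * (c * (2 * pi)) by rewrite mulr_ge0.
rewrite poweR_EFin lee_fin powR12_sqrt; last by rewrite mulr_ge0 ?sqr_ge0.
by rewrite sqrtrM ?sqr_ge0// sqrtr_sqr ger0_norm// !mulrA.
Qed.

Lemma cmeasurable_phys w : cmeasurable w -> cmeasurable (phys mu w).
Proof.
move=> mw; apply: (cmeasurable_cint2 mu (f := fun p : R * R => w p.2 * cexpi (p.1 * p.2))).
apply: cmeasurableM; first exact: (cmeasurable_comp mw).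
by apply: cmeasurable_cexpi; exact: measurable_funM.
Qed.

Lemma in_Hinfty_phys w : edec w -> seqc w -> in_Hinfty Z (phys mu w).
Proof.
move=> hw cw; have [h1 h2 _ _] := adm_fourier adm hw cw; have [mw [k [C [k0 hC]]]] := hw.
split; first by split => //; exact: cmeasurable_phys.
  exact: (csmooth_phys muS hw).
move=> s; have [K K0 hK] := @Hnorm_le s _ k0.
by apply: le_lt_trans (hK w C mw cw hC) _; rewrite ltry.
Qed.

End Sobolev.

(** * The amplitude equation gives a classical solution *)

Section Solution.
Context {R : realType}.
Variables (Z : domain R) (mu : {sigma_finite_measure set R -> \bar R}) (S : set R).
Hypothesis adm : admissible Z mu S.
Let muS := adm_freq adm.
Variables (T : R) (eps : R[i]).
Hypothesis T0 : 0 <= T.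
Hypothesis eps1 : nm eps <= 1.
Variables (phi : R -> R[i]) (v : R -> R -> R[i]) (k a : R).
Hypothesis k0 : 0 < k.
Hypothesis mv : cmeasurable (fun p : R * R => v p.1 p.2).
Hypothesis va : forall t x, wt k x * nm (v t x) <= a.
Hypothesis cv : forall t, seqc (v t).
Hypothesis veq : forall t x, v t x = phi x + tint T t (rhs mu eps v ^~ x).

Notation rhsv := (rhs mu eps v).
Let k1 := k / 2.
Let k2 := k1 / 2.
Let k10 : 0 < k1. Proof. by rewrite divr_gt0. Qed.
Let k20 : 0 < k2. Proof. by rewrite divr_gt0. Qed.
Let I1 := fine (\int[mu]_x (expR (- (k / 2 * `|x|)))%:E)%E.
Let I2 := fine (\int[mu]_x (expR (- (k1 / 2 * `|x|)))%:E)%E.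

Definition amplitude t x : R[i] := ph t x * v t x.

(** Time derivative of the amplitude. *)
Definition damplitude t x : R[i] :=
  ph t x * rhsv t x - 'i%C * (x ^+ 2)%:C * amplitude t x.

Let mvt t : cmeasurable (v t). Proof. exact: (cmeasurable_section t mv). Qed.
Let mph t : cmeasurable (ph t : R -> R[i]).
Proof. exact: (cmeasurable_section t cmeasurable_ph). Qed.
Let a0 : 0 <= a. Proof. exact: le_trans (wnm_ge0 k 0 (v 0 0)) (va 0 0). Qed.

Let nv t : nrm mu k1 a (a * I1) (v t).
Proof. exact: (nrm_of_sup muS k0 (mvt t) (va t)). Qed.

Let K := a * (a * I1) * (a * I1).
Let nr t : nrm mu k1 K (a * I1 * (a * I1) * (a * I1)) (rhsv t).
Proof. exact: (nrm_rhs muS eps1 (ltW k10) (nv t)). Qed.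
Let K0 : 0 <= K. Proof. exact: (nrm_A0 (nr 0)). Qed.

Let mr x : cmeasurable (rhsv ^~ x).
Proof.
apply: (cmeasurable_comp (cmeasurable_rhs mu eps mv) (h := fun s : R => (s, x))).
exact: measurable_fun_pair.
Qed.

Let rK x s : nm (rhsv s x) <= K / wt k1 x.
Proof. by rewrite ler_pdivlMr ?wt_gt0// mulrC; case: (nr s). Qed.

Let v_lip s t x : wt k1 x * nm (v s x - v t x) <= K * `|s - t|.
Proof.
rewrite mulrC -ler_pdivlMr ?wt_gt0// mulrAC.
have -> : v s x - v t x = tint T s (rhsv ^~ x) - tint T t (rhsv ^~ x).
  by rewrite !veq opprD addrACA subrr add0r.
by apply: tint_lip => // *; exact: rK.
Qed.

Lemma ph_lip (s t x : R) : nm (ph s x - ph t x) <= 2 * `|s - t| * x ^+ 2.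
Proof.
apply: le_trans (cexpi_lip _ _) _; rewrite -mulrA ler_wpM2l//.
by rewrite opprK addrC -mulrBl normrM distrC [`|x ^+ 2|]ger0_norm ?sqr_ge0.
Qed.

Let c1 := (4 / k) ^+ 2.
Let c2 := (4 / k1) ^+ 2.
Let c10 : 0 <= c1. Proof. exact: sqr_ge0. Qed.
Let c20 : 0 <= c2. Proof. exact: sqr_ge0. Qed.

Let K2 := K + 2 * c1 * a.
Let amp_lip s t x : wt k1 x * nm (amplitude s x - amplitude t x) <= K2 * `|s - t|.
Proof.
rewrite (_ : amplitude s x - amplitude t x =
  ph s x * (v s x - v t x) + (ph s x - ph t x) * v t x); last by rewrite /amplitude; ring.
apply: (@le_trans _ _ (wt k1 x * nm (v s x - v t x) +
    2 * `|s - t| * (x ^+ 2 * wt k1 x * nm (v t x)))).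
  rewrite (_ : 2 * `|s - t| * (x ^+ 2 * wt k1 x * nm (v t x)) =
    wt k1 x * (2 * `|s - t| * x ^+ 2 * nm (v t x))); last by ring.
  rewrite -mulrDr ler_wpM2l ?wt_ge0//; apply: le_trans (nmD _ _) _.
  by rewrite !nmM nm_ph mul1r lerD2l ler_wpM2r ?nm_ge0// ph_lip.
rewrite /K2 [leRHS]mulrDl lerD ?v_lip//.
rewrite (_ : 2 * c1 * a * `|s - t| = 2 * `|s - t| * (c1 * a)); last by ring.
rewrite ler_wpM2l ?mulr_ge0//.
apply: (@le_trans _ _ (c1 * wt k x * nm (v t x))).
  by rewrite ler_wpM2r ?nm_ge0// sqrx_wt.
by rewrite -mulrA ler_wpM2l.
Qed.

Let ampM t : cmeasurable (amplitude t). Proof. exact: cmeasurableM. Qed.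
Let na t : nrm mu k1 a (a * I1) (amplitude t).
Proof. exact: nrm_ph. Qed.
Let na2 t : nrm mu k2 a (a * I1) (amplitude t).
Proof.
apply: nrm_wt_le (na t); rewrite /k2 ler_pdivrMr// ler_peMr//; first exact: ltW.
by rewrite (ler_nat R 1 2).
Qed.

Let K3 := K2 * (a * I1) * (a * I1) + 2 * (a * (a * I1) * (K2 * I2)).
Let tri_lip s t x :
  wt k2 x * nm (tri mu (amplitude s) x - tri mu (amplitude t) x) <= K3 * `|s - t|.
Proof.
have md : cmeasurable (fun x => amplitude s x - amplitude t x) by exact: cmeasurableB.
have nd := nrm_of_sup muS k10 md (amp_lip s t).
have [_ h _] := nrm_tri_sub muS (ltW k20) (na2 s) (na2 t) nd.
apply: le_trans (h x) _; rewrite -/I2 /K3 le_eqVlt; apply/orP; left; apply/eqP; ring.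
Qed.

Let K4 := K3 + 2 * c2 * K.
Let rhs_lip s t x : wt k2 x * nm (rhsv s x - rhsv t x) <= K4 * `|s - t|.
Proof.
have [_ ht _] := nrm_tri muS (ltW k10) (na t).
rewrite (_ : rhsv s x - rhsv t x =
  - 'i%C * eps * conjC (ph s x) * (tri mu (amplitude s) x - tri mu (amplitude t) x) +
  - 'i%C * eps * (conjC (ph s x) - conjC (ph t x)) * tri mu (amplitude t) x); last first.
  rewrite /rhs -/(amplitude s) -/(amplitude t).
  move: (tri mu (amplitude s) x) (tri mu (amplitude t) x) => z1 z2.
  by move: (conjC (ph s x)) (conjC (ph t x)) => z3 z4; ring.
have e1 : nm (- 'i%C * eps) <= 1 by rewrite nmM nmN nm_i mul1r.
apply: (@le_trans _ _ (wt k2 x * nm (tri mu (amplitude s) x - tri mu (amplitude t) x) +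
    2 * `|s - t| * (x ^+ 2 * wt k2 x * nm (tri mu (amplitude t) x)))).
  set z1 := tri mu (amplitude s) x; set z2 := tri mu (amplitude t) x.
  rewrite (_ : 2 * `|s - t| * (x ^+ 2 * wt k2 x * nm z2) =
    wt k2 x * (2 * `|s - t| * x ^+ 2 * nm z2)); last by ring.
  rewrite -mulrDr ler_wpM2l ?wt_ge0//; apply: le_trans (nmD _ _) _.
  rewrite nmM [nm (_ * _ * z2)]nmM lerD//.
    rewrite ler_piMl ?nm_ge0// nmM nm_conj nm_ph mulr1//.
  rewrite ler_wpM2r ?nm_ge0// nmM -conjB nm_conj.
  apply: le_trans (ph_lip _ _ _); by rewrite ler_piMl ?nm_ge0.
rewrite /K4 [leRHS]mulrDl lerD ?tri_lip//.
rewrite (_ : 2 * c2 * K * `|s - t| = 2 * `|s - t| * (c2 * K)); last by ring.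
rewrite ler_wpM2l ?mulr_ge0//.
apply: (@le_trans _ _ (c2 * wt k1 x * nm (tri mu (amplitude t) x))).
  by rewrite ler_wpM2r ?nm_ge0// sqrx_wt.
by rewrite -mulrA ler_wpM2l.
Qed.

Let v_taylor s t x : 0 <= s <= T -> 0 <= t <= T ->
  wt k2 x * nm (v s x - v t x - (s - t)%:C * rhsv t x) <= K4 * (s - t) ^+ 2.
Proof.
move=> sT tT.
have K40 : 0 <= K4.
  by have := rhs_lip 1 0 0; rewrite subr0 normr1 mulr1; apply: le_trans; exact: wnm_ge0.
rewrite mulrC -ler_pdivlMr ?wt_gt0// mulrAC -(real_normK (num_real (s - t))).
have -> : v s x - v t x = tint T s (rhsv ^~ x) - tint T t (rhsv ^~ x).
  by rewrite !veq opprD addrACA subrr add0r.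
apply: (tint_taylor T0 tT sT (mr x) (rK x)).
- by rewrite divr_ge0 ?wt_ge0.
- by move=> r; rewrite mulrAC ler_pdivlMr ?wt_gt0// mulrC.
Qed.

Let ph_taylor (s t x : R) :
  nm (ph s x - ph t x + (s - t)%:C * ('i%C * (x ^+ 2)%:C) * ph t x) <=
  2 * (s - t) ^+ 2 * (x ^+ 2 * x ^+ 2).
Proof.
have -> : ph s x = ph t x * cexpi (- ((s - t) * x ^+ 2)) :> R[i].
  by rewrite /ph -cexpiD; congr cexpi; ring.
rewrite (_ : _ + _ = ph t x * (cexpi (- ((s - t) * x ^+ 2)) - 1 -
   'i%C * (- ((s - t) * x ^+ 2))%:C)); last first.
  by rewrite rmorphN rmorphM /=; ring.
rewrite nmM nm_ph mul1r; apply: le_trans (cexpi_taylor _) _.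
by rewrite sqrrN exprMn -mulrA -expr2.
Qed.

Let K5 := 2 * (c2 * (c1 * a)) + K4 + 2 * (c2 * K).
(** The amplitude is differentiable in time, with a quadratic remainder. *)
Lemma amplitude_taylor s t x : 0 <= s <= T -> 0 <= t <= T ->
  wt k2 x * nm (amplitude s x - amplitude t x - (s - t)%:C * damplitude t x) <=
  K5 * (s - t) ^+ 2.
Proof.
move=> sT tT.
rewrite (_ : _ - _ - _ =
  (ph s x - ph t x + (s - t)%:C * ('i%C * (x ^+ 2)%:C) * ph t x) * v t x +
  ph t x * (v s x - v t x - (s - t)%:C * rhsv t x) +
  (ph s x - ph t x) * (v s x - v t x)); last first.
  by rewrite /damplitude /amplitude; move: (rhsv t x) => z; ring.
apply: (@le_trans _ _ (
   2 * (s - t) ^+ 2 * (x ^+ 2 * (x ^+ 2 * wt k2 x) * nm (v t x)) +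
   wt k2 x * nm (v s x - v t x - (s - t)%:C * rhsv t x) +
   2 * `|s - t| * (x ^+ 2 * wt k2 x * nm (v s x - v t x)))).
  set z := v s x - v t x - (s - t)%:C * rhsv t x.
  rewrite (_ : 2 * (s - t) ^+ 2 * (x ^+ 2 * (x ^+ 2 * wt k2 x) * nm (v t x)) =
    wt k2 x * (2 * (s - t) ^+ 2 * (x ^+ 2 * x ^+ 2) * nm (v t x))); last by ring.
  rewrite (_ : 2 * `|s - t| * (x ^+ 2 * wt k2 x * nm (v s x - v t x)) =
    wt k2 x * (2 * `|s - t| * x ^+ 2 * nm (v s x - v t x))); last by ring.
  rewrite -!mulrDr ler_wpM2l ?wt_ge0//; apply: le_trans (nmD _ _) _.
  rewrite lerD//; last by rewrite nmM ler_wpM2r ?nm_ge0// ph_lip.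
  apply: le_trans (nmD _ _) _; rewrite lerD//; last by rewrite nmM nm_ph mul1r.
  by rewrite nmM ler_wpM2r ?nm_ge0// ph_taylor.
rewrite /K5 [leRHS]mulrDl [X in _ <= X + _]mulrDl.
apply: lerD; [apply: lerD; [|exact: v_taylor]|].
  rewrite (_ : 2 * (c2 * (c1 * a)) * (s - t) ^+ 2 =
    2 * (s - t) ^+ 2 * (c2 * (c1 * a))); last by ring.
  have n0 : 0 <= 2 * (s - t) ^+ 2 by apply: mulr_ge0 => //; exact: sqr_ge0.
  apply: (ler_wpM2l n0).
  apply: (@le_trans _ _ (x ^+ 2 * (c2 * wt k1 x) * nm (v t x))).
    by rewrite ler_wpM2r ?nm_ge0// ler_wpM2l ?sqr_ge0// sqrx_wt.
  rewrite mulrCA -mulrA ler_wpM2l//.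
  apply: (@le_trans _ _ (c1 * wt k x * nm (v t x))).
    by rewrite ler_wpM2r ?nm_ge0// sqrx_wt.
  by rewrite -mulrA ler_wpM2l.
rewrite -(real_normK (num_real (s - t))) (_ : 2 * (c2 * K) * `|s - t| ^+ 2 =
  2 * `|s - t| * (c2 * (K * `|s - t|))); last by ring.
rewrite ler_wpM2l ?mulr_ge0//.
apply: (@le_trans _ _ (c2 * wt k1 x * nm (v s x - v t x))).
  by rewrite ler_wpM2r ?nm_ge0// sqrx_wt.
by rewrite -mulrA ler_wpM2l.
Qed.

Definition solution t : R -> R[i] := phys mu (amplitude t).

Lemma edec_amplitude t : edec (amplitude t).
Proof. exact: (nrm_edec k10 (na t)). Qed.

Lemma seqc_amplitude t : seqc (amplitude t).
Proof. by apply: seqcM => //; exact: seqc_ph. Qed.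

Lemma edec_damplitude t : edec (damplitude t).
Proof.
apply: edecD.
  exact: (nrm_edec k10 (nrm_ph t (nr t))).
apply: edecN; have := edec_mulX (edec_mulX (edec_amplitude t)).
move=> /(edec_mul (m := fun=> 'i%C)) h.
have -> : (fun x => 'i%C * (x ^+ 2)%:C * amplitude t x) =
    (fun x : R => 'i%C * (x%:C * (x%:C * amplitude t x))).
  by apply/funext => x; rewrite rmorphXn expr2 !mulrA.
apply: h; first exact: cmeasurable_cst.
by move=> x; rewrite nm_i.
Qed.

Lemma phys_sub (f g : R -> R[i]) x : edec f -> edec g ->
  phys mu (fun y => f y - g y) x = phys mu f x - phys mu g x.
Proof.
move=> /(edec_cintegrable muS)/(phys_cintegrable x) fi.
move=> /(edec_cintegrable muS)/(phys_cintegrable x) gi.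
by rewrite /phys -cintB//; apply: eq_cint => y; rewrite mulrBl.
Qed.

Lemma physZ (c : R[i]) (f : R -> R[i]) x : edec f ->
  phys mu (fun y => c * f y) x = c * phys mu f x.
Proof.
move=> /(edec_cintegrable muS)/(phys_cintegrable x) fi.
by rewrite /phys -cintZ//; apply: eq_cint => y; rewrite mulrA.
Qed.

Lemma nm_phys_le (f : R -> R[i]) q C x : 0 < q -> cmeasurable f ->
  (forall y, wt q y * nm (f y) <= C) ->
  nm (phys mu f x) <= C * fine (\int[mu]_y (expR (- (q / 2 * `|y|)))%:E)%E.
Proof.
move=> q0 mf fC; have nf := nrm_of_sup muS q0 mf fC.
have q20 : 0 <= q / 2 by rewrite divr_ge0// ltW.
apply: nm_cint_le.
  by apply: cmeasurableM => //; exact: cmeasurable_character.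
by rewrite /L1norm; under eq_integral do rewrite nmM nm_cexpi mulr1;
  exact: (nrm_L1 q20 nf).
Qed.

Lemma solution_taylor : exists C, forall s t x, 0 <= s <= T -> 0 <= t <= T ->
  nm (solution s x - solution t x - (s - t)%:C * phys mu (damplitude t) x) <=
  C * (s - t) ^+ 2.
Proof.
exists (K5 * fine (\int[mu]_y (expR (- (k2 / 2 * `|y|)))%:E)%E) => s t x sT tT.
have es := edec_amplitude s; have et := edec_amplitude t.
have ed := edec_damplitude t; have [md _] := ed.
have ez : edec (fun y => (s - t)%:C * damplitude t y).
  have [_ [q [C [q0 hC]]]] := ed; split.
    by apply: cmeasurableM => //; exact: cmeasurable_cst.
  exists q, (`|s - t| * C); split => // y.
  by rewrite nmM nm_real mulrCA ler_wpM2l.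
rewrite -physZ// -!phys_sub//; last exact: (edecD es (edecN et)).
rewrite mulrAC; apply: nm_phys_le => //.
  by apply: cmeasurableB; [exact: cmeasurableB|case: ez].
by move=> y; exact: amplitude_taylor.
Qed.

Lemma is_derive_within_taylor (D : set R) (F : R -> R[i]) t l C :
  (forall s, D s -> nm (F s - F t - (s - t)%:C * l) <= C * (s - t) ^+ 2) ->
  is_derive_within D F t l.
Proof.
move=> hF.
have aux (G : R -> R) m : (forall s, D s -> `|G s - G t - (s - t) * m| <= C * (s - t) ^+ 2) ->
    (fun s => (G s - G t) / (s - t)) @ within D t^' --> m.
  move=> hG; apply/cvgrPdist_le => e e0.
  have C1 : 0 < `|C| + 1 by rewrite ltr_wpDl.
  apply/nbhs_normP; exists (e / (`|C| + 1)); first by rewrite /= divr_gt0.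
  move=> s /= ts st Ds; have s0 : s - t != 0 by rewrite subr_eq0.
  rewrite distrC (_ : _ - m = (s - t)^-1 * (G s - G t - (s - t) * m)); last first.
    by rewrite mulrBr mulrA mulVf// mul1r mulrC.
  rewrite normrM normfV ler_pdivrMl ?normr_gt0//.
  apply: le_trans (hG s Ds) _; rewrite -(real_normK (num_real (s - t))) expr2 mulrCA.
  rewrite ler_wpM2l//; move: ts; rewrite distrC ltr_pdivlMr// => /ltW; apply: le_trans.
  by rewrite mulrC ler_wpM2l//; have := ler_norm C; lra.
split; apply: aux => s Ds; apply: le_trans (hF s Ds).
  by apply: le_trans (Re_le_nm _); rewrite !(cReD, cReN, cReM)/= mul0r subr0.
by apply: le_trans (Im_le_nm _); rewrite !(cImD, cImN, cImM)/= mul0r addr0.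
Qed.

(** The Schrodinger equation, from the equation for the amplitudes. *)
Lemma solution_pde t x :
  'i%C * phys mu (damplitude t) x + cderive 2 (solution t) x =
  eps * (`|solution t x| ^+ 2 * solution t x).
Proof.
have ea := edec_amplitude t; have ed := edec_damplitude t.
have e2 := edec_mulIX (edec_mulIX ea).
rewrite (cderive2_phys muS)// -physZ//.
have eid : edec (fun y => 'i%C * damplitude t y).
  have h1 (y : R) : nm ('i%C : R[i]) <= 1 by rewrite nm_i.
  exact: (edec_mul (m := fun=> 'i%C) (cmeasurable_cst _ _) h1 ed).
have i1 := phys_cintegrable x (edec_cintegrable muS eid).
have i2 := phys_cintegrable x (edec_cintegrable muS e2).
have nt := nrm_tri muS (ltW k10) (na t).
have i3 := phys_cintegrable x (nrm_cintegrable (ltW k10) nt).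
rewrite {1}/phys {1}/phys -cintD//.
transitivity (cint mu (fun xi => eps * (tri mu (amplitude t) xi * cexpi (x * xi)))).
  apply: eq_cint => xi; rewrite -mulrDl [RHS]mulrA; congr (_ * _).
  rewrite /damplitude /mulIX /rhs -/(amplitude t).
  set z := tri mu (amplitude t) xi; set w := amplitude t xi.
  have pp : ph t xi * conjC (ph t xi) = 1 :> R[i].
    by rewrite mul_conj nm_ph expr1n.
  have ii : 'i%C * 'i%C = -1 :> R[i] by rewrite -expr2 sqr_i.
  rewrite rmorphXn.
  transitivity (- ('i%C * 'i%C) * eps * (ph t xi * conjC (ph t xi)) * z).
    by move: (ph t xi) (conjC _) => p p'; ring.
  by rewrite ii pp opprK mul1r mulr1.
rewrite cintZ//; congr (_ * _).
rewrite -/(phys mu (tri mu (amplitude t)) x) (phys_tri muS x (ltW k10) (na t)).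
by rewrite normr_sqr_complex /solution mulrAC.
Qed.

Theorem smooth_solution_solution : v 0 = phi ->
  smooth_solution Z eps T (phys mu phi) solution.
Proof.
move=> v0; split.
- rewrite /solution; congr (phys mu _); apply/funext => x.
  by rewrite /amplitude /ph mul0r oppr0 cexpi0 mul1r v0.
- move=> t _; apply: (in_Hinfty_phys adm); [exact: edec_amplitude|exact: seqc_amplitude].
- move=> s t tT; have [C C0 hC] := @Hnorm_le _ _ _ _ adm s _ k10.
  have h r : (Hnorm Z s (fun x => (solution r x - solution t x)%R) <=
      (K2 * C * `|r - t|)%:E)%E.
    have -> : (fun x => solution r x - solution t x) =
        phys mu (fun y => amplitude r y - amplitude t y).
      by apply/funext => x; rewrite phys_sub//; exact: edec_amplitude.
    rewrite mulrAC; apply: hC.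
    + exact: cmeasurableB.
    + apply: seqcD; first exact: seqc_amplitude.
      have -> : (fun y => - amplitude t y) = (fun y => -1 * amplitude t y).
        by apply/funext => y; rewrite mulN1r.
      by apply: seqcM; [exact: seqc_cst|exact: seqc_amplitude].
    + by move=> y; exact: amp_lip.
  apply: (@squeeze_cvge _ _ _ _ (cst 0%E) _ (fun r => (K2 * C * `|r - t|)%:E)).
  + by apply: nearW => r; rewrite h andbT; exact: Lnorm_ge0.
  + exact: cvg_cst.
  apply: cvg_within_filter; apply: cvg_EFin; first exact: nearW.
  have -> : (0 : R) = K2 * C * `|t - t| by rewrite subrr normr0 mulr0.
  apply: cvgM; first exact: cvg_cst.
  by apply: cvg_norm; apply: cvgB; [exact: cvg_id|exact: cvg_cst].
- move=> t x tT; exists (phys mu (damplitude t) x); last exact: solution_pde.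
  have [C hC] := solution_taylor.
  apply: (is_derive_within_taylor (C := C)) => s /=; rewrite in_itv /= => sT.
  exact: hC.
Qed.

End Solution.

(** * Lebesgue measure as a frequency measure *)

Section LebesgueMeasure.
Context {R : realType}.
Notation leb := (@lebesgue_measure R).

(** Lebesgue measure lives on a copy of the real line whose sigma-algebra is
    generated by intervals; [lebR] moves it to the Borel sets of the line itself. *)
Definition pushforward_leb : set R -> \bar R := pushforward leb (id : measurableTypeR R -> R).

Lemma measurable_id_leb : measurable_fun setT (id : measurableTypeR R -> R).
Proof. by move=> _ A mA; rewrite setTI. Qed.

HB.instance Definition _ := Measure.copy pushforward_leb
  (measure_function_pushforward__canonical__measure_function_Measure leb measurable_id_leb).

Lemma sigma_finite_pushforward_leb : sigma_finite setT pushforward_leb.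
Proof. exact: (sigma_finiteT leb). Qed.

HB.instance Definition _ := @Measure_isSigmaFinite.Build _ _ _ pushforward_leb sigma_finite_pushforward_leb.

Definition lebR : {sigma_finite_measure set R -> \bar R} := pushforward_leb.

Lemma integral_lebR (f : R -> \bar R) : measurable_fun setT f ->
  (\int[lebR]_x f x = \int[leb]_x f x)%E.
Proof.
move=> mf; rewrite [RHS]integralE [LHS]integralE.
have mp := measurable_funepos mf; have mn := measurable_funeneg mf.
by congr (_ - _)%E; rewrite (ge0_integral_pushforward measurable_id_leb).
Qed.

(** The affine image of Lebesgue measure agrees with a multiple of it on
    intervals, hence everywhere. *)
Lemma integral_affine (a b : R) (f : R -> \bar R) : a != 0 ->
  measurable_fun setT f -> (forall x, 0 <= f x)%E ->
  (`|a|%:E * \int[lebR]_x f (a * x + b)%R = \int[lebR]_x f x)%E.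
Proof.
move=> a0 mf f0; pose h (x : R) : R := a * x + b.
have mhR : measurable_fun setT h by apply: measurable_funD => //; exact: measurable_funM.
have mh : @measurable_fun _ _ (measurableTypeR R) (measurableTypeR R) setT h by [].
rewrite !integral_lebR//; last exact: (measurableT_comp mf mhR).
have a0' : 0 <= `|a| by [].
pose nu : {measure set (measurableTypeR R) -> \bar R} :=
  mscale (NngNum a0') (measure_function_pushforward__canonical__measure_function_Measure leb mh).
have -> : (\int[leb]_x f x = \int[nu]_x f x)%E.
  apply: (eq_measure_integral nu) => A mA _.
  apply: lebesgue_measure_unique => // _ [[c d] _ <-] /=.
  rewrite /mscale /= /pushforward.
  have [a1|a1] := ltP 0 a.
    rewrite (_ : h @^-1` _ = `](c - b) / a, (d - b) / a]%classic); last first.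
      apply/seteqP; split=> x; rewrite /h /= !in_itv /= ltr_pdivrMr// ler_pdivlMr//;
      rewrite ltrBlDr lerBrDr mulrC//.
    rewrite !lebesgue_measure_itv /= !lte_fin ltr_pM2r ?invr_gt0// ltrD2r.
    case: ifP => _; last by rewrite mule0.
    by rewrite -!EFinD -EFinM gtr0_norm//; congr EFin; field.
  have {}a1 : a < 0 by rewrite lt_neqAle a0.
  rewrite (_ : h @^-1` _ = `[(d - b) / a, (c - b) / a[%classic); last first.
    apply/seteqP; split=> x; rewrite /h /= !in_itv /= ltr_ndivlMr// ler_ndivrMr//;
    by rewrite ltrBlDr lerBrDr mulrC andbC.
  rewrite !lebesgue_measure_itv /= !lte_fin ltr_nM2r ?invr_lt0// ltrD2r.
  case: ifP => _; last by rewrite mule0.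
  by rewrite -!EFinD -EFinM ltr0_norm//; congr EFin; field.
rewrite ge0_integral_mscale// ge0_integral_pushforward// preimage_setT//.
Qed.
Lemma cintegralE (D : set R) (f : R -> R[i]) : measurable D -> cmeasurable f ->
  cintegral D f = cint lebR (fun x => (\1_D x)%:C * f x).
Proof.
move=> mD mf; have mDf : cmeasurable (fun x => (\1_D x)%:C * f x).
  by apply: cmeasurableM => //; apply: cmeasurable_real; exact: measurable_indic.
have e (p : R[i] -> R) : p 0 = 0 ->
    (fun x => p (f x)) \_ D = (fun x => p ((\1_D x)%:C * f x)).
  move=> p0; apply/funext => x; rewrite /patch indicE.
  by case: (x \in D); rewrite ?mul1r ?mul0r ?p0.
rewrite /cintegral /cint; congr (_ +i* _).
  rewrite Rintegral_mkcond (e (@complex.Re R) erefl) /Rintegral -integral_lebR//.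
  by apply/measurable_EFinP; exact: mDf.1.
rewrite Rintegral_mkcond (e (@complex.Im R) erefl) /Rintegral -integral_lebR//.
by apply/measurable_EFinP; exact: mDf.2.
Qed.

End LebesgueMeasure.
Section Laplace.
Context {R : realType}.
Notation leb := (@lebesgue_measure R).
Implicit Types (k z x : R).

Lemma cvgy_expRN k : 0 < k -> expR (- (k * x)) @[x --> +oo] --> (0 : R).
Proof.
move=> k0; apply/cvgrPdist_lt => e e0; near=> x.
rewrite sub0r normrN ger0_norm ?expR_ge0// -ltr_ln ?posrE ?expR_gt0// expRK.
rewrite ltrNl -ltr_pdivrMl//; near: x; exact: (nbhs_pinfty_gt (num_real _)).
Unshelve. all: by end_near. Qed.

(** The half-line integral of an explicit derivative; adding the constant 1
    makes the integrand nonnegative. *)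
Lemma integral0y_expcos k z : 0 < k ->
  (\int[leb]_(x in `[0%R, +oo[) (expR (- (k * x)) * (1 + cos (z * x)))%:E =
   (k^-1 + k / (k ^+ 2 + z ^+ 2))%:E)%E.
Proof.
move=> k0; pose d := k ^+ 2 + z ^+ 2.
have d0 : 0 < d by rewrite ltr_wpDr ?sqr_ge0// exprn_gt0.
pose F x := expR (- (k * x)) * (- k^-1 + d^-1 * (z * sin (z * x) - k * cos (z * x))).
have dF x : is_derive x (1 : R) F (expR (- (k * x)) * (1 + cos (z * x))).
  rewrite /F; apply: is_derive_eq.
  rewrite /GRing.scale /= /d; move: (expR _) (cos _) (sin _) => e c s.
  by field; rewrite gt_eqF//= gt_eqF.
have cF : continuous F.
  by move=> x; apply: differentiable_continuous; apply/derivable1_diffP; case: (dF x).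
rewrite (@ge0_continuous_FTC2y _ _ F 0 0).
- by rewrite /F !mulr0 oppr0 expR0 sin0 cos0 -EFinB; congr EFin; rewrite /d; field; rewrite gt_eqF//= gt_eqF.
- move=> x _; rewrite mulr_ge0 ?expR_ge0//.
- apply: continuous_subspaceT => x.
  apply: cvgM; last first.
    apply: cvgD; first exact: cvg_cst.
    by apply: continuous_comp; [exact: mulrl_continuous|exact: continuous_cos].
  apply: continuous_comp; last exact: continuous_expR.
  by apply: cvgN; exact: mulrl_continuous.
- pose C := k^-1 + d^-1 * (`|z| + k).
  have bF x : `|F x| <= expR (- (k * x)) * C.
    rewrite normrM ger0_norm ?expR_ge0// ler_wpM2l ?expR_ge0//.
    rewrite (le_trans (ler_normD _ _))// normrN gtr0_norm ?invr_gt0// lerD2l.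
    rewrite normrM gtr0_norm ?invr_gt0// ler_wpM2l ?invr_ge0 ?(ltW d0)//.
    rewrite (le_trans (ler_normB _ _))// !normrM (gtr0_norm k0) lerD//.
      by rewrite ler_piMr// sin_max.
    by rewrite ler_piMr ?(ltW k0)// cos_max.
  have cC s : expR (- (k * x)) * (s * C) @[x --> +oo] --> (0 : R).
    by rewrite -[0](mul0r (s * C)); apply: cvgMl; exact: cvgy_expRN.
  apply: (@squeeze_cvgr _ _ _ _ (fun x => expR (- (k * x)) * (-1 * C)) (fun x => expR (- (k * x)) * (1 * C))) => //.
  by apply: nearW => x; rewrite mul1r mulN1r mulrN -ler_norml.
- by move=> x _; case: (dF x).
- apply: cvg_at_right_filter; exact: cF.
- by move=> x _; rewrite derive1E; case: (dF x).
Qed.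
End Laplace.
Section Poisson.
Context {R : realType}.
Notation leb := (@lebesgue_measure R).
Notation muL := (@lebR R).
Implicit Types (k z x : R).

Lemma integral_expcos k z : 0 < k ->
  (\int[muL]_x (expR (- (k * `|x|)) * (1 + cos (z * x)))%:E =
   (2 * (k^-1 + k / (k ^+ 2 + z ^+ 2)))%:E)%E.
Proof.
move=> k0.
have cf : continuous (fun x : R => expR (- (k * `|x|)) * (1 + cos (z * x))).
  move=> x; apply: cvgM; last first.
    apply: cvgD; first exact: cvg_cst.
    by apply: continuous_comp; [exact: mulrl_continuous|exact: continuous_cos].
  apply: continuous_comp; last exact: continuous_expR.
  apply: cvgN; apply: cvgM; first exact: cvg_cst.
  exact: norm_continuous.
rewrite integral_lebR; last by apply/measurable_EFinP; exact: continuous_measurable_fun.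
rewrite ge0_symfun_integralT; first last.
- by move=> x /=; rewrite normrN mulrN cosN.
- exact: cf.
- by move=> x; rewrite mulr_ge0 ?expR_ge0.
rewrite EFinM -(integral0y_expcos z k0); congr (_ * _)%E.
rewrite (_ : [set x : R | _] = `[0, +oo[%classic); last first.
  by apply/seteqP; split=> x /=; rewrite in_itv /= andbT.
by apply: eq_integral => x; rewrite inE /= in_itv /= andbT => x0; rewrite ger0_norm.
Qed.

Lemma integral_exp k : 0 < k ->
  (\int[muL]_x (expR (- (k * `|x|)))%:E = (2 / k)%:E)%E.
Proof.
move=> k0; have mE : measurable_fun setT (fun x : R => expR (- (k * `|x|))).
  by have := measurable_wt (- k); rewrite /wt; under eq_fun do rewrite mulNr.
have := integral_expcos 0 k0.
rewrite (_ : (fun _ => _) = (fun x : R => (2 * expR (- (k * `|x|)))%:E)); last first.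
  by apply/funext => x; rewrite mul0r cos0 mulrC.
rewrite integralZ_EFin//.
have i0 : (0 <= \int[muL]_x (expR (- (k * `|x|)))%:E)%E.
  by apply: integral_ge0 => x _; rewrite lee_fin expR_ge0.
case: (integral _ _ _) i0 => [r _ /=|_|//].
  rewrite -EFinM => -[] h; congr EFin; apply: (mulfI (x := 2)) => //.
  by rewrite h expr0n addr0; field; rewrite gt_eqF.
by rewrite gt0_muley ?lte_fin.
Qed.

Lemma lebesgue_frequency : frequency_measure muL setT.
Proof.
split.
- by apply: aeW.
- move=> c f _ mf f0; have := integral_affine (- c) (oner_neq0 R) mf f0.
  rewrite normr1 mul1e => h; apply: (eq_trans _ h).
  by apply: eq_integral => x _; rewrite mul1r.
- move=> f mf f0; have n1 : (-1 : R) != 0 by rewrite oppr_eq0 oner_eq0.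
  apply: (eq_trans _ (integral_affine 0 n1 mf f0)); rewrite normrN normr1 mul1e.
  by apply: eq_integral => x _; rewrite mulN1r addr0.
- by move=> k k0; rewrite integral_exp// ltry.
Qed.

(** The Fourier transform of the exponential is the Poisson kernel. *)
Lemma phys_exp k z : 0 < k ->
  phys muL (fun x => (expR (- (k * `|x|)))%:C) z = (2 * k / (k ^+ 2 + z ^+ 2))%:C.
Proof.
move=> k0; pose e x : R := expR (- (k * `|x|)).
have mE : measurable_fun setT e.
  by have := measurable_wt (- k); rewrite /wt; under eq_fun do rewrite mulNr.
have ei : cintegrable muL (fun x => (e x)%:C).
  apply: (@cintegrable_le _ _ _ _ _ e) => //.
  - by move=> x; rewrite nm_real ger0_norm ?expR_ge0.
  - by rewrite integral_exp// ltry.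
have pz := phys_cintegrable z ei.
have re : complex.Re (phys muL (fun x => (e x)%:C) z) = 2 * k / (k ^+ 2 + z ^+ 2).
  pose g x := (e x)%:C + (e x)%:C * cexpi (z * x).
  have gi : cint muL g = cint muL (fun x => (e x)%:C) + phys muL (fun x => (e x)%:C) z.
    by rewrite /g cintD.
  have -> : phys muL (fun x => (e x)%:C) z = cint muL g - cint muL (fun x => (e x)%:C).
    by rewrite gi addrC addKr.
  rewrite cReD cReN /cint /= /Rintegral integral_exp//.
  rewrite (_ : (\int[muL]_x _)%E = (\int[muL]_x (e x * (1 + cos (z * x)))%:E)%E); last first.
    by apply: eq_integral => x _; congr EFin; ring.
  have d0 : k ^+ 2 + z ^+ 2 != 0 by rewrite gt_eqF// ltr_wpDr ?sqr_ge0// exprn_gt0.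
  have k0' : k != 0 by rewrite gt_eqF.
  rewrite integral_expcos//; rewrite [fine _]/= [fine (_ / _)%:E]/=.
  by field; rewrite k0' d0.
have im : complex.Im (phys muL (fun x => (e x)%:C) z) = 0.
  have : conjC (phys muL (fun x => (e x)%:C) z) = phys muL (fun x => (e x)%:C) z.
    rewrite /phys -(cint_conj pz) -(cint_refl lebesgue_frequency pz.1).
    apply: eq_cint => x; rewrite conjM conj_cexpi mulrN /e normrN.
    by congr (_ * _); rewrite conjc_real.
  by case: (phys _ _ _) => a b [] /= h; lra.
by case: (phys muL _ z) re im => a b /= -> ->.
Qed.
End Poisson.

Lemma cvg_integral_mono (R : realType) d (T : measurableType d)
    (mu : {measure set T -> \bar R}) (f_ : nat -> T -> R) (f : T -> R) :
  (forall n, measurable_fun setT (f_ n)) -> (forall n x, 0 <= f_ n x) ->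
  (forall n x, f_ n x <= f_ n.+1 x) ->
  (forall x, f_ n x @[n --> \oo] --> f x) ->
  ((\int[mu]_x (f_ n x)%:E)%E @[n --> \oo] --> (\int[mu]_x (f x)%:E)%E).
Proof.
move=> mf f0 nd cf.
rewrite (_ : (\int[mu]_x (f x)%:E)%E = (\int[mu]_x (limn (fun n => (f_ n x)%:E)))%E); last first.
  apply: eq_integral => x _; apply/esym/cvg_lim => //.
  by apply: cvg_EFin; [exact: nearW|exact: cf].
apply: cvg_monotone_convergence => //.
- by move=> n; exact/measurable_EFinP.
- by move=> n x _; rewrite lee_fin.
by move=> x _; apply/nondecreasing_seqP => n; rewrite lee_fin.
Qed.

Lemma le_integral_mono (R : realType) d (T : measurableType d)
    (mu : {measure set T -> \bar R}) (f_ : nat -> T -> R) (f : T -> R) (C : \bar R) :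
  (forall n, measurable_fun setT (f_ n)) -> (forall n x, 0 <= f_ n x) ->
  (forall n x, f_ n x <= f_ n.+1 x) ->
  (forall x, f_ n x @[n --> \oo] --> f x) ->
  (forall n, \int[mu]_x (f_ n x)%:E <= C)%E -> (\int[mu]_x (f x)%:E <= C)%E.
Proof.
move=> mf f0 nd cf fC; have c := cvg_integral_mono (mu := mu) mf f0 nd cf.
rewrite -(cvg_lim (@ereal_hausdorff R) c); apply: lime_le; first by apply/cvg_ex; eexists; exact: c.
exact: nearW.
Qed.

Section PoissonKernel.
Context {R : realType}.
Notation muL := (@lebR R).
Implicit Types (k z x : R).

Definition poisson k z : R := 2 * k / (k ^+ 2 + z ^+ 2).

Lemma poisson_ge0 k z : 0 < k -> 0 <= poisson k z.
Proof.
move=> k0; rewrite /poisson divr_ge0//; first by rewrite mulr_ge0// ltW.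
by rewrite addr_ge0 ?sqr_ge0.
Qed.

Lemma continuous_poisson k : 0 < k -> continuous (poisson k).
Proof.
move=> k0 x; apply: cvgM; first exact: cvg_cst.
apply: cvgV; first by rewrite gt_eqF// ltr_wpDr ?sqr_ge0// exprn_gt0.
apply: cvgD; first exact: cvg_cst.
exact: exprn_continuous.
Qed.

Lemma measurable_poisson k : 0 < k -> measurable_fun setT (poisson k).
Proof. by move=> k0; apply: continuous_measurable_fun; exact: continuous_poisson. Qed.

Lemma poisson_scale k y : 0 < k -> k * poisson k (k * y) = poisson 1 y.
Proof.
move=> k0; have k0' : k != 0 by rewrite gt_eqF.
have h0 : 1 + y ^+ 2 != 0 by rewrite gt_eqF// ltr_wpDr ?sqr_ge0.
rewrite /poisson; have -> : k ^+ 2 + (k * y) ^+ 2 = k ^+ 2 * (1 + y ^+ 2) by ring.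
by field; rewrite k0' h0.
Qed.

Lemma integral_poisson1 : (\int[muL]_x (poisson 1 x)%:E = (2 * pi)%:E)%E.
Proof.
rewrite integral_lebR; last by apply/measurable_EFinP; exact: measurable_poisson.
rewrite ge0_symfun_integralT; first last.
- by move=> x; rewrite /poisson /= sqrrN.
- exact: continuous_poisson.
- by move=> x; exact: poisson_ge0.
rewrite (_ : [set x : R | _] = `[0, +oo[%classic); last first.
  by apply/seteqP; split=> x /=; rewrite in_itv /= andbT.
rewrite EFinM; congr (_ * _)%E.
under eq_integral do rewrite /poisson mulr1 expr1n EFinM.
rewrite ge0_integralZl//; first last.
- by move=> x _; rewrite lee_fin invr_ge0 addr_ge0 ?sqr_ge0.
- apply/measurable_EFinP; apply: measurable_funTS; apply: continuous_measurable_fun.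
  exact: continuous_oneDsqrV.
by rewrite integral0y_oneDsqr -EFinM; congr EFin; field.
Qed.

Lemma integral_scale k (F : R -> R) : 0 < k -> measurable_fun setT F ->
  (forall x, 0 <= F x) ->
  (\int[muL]_x (F x * poisson k x)%:E = \int[muL]_x (F (k * x) * poisson 1 x)%:E)%E.
Proof.
move=> k0 mF F0; have k0' : k != 0 by rewrite gt_eqF.
have mP := measurable_poisson k0.
have mFP : measurable_fun setT (fun x => F x * poisson k x) by exact: measurable_funM.
rewrite -(integral_affine 0 k0'); first last.
- by move=> x; rewrite lee_fin mulr_ge0 ?poisson_ge0.
- exact/measurable_EFinP.
rewrite gtr0_norm// -integralZ_EFin ?(ltW k0)//; first last.
- by move=> x; rewrite mulr_ge0 ?poisson_ge0.
- apply: (measurableT_comp mFP (f := fun x => F x * poisson k x)).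
  by apply: measurable_funD => //; exact: measurable_funM.
apply: eq_integral => x _; rewrite addr0 mulrCA poisson_scale//.
Qed.

Lemma integral_poisson k : 0 < k -> (\int[muL]_x (poisson k x)%:E = (2 * pi)%:E)%E.
Proof.
move=> k0; rewrite -integral_poisson1.
have := integral_scale (F := fun=> 1) k0.
under eq_integral do rewrite mul1r; under [in RHS]eq_integral do rewrite mul1r.
by apply.
Qed.

End PoissonKernel.

(** * Plancherel's theorem *)

Section Plancherel.
Context {R : realType}.
Notation muL := (@lebR R).
Let muS := @lebesgue_frequency R.
Variables (A B : R) (g : R -> R[i]).
Hypothesis hg : nrm muL 0 A B g.
Implicit Types (k x : R).

Let u := phys muL g.
Let h := convol muL g (tilde g).
Let mg : cmeasurable g := let: And3 mg _ _ := hg in mg.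

Let hh : nrm muL 0 (A * B) (B * B) h.
Proof. exact: (nrm_conv muS (lexx 0) hg (nrm_tilde muS hg)). Qed.

Lemma autocorrelation_phys x : phys muL h x = (nm (u x) ^+ 2)%:C.
Proof.
rewrite /h (phys_conv muS _ (lexx 0) hg (nrm_tilde muS hg)) (phys_tilde muS)//.
  by rewrite mul_conj.
exact: (nrm_cintegrable (lexx 0) hg).
Qed.

Let e k x : R := expR (- (k * `|x|)).

Let me k : measurable_fun setT (e k).
Proof. by have := measurable_wt (- k); rewrite /wt; under eq_fun do rewrite mulNr. Qed.

Let mu_u : cmeasurable u. Proof. exact: cmeasurable_phys. Qed.

(** Abel summation of the squared transform against the Poisson kernel. *)
Lemma abel_plancherel k : 0 < k ->
  cint muL (fun x => (nm (u x) ^+ 2 * e k x)%:C) =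
  cint muL (fun x => h x * (poisson k x)%:C).
Proof.
move=> k0; have [mh _ _] := hh.
transitivity (cint muL (fun x => cint muL (fun y => (e k x)%:C * (h y * cexpi (x * y))))).
  apply: eq_cint => x; rewrite cintZ; last first.
    by apply: phys_cintegrable; exact: (nrm_cintegrable (lexx 0) hh).
  by rewrite -/(phys muL h x) autocorrelation_phys mulrC rmorphM.
pose f (p : R * R) := (e k p.1)%:C * (h p.2 * cexpi (p.1 * p.2)).
have mf : cmeasurable f.
  apply: cmeasurableM.
    by apply: cmeasurable_real; exact: (measurableT_comp (me k)).
  apply: cmeasurableM; first exact: (cmeasurable_comp mh).
  by apply: cmeasurable_cexpi; exact: measurable_funM.
have nf x y : nm (f (x, y)) = e k x * nm (h y).
  by rewrite /f !nmM nm_cexpi mulr1 nm_real ger0_norm ?expR_ge0.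
rewrite (cint_swap (f := f))//.
  apply: eq_cint => y; rewrite /f /=.
  transitivity (cint muL (fun x => h y * ((e k x)%:C * cexpi (y * x)))).
    by apply: eq_cint => x; rewrite mulrCA (mulrC x y).
  have ei : cintegrable muL (fun x => (e k x)%:C).
    apply: (@cintegrable_le _ _ _ _ _ (e k)) => //.
    - exact: cmeasurable_real.
    - by move=> x; rewrite nm_real ger0_norm ?expR_ge0.
    - by rewrite integral_exp// ltry.
  rewrite cintZ; last exact: phys_cintegrable.
  by rewrite -/(phys muL _ y) phys_exp.
under eq_integral do under eq_integral do rewrite nf.
under eq_integral => x _.
  rewrite integralZ_EFin ?expR_ge0//; first last.
  - by move=> y; exact: nm_ge0.
  - exact: measurable_nm.
  over.
have hB := nrm_L1 (lexx 0) hh.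
rewrite /L1norm in hB.
apply: (@le_lt_trans _ _ (\int[muL]_x (B * B * e k x)%:E)%E).
  apply: ge0_le_integral => //.
  - move=> x _; rewrite mule_ge0 ?lee_fin ?expR_ge0//.
    by apply: integral_ge0 => y _; rewrite lee_fin nm_ge0.
  - by apply: emeasurable_funM; [exact/measurable_EFinP|exact: measurable_cst].
  - by apply/measurable_EFinP; exact: measurable_funM.
  by move=> x _; rewrite mulrC EFinM lee_pmul2l ?lte_fin ?expR_gt0.
rewrite integralZ_EFin ?mulr_ge0 ?(nrm_B0 hg)//; last first.
  by move=> x; exact: expR_ge0.
by rewrite integral_exp// -EFinM ltry.
Qed.

Lemma L2_finite : (\int[muL]_x (nm (g x) ^+ 2)%:E < +oo)%E.
Proof.
have A0 := nrm_A0 hg; have gB := nrm_L1 (lexx 0) hg; rewrite /L1norm in gB.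
apply: (@le_lt_trans _ _ (\int[muL]_x (A * nm (g x))%:E)%E).
  apply: ge0_le_integral => //.
  - by move=> x _; rewrite lee_fin sqr_ge0.
  - by apply/measurable_EFinP; apply: measurable_funX; exact: measurable_nm.
  - by apply/measurable_EFinP; apply: measurable_funM => //; exact: measurable_nm.
  by move=> x _; rewrite lee_fin expr2 ler_wpM2r ?nm_ge0// (nrm_sup (lexx 0) hg).
rewrite integralZ_EFin//; first last.
- by move=> x; exact: nm_ge0.
- exact: measurable_nm.
by apply: le_lt_trans (lee_wpmul2l _ gB) _; rewrite ?lee_fin// -EFinM ltry.
Qed.

Definition L2sqr : R := fine (\int[muL]_x (nm (g x) ^+ 2)%:E)%E.

Lemma L2sqrE : (\int[muL]_x (nm (g x) ^+ 2)%:E)%E = L2sqr%:E.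
Proof.
rewrite fineK// ge0_fin_numE ?L2_finite//.
by apply: integral_ge0 => x _; rewrite lee_fin sqr_ge0.
Qed.

Lemma L2sqr_ge0 : 0 <= L2sqr.
Proof.
by rewrite -lee_fin -L2sqrE; apply: integral_ge0 => x _; rewrite lee_fin sqr_ge0.
Qed.

Let mg2 : measurable_fun setT (fun x => nm (g x) ^+ 2).
Proof. by apply: measurable_funX; exact: measurable_nm. Qed.

(** The autocorrelation is bounded by its value at 0. *)
Lemma autocorrelation_le x : nm (h x) <= L2sqr.
Proof.
have [mh _ _] := hh; have [mt _ _] := nrm_tilde muS hg.
have mgx : cmeasurable (fun b : R => g (x - b)) by exact: cmeasurable_shift.
apply: nm_cint_le; first exact: cmeasurableM.
apply: (@le_trans _ _ (\int[muL]_b ((2^-1 * nm (g (x - b)) ^+ 2)%:E +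
   (2^-1 * nm (g (- b)) ^+ 2)%:E))%E).
  apply: ge0_le_integral => //.
  - by move=> b _; rewrite lee_fin nm_ge0.
  - by apply: measurable_enm; exact: cmeasurableM.
  - apply/measurable_EFinP; apply: measurable_funD; apply: measurable_funM => //.
      exact: (measurable_funX 2 (measurable_nm mgx)).
    by apply: measurable_funX; have := measurable_nm mt;
      rewrite /tilde; under eq_fun do rewrite nm_conj.
  move=> b _; rewrite nmM /tilde nm_conj -EFinD lee_fin.
  have := sqr_ge0 (nm (g (x - b)) - nm (g (- b))).
  by rewrite sqrrB; lra.
have mg' c : measurable_fun setT (fun b : R => nm (g (c - b)) ^+ 2).
  by apply: measurable_funX; apply: measurable_nm; exact: cmeasurable_shift.
have i c : (\int[muL]_b (2^-1 * nm (g (c - b)) ^+ 2)%:E = (2^-1 * L2sqr)%:E)%E.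
  rewrite integralZ_EFin//; last by move=> b; rewrite sqr_ge0.
  rewrite EFinM -L2sqrE; congr (_ * _)%E.
  have e1 := @integral_affine R (-1) c (fun x => (nm (g x) ^+ 2)%:E).
  rewrite -e1 ?oppr_eq0 ?oner_eq0//; first last.
  - by move=> y; rewrite lee_fin sqr_ge0.
  - exact/measurable_EFinP.
  rewrite normrN1 mul1e; apply: eq_integral => b _.
  by rewrite mulN1r addrC.
rewrite ge0_integralD//; first last.
- by have := mg' 0; under eq_fun do rewrite sub0r; move=> m;
    apply/measurable_EFinP; exact: measurable_funM.
- by move=> b _; rewrite lee_fin mulr_ge0 ?sqr_ge0.
- by apply/measurable_EFinP; exact: measurable_funM.
- by move=> b _; rewrite lee_fin mulr_ge0 ?sqr_ge0.
have -> : (\int[muL]_b (2^-1 * nm (g (- b)) ^+ 2)%:E = (2^-1 * L2sqr)%:E)%E.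
  by rewrite -(i 0); apply: eq_integral => b _; rewrite sub0r.
by rewrite i -EFinD lee_fin; lra.
Qed.

Lemma autocorrelation0 : h 0 = L2sqr%:C.
Proof.
rewrite /h /convol /tilde -(cint_refl muS); last first.
  have [mt _ _] := nrm_tilde muS hg.
  by apply: cmeasurableM => //; have := cmeasurable_shift 0 mg.
transitivity (cint muL (fun x => (nm (g x) ^+ 2)%:C)).
  by apply: eq_cint => x; rewrite sub0r opprK mul_conj.
rewrite /cint /= /Rintegral integral0 L2sqrE//.
Qed.


Lemma integral_abel k : 0 < k ->
  (\int[muL]_x (nm (u x) ^+ 2 * e k x)%:E =
   (complex.Re (cint muL (fun x => h x * (poisson k x)%:C)))%:E)%E.
Proof.
move=> k0; rewrite -abel_plancherel// /cint /= /Rintegral fineK//.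
have mu2 : measurable_fun setT (fun x => nm (u x) ^+ 2 * e k x).
  by apply: measurable_funM => //; apply: measurable_funX; exact: measurable_nm.
have i0 x : 0 <= nm (u x) ^+ 2 * e k x by rewrite mulr_ge0 ?sqr_ge0 ?expR_ge0.
rewrite ge0_fin_numE; last by apply: integral_ge0 => x _; rewrite lee_fin.
apply: (@le_lt_trans _ _ (\int[muL]_x (B ^+ 2 * e k x)%:E)%E).
  apply: ge0_le_integral => //.
  - by move=> x _; rewrite lee_fin.
  - exact/measurable_EFinP.
  - by apply/measurable_EFinP; exact: measurable_funM.
  move=> x _; rewrite lee_fin ler_wpM2r ?expR_ge0//.
  rewrite ler_pXn2r// ?nnegrE ?nm_ge0 ?(nrm_B0 hg)//.
  apply: nm_cint_le; first by apply: cmeasurableM => //; exact: cmeasurable_character.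
  rewrite /L1norm; under eq_integral do rewrite nmM nm_cexpi mulr1.
  exact: (nrm_L1 (lexx 0) hg).
rewrite integralZ_EFin ?sqr_ge0//; last by move=> x; exact: expR_ge0.
by rewrite integral_exp// -EFinM ltry.
Qed.

Lemma abel_le k : 0 < k ->
  (\int[muL]_x (nm (u x) ^+ 2 * e k x)%:E <= (2 * pi * L2sqr)%:E)%E.
Proof.
move=> k0; have [mh _ _] := hh; rewrite integral_abel// lee_fin.
apply: (le_trans (ler_norm _)); apply: (le_trans (Re_le_nm _)); apply: nm_cint_le.
  by apply: cmeasurableM => //; apply: cmeasurable_real; exact: measurable_poisson.
apply: (@le_trans _ _ (\int[muL]_x (L2sqr * poisson k x)%:E)%E); last first.
  rewrite integralZ_EFin ?L2sqr_ge0//; first by rewrite integral_poisson// -EFinM lee_fin mulrC.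
  - exact: measurable_poisson.
  - by move=> x; exact: poisson_ge0.
apply: ge0_le_integral => //.
- by move=> x _; rewrite lee_fin nm_ge0.
- apply: measurable_enm; apply: cmeasurableM => //; apply: cmeasurable_real.
  exact: measurable_poisson.
- by apply/measurable_EFinP; apply: measurable_funM => //; exact: measurable_poisson.
move=> x _; rewrite lee_fin nmM nm_real ger0_norm ?poisson_ge0//.
by rewrite ler_wpM2r ?poisson_ge0// autocorrelation_le.
Qed.

Lemma bessel : (\int[muL]_x (nm (u x) ^+ 2)%:E <= (2 * pi * L2sqr)%:E)%E.
Proof.
apply: (@le_integral_mono _ _ _ _ (fun n x => nm (u x) ^+ 2 * e (harmonic n) x)).
- move=> n; apply: measurable_funM => //.
  by apply: measurable_funX; exact: measurable_nm.
- by move=> n x; rewrite mulr_ge0 ?sqr_ge0 ?expR_ge0.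
- move=> n x; rewrite ler_wpM2l ?sqr_ge0// ler_expR lerN2 ler_wpM2r//.
  by rewrite /harmonic /= lef_pV2 ?posrE// ler_nat.
- move=> x; rewrite -[X in _ --> X]mulr1; apply: cvgM; first exact: cvg_cst.
  have ce : continuous (fun t : R => expR (- (t * `|x|))).
    move=> t; apply: continuous_comp; last exact: continuous_expR.
    by apply: cvgN; apply: cvgM; [exact: cvg_id|exact: cvg_cst].
  have -> : 1 = expR (- (0 * `|x|)) :> R by rewrite mul0r oppr0 expR0.
  apply: (@cvg_comp _ _ _ harmonic (fun t => expR (- (t * `|x|))) _ (nbhs (0 : R))).
    exact: cvg_harmonic.
  exact: ce.
- by move=> n; apply: abel_le; rewrite /harmonic /= invr_gt0.
Qed.

Lemma plancherel_ge : seqc g -> ((2 * pi * L2sqr)%:E <= \int[muL]_x (nm (u x) ^+ 2)%:E)%E.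
Proof.
move=> cg; have [mh _ _] := hh.
have ch : seqc h by exact: (seqc_conv (lexx 0) hg (nrm_tilde muS hg) cg).
have mP k : 0 < k -> cmeasurable (fun x => (poisson k x)%:C).
  by move=> k0; apply: cmeasurable_real; exact: measurable_poisson.
pose f_ (n : nat) (y : R) : R[i] :=
  (nm (h (harmonic n * y) - h 0) * poisson 1 y)%:C.
have mn n : measurable_fun setT (fun y : R => nm (h (harmonic n * y) - h 0)).
  apply: measurable_nm; apply: cmeasurableB; last exact: cmeasurable_cst.
  by apply: (cmeasurable_comp mh); exact: measurable_funM.
have nd x : nm (h x - h 0) <= 2 * L2sqr.
  apply: le_trans (nmB _ _) _.
  by have := autocorrelation_le x; have := autocorrelation_le 0; lra.
have P0 (y : R) : 0 <= poisson 1 y by exact: poisson_ge0.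
have L0 : 0 <= 2 * L2sqr by rewrite mulr_ge0 ?L2sqr_ge0.
have lim0 : nm (cint muL (f_ n) - cint muL (fun=> 0)) @[n --> \oo] --> (0 : R).
  apply: (cint_cvg (g := fun y => 2 * L2sqr * poisson 1 y)).
  - by move=> n; apply: cmeasurable_real; apply: measurable_funM => //; exact: measurable_poisson.
  - exact: cmeasurable_cst.
  - by apply: measurable_funM => //; exact: measurable_poisson.
  - move=> y; rewrite (_ : (fun n => _) =
      (fun n => nm (h (harmonic n * y) - h 0) * poisson 1 y)); last first.
      apply/funext => n; rewrite /f_ subr0 nm_real ger0_norm//.
      by rewrite (mulr_ge0 (nm_ge0 _) (P0 y)).
    rewrite -[X in _ --> X](mul0r (poisson 1 y)); apply: cvgM; last exact: cvg_cst.
    apply: (ch (fun n => harmonic n * y)); rewrite -(mul0r y).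
    by apply: cvgM; [exact: cvg_harmonic|exact: cvg_cst].
  - move=> n y; rewrite nm_real ger0_norm; first by rewrite (ler_wpM2r (P0 y)).
    by rewrite (mulr_ge0 (nm_ge0 _) (P0 y)).
  - by move=> n; rewrite nm0 (mulr_ge0 L0 (P0 n)).
  rewrite integralZ_EFin//; first by rewrite integral_poisson1 -EFinM ltry.
  exact: measurable_poisson.
have [U UE] : exists U : R, (\int[muL]_x (nm (u x) ^+ 2)%:E = U%:E)%E.
  exists (fine (\int[muL]_x (nm (u x) ^+ 2)%:E)%E); rewrite fineK// ge0_fin_numE.
    by apply: le_lt_trans bessel _; rewrite ltry.
  by apply: integral_ge0 => x _; rewrite lee_fin sqr_ge0.
rewrite UE lee_fin; apply/ler_addgt0Pr => eps eps0.
move/cvgrPdist_lt : lim0 => /(_ _ eps0) [n _ /(_ n (leqnn n))].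
rewrite /= sub0r normrN ger0_norm ?nm_ge0// cint0 subr0 => hn.
have k0 : 0 < harmonic n :> R by rewrite /harmonic /= invr_gt0.
have Ui : (\int[muL]_x (nm (u x) ^+ 2 * e (harmonic n) x)%:E <= U%:E)%E.
  rewrite -UE; apply: ge0_le_integral => //.
  - by move=> x _; rewrite lee_fin mulr_ge0 ?sqr_ge0 ?expR_ge0.
  - apply/measurable_EFinP; apply: measurable_funM => //.
    by apply: measurable_funX; exact: measurable_nm.
  - by apply/measurable_EFinP; apply: measurable_funX; exact: measurable_nm.
  move=> x _; rewrite lee_fin ler_piMr ?sqr_ge0// -[leRHS]expR0 ler_expR oppr_le0.
  by rewrite mulr_ge0// ltW.
move: Ui; rewrite integral_abel// lee_fin.
set c := cint muL _ => Ui.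
have iP : cintegrable muL (fun x => (poisson (harmonic n) x)%:C).
  apply: (@cintegrable_le _ _ _ _ _ (poisson (harmonic n))).
  - exact: mP.
  - exact: measurable_poisson.
  - by move=> x; rewrite nm_real ger0_norm ?poisson_ge0.
  - by rewrite integral_poisson// ltry.
have ihP : cintegrable muL (fun x => h x * (poisson (harmonic n) x)%:C).
  apply: (@cintegrable_le _ _ _ _ _ (fun x => L2sqr * poisson (harmonic n) x)).
  - by apply: cmeasurableM => //; exact: mP.
  - by apply: measurable_funM => //; exact: measurable_poisson.
  - move=> x; rewrite nmM nm_real ger0_norm ?poisson_ge0//.
    by rewrite ler_wpM2r ?poisson_ge0// autocorrelation_le.
  - rewrite integralZ_EFin ?L2sqr_ge0//.
    + by rewrite integral_poisson// -EFinM ltry.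
    + exact: measurable_poisson.
    + by move=> x; exact: poisson_ge0.
have cP : cint muL (fun x => (poisson (harmonic n) x)%:C) = (2 * pi)%:C.
  by rewrite /cint /= /Rintegral integral0 integral_poisson.
have bound : nm (c - (2 * pi * L2sqr)%:C) <= nm (cint muL (f_ n)).
  have -> : c - (2 * pi * L2sqr)%:C =
      cint muL (fun x => (h x - h 0) * (poisson (harmonic n) x)%:C).
    have <- : cint muL (fun x => h 0 * (poisson (harmonic n) x)%:C) = (2 * pi * L2sqr)%:C.
      by rewrite (cintZ _ iP) cP autocorrelation0 [RHS]rmorphM mulrC.
    apply: (eq_trans (esym (cintB ihP (cintegrableZ (h 0) iP)))).
    by apply: eq_cint => x; rewrite mulrBl.
  apply: nm_cint_le.
    by apply: cmeasurableM; [apply: cmeasurableB => //; exact: cmeasurable_cst|exact: mP].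
  rewrite /L1norm.
  under eq_integral => x _ do rewrite nmM nm_real ger0_norm ?poisson_ge0//.
  rewrite (integral_scale (F := fun x => nm (h x - h 0)))//; last 2 first.
  - by apply: measurable_nm; apply: cmeasurableB => //; exact: cmeasurable_cst.
  - by move=> x; exact: nm_ge0.
  rewrite /cint /f_ /= /Rintegral integral0 /=.
  set I := integral _ _ _; have I0 : (0 <= I)%E.
    by apply: integral_ge0 => y _; rewrite lee_fin (mulr_ge0 (nm_ge0 _) (P0 y)).
  have If : (I < +oo)%E.
    apply: (@le_lt_trans _ _ (\int[muL]_y (2 * L2sqr * poisson 1 y)%:E)%E).
      apply: ge0_le_integral => //.
      - by move=> y _; rewrite lee_fin (mulr_ge0 (nm_ge0 _) (P0 y)).
      - apply/measurable_EFinP; apply: measurable_funM; first exact: mn.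
        exact: measurable_poisson.
      - by apply/measurable_EFinP; apply: measurable_funM => //; exact: measurable_poisson.
      by move=> y _; rewrite lee_fin ler_wpM2r.
    rewrite integralZ_EFin//; first by rewrite integral_poisson1 -EFinM ltry.
    exact: measurable_poisson.
  rewrite -[leLHS]fineK ?ge0_fin_numE// lee_fin.
  by rewrite (nm_real (fine I)) ler_norm.
have {}bound : nm ((2 * pi * L2sqr)%:C - c) <= nm (cint muL (f_ n)).
  by rewrite -nmN opprB.
have := le_trans (ler_norm _) (Re_le_nm ((2 * pi * L2sqr)%:C - c)).
by rewrite cReD cReN [complex.Re _%:C]/=; move: bound hn Ui; lra.
Qed.

End Plancherel.

Lemma cint_real_ge0 (R : realType) d (T : measurableType d)
    (mu : {measure set T -> \bar R}) (f : T -> R) : measurable_fun setT f ->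
  (forall x, 0 <= f x) -> cintegrable mu (fun x => (f x)%:C) ->
  (\int[mu]_x (f x)%:E = (complex.Re (cint mu (fun x => (f x)%:C)))%:E)%E.
Proof.
move=> mf f0 [_]; rewrite /L1norm; under eq_integral do rewrite nm_real ger0_norm//.
move=> fi; rewrite /cint /= /Rintegral fineK// ge0_fin_numE//.
by apply: integral_ge0 => x _; rewrite lee_fin.
Qed.

Section FourierDistance.
Context {R : realType}.
Notation muL := (@lebR R).
Let muS := @lebesgue_frequency R.
Variables (A B A' B' : R) (g w : R -> R[i]).
Hypotheses (hg : nrm muL 0 A B g) (hw : nrm muL 0 A' B' w).
Let mg : cmeasurable g := let: And3 mg _ _ := hg in mg.
Let mw : cmeasurable w := let: And3 mw _ _ := hw in mw.
Let a (xi : R) : R[i] := phys muL g (- xi).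

Let ma : cmeasurable a.
Proof. exact: (cmeasurable_comp (cmeasurable_phys muL mg)). Qed.

Lemma nm_phys_L1 x : nm (phys muL g x) <= B.
Proof.
apply: nm_cint_le; first by apply: cmeasurableM => //; exact: cmeasurable_character.
rewrite /L1norm; under eq_integral do rewrite nmM nm_cexpi mulr1.
exact: (nrm_L1 (lexx 0) hg).
Qed.

Lemma phys_multiplication :
  cint muL (fun xi => a xi * conjC (w xi)) =
  cint muL (fun x => g x * conjC (phys muL w x)).
Proof.
have wi := nrm_cintegrable (lexx 0) hw; have gi := nrm_cintegrable (lexx 0) hg.
pose f (p : R * R) := conjC (w p.1) * (g p.2 * cexpi (- p.1 * p.2)).
have mf : cmeasurable f.
  apply: cmeasurableM; first by apply: cmeasurable_conj; exact: (cmeasurable_comp mw).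
  apply: cmeasurableM; first exact: (cmeasurable_comp mg).
  by apply: cmeasurable_cexpi; apply: measurable_funM => //; exact: measurableT_comp.
have nf x y : nm (f (x, y)) = nm (w x) * nm (g y).
  by rewrite /f !nmM nm_cexpi mulr1 nm_conj.
transitivity (cint muL (fun xi => cint muL (fun x => f (xi, x)))).
  apply: eq_cint => xi; rewrite mulrC /a -cintZ//; exact: phys_cintegrable.
rewrite cint_swap//.
  apply: eq_cint => x; rewrite -cint_conj; last exact: phys_cintegrable.
  rewrite -cintZ; last first.
    split; first by apply: cmeasurable_conj; apply: cmeasurableM => //; exact: cmeasurable_character.
    rewrite /L1norm; under eq_integral do rewrite nm_conj nmM nm_cexpi mulr1.
    exact: wi.2.
  apply: eq_cint => xi; rewrite /f conjM conj_cexpi mulNr (mulrC xi x) mulrCA; congr (_ * _).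
  (* admit *)
under eq_integral do under eq_integral do rewrite nf.
under eq_integral => x _.
  rewrite integralZ_EFin ?nm_ge0//; first last.
  - by move=> y; exact: nm_ge0.
  - exact: measurable_nm.
  over.
have gB := nrm_L1 (lexx 0) hg; have wB := nrm_L1 (lexx 0) hw; rewrite /L1norm in gB wB.
apply: (@le_lt_trans _ _ (\int[muL]_x (B * nm (w x))%:E)%E).
  apply: ge0_le_integral => //.
  - move=> x _; rewrite mule_ge0 ?lee_fin ?nm_ge0//.
    by apply: integral_ge0 => y _; rewrite lee_fin nm_ge0.
  - by apply: emeasurable_funM; [exact: measurable_enm|exact: measurable_cst].
  - by apply/measurable_EFinP; apply: measurable_funM => //; exact: measurable_nm.
  by move=> x _; rewrite mulrC EFinM lee_wpmul2l ?lee_fin ?nm_ge0.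
rewrite integralZ_EFin ?(nrm_B0 hg)//; first last.
- by move=> x; exact: nm_ge0.
- exact: measurable_nm.
apply: (@le_lt_trans _ _ (B%:E * B'%:E)%E); last by rewrite -EFinM ltry.
by rewrite lee_wpmul2l ?lee_fin ?(nrm_B0 hg).
Qed.

Lemma integral_distance (c : R) : 0 <= c ->
  (\int[muL]_xi (nm (a xi - c%:C * w xi) ^+ 2)%:E <=
   (2 * pi * L2sqr g + c ^+ 2 * L2sqr w
     - 2 * c * complex.Re (cint muL (fun x => g x * conjC (phys muL w x))))%:E)%E.
Proof.
move=> c0; pose b xi := c%:C * w xi.
have mb : cmeasurable b by apply: cmeasurableM => //; exact: cmeasurable_cst.
have ia : (\int[muL]_xi (nm (a xi) ^+ 2)%:E <= (2 * pi * L2sqr g)%:E)%E.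
  have := bessel hg; rewrite -(freq_refl muS (f := fun x => (nm (phys muL g x) ^+ 2)%:E))//.
    apply/measurable_EFinP; apply: measurable_funX; apply: measurable_nm.
    exact: cmeasurable_phys.
  by move=> x; rewrite lee_fin sqr_ge0.
have ib : (\int[muL]_xi (nm (b xi) ^+ 2)%:E = (c ^+ 2 * L2sqr w)%:E)%E.
  rewrite EFinM -(L2sqrE hw) -integralZ_EFin ?sqr_ge0//; last first.
    by move=> x; rewrite sqr_ge0.
    by apply: measurable_funX; exact: measurable_nm.
  apply: eq_integral => x _; rewrite /b nmM nm_real ger0_norm// exprMn//.
have cr (f : R -> R[i]) : cmeasurable f -> (\int[muL]_xi (nm (f xi) ^+ 2)%:E < +oo)%E ->
    cintegrable muL (fun xi => (nm (f xi) ^+ 2)%:C).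
  move=> mf ff; split.
    by apply: cmeasurable_real; apply: measurable_funX; exact: measurable_nm.
  rewrite /L1norm (_ : (fun x => _) = (fun x => (nm (f x) ^+ 2)%:E))//.
  by apply/funext => x; rewrite nm_real ger0_norm ?sqr_ge0.
have ca : cintegrable muL (fun xi => (nm (a xi) ^+ 2)%:C).
  by apply: cr => //; apply: le_lt_trans ia _; rewrite ltry.
have cb : cintegrable muL (fun xi => (nm (b xi) ^+ 2)%:C).
  by apply: cr => //; rewrite ib ltry.
have cab : cintegrable muL (fun xi => a xi * conjC (b xi)).
  apply: (@cintegrable_le _ _ _ _ _ (fun xi => B * c * nm (w xi))).
  - by apply: cmeasurableM => //; exact: cmeasurable_conj.
  - by apply: measurable_funM => //; exact: measurable_nm.
  - move=> x; rewrite nmM nm_conj /b nmM nm_real ger0_norm// mulrA.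
    by rewrite ler_wpM2r ?nm_ge0// ler_wpM2r// nm_phys_L1.
  rewrite integralZ_EFin ?mulr_ge0 ?(nrm_B0 hg)//; first last.
  - by move=> x; exact: nm_ge0.
  - exact: measurable_nm.
  apply: (@le_lt_trans _ _ ((B * c)%:E * B'%:E)%E); last by rewrite -EFinM ltry.
  apply: lee_wpmul2l; first by rewrite lee_fin mulr_ge0// (nrm_B0 hg).
  exact: (nrm_L1 (lexx 0) hw).
have cba : cintegrable muL (fun xi => conjC (a xi * conjC (b xi))).
  split; first by apply: cmeasurable_conj; exact: cab.1.
  by rewrite /L1norm; under eq_integral do rewrite nm_conj; exact: cab.2.
have e x : (nm (a x - b x) ^+ 2)%:C = (nm (a x) ^+ 2)%:C + (nm (b x) ^+ 2)%:C
   - (a x * conjC (b x) + conjC (a x * conjC (b x))).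
  move: (a x) (b x) => z1 z2; rewrite -!mul_conj !conjM conjB conjcK.
  by move: (conjC z1) (conjC z2) => z3 z4; ring.
have ci : cintegrable muL (fun xi => (nm (a xi - b xi) ^+ 2)%:C).
  under eq_fun do rewrite e.
  apply: cintegrableD; first exact: cintegrableD.
  by apply: cintegrableN; exact: cintegrableD.
rewrite (cint_real_ge0 _ _ ci); last 2 first.
- by apply: measurable_funX; apply: measurable_nm; exact: cmeasurableB.
- by move=> x; exact: sqr_ge0.
rewrite lee_fin.
have -> : cint muL (fun x => (nm (a x - b x) ^+ 2)%:C) =
   cint muL (fun x => (nm (a x) ^+ 2)%:C) + cint muL (fun x => (nm (b x) ^+ 2)%:C) -
   (cint muL (fun x => a x * conjC (b x)) + conjC (cint muL (fun x => a x * conjC (b x)))).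
  rewrite -(cint_conj cab) -(cintD cab cba) -(cintD ca cb).
  apply: (eq_trans _ (cintB (cintegrableD ca cb) (cintegrableD cab cba))).
  exact: eq_cint.
have -> : cint muL (fun x => a x * conjC (b x)) =
    c%:C * cint muL (fun x => g x * conjC (phys muL w x)).
  rewrite -phys_multiplication -cintZ.
    by apply: eq_cint => x; rewrite /b conjM conjc_real mulrCA.
  apply: (@cintegrable_le _ _ _ _ _ (fun xi => B * nm (w xi))).
  - by apply: cmeasurableM => //; exact: cmeasurable_conj.
  - by apply: measurable_funM => //; exact: measurable_nm.
  - by move=> x; rewrite nmM nm_conj ler_wpM2r ?nm_ge0// nm_phys_L1.
  rewrite integralZ_EFin ?(nrm_B0 hg)//; first last.
  - by move=> x; exact: nm_ge0.
  - exact: measurable_nm.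
  apply: (@le_lt_trans _ _ (B%:E * B'%:E)%E); last by rewrite -EFinM ltry.
  apply: lee_wpmul2l; first by rewrite lee_fin (nrm_B0 hg).
  exact: (nrm_L1 (lexx 0) hw).
have ra : complex.Re (cint muL (fun x => (nm (a x) ^+ 2)%:C)) <= 2 * pi * L2sqr g.
  rewrite -lee_fin -cint_real_ge0//.
  - by apply: measurable_funX; exact: measurable_nm.
  - by move=> x; exact: sqr_ge0.
have rb : complex.Re (cint muL (fun x => (nm (b x) ^+ 2)%:C)) = c ^+ 2 * L2sqr w.
  apply: EFin_inj; rewrite -cint_real_ge0//.
  - by apply: measurable_funX; exact: measurable_nm.
  - by move=> x; exact: sqr_ge0.
move: ra rb; set z := cint muL (fun x => g x * _).
move: (cint muL (fun x => (nm (a x) ^+ 2)%:C)) (cint muL (fun x => (nm (b x) ^+ 2)%:C)) => za zb ra rb.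
have rz : complex.Re (c%:C * z) = c * complex.Re z by rewrite cReM /= mul0r subr0.
by rewrite !(cReD, cReN, cReJ) rb rz; move: ra (complex.Re z) => ra' r; lra.
Qed.

End FourierDistance.

(** * Fourier inversion on the line *)

Section LineFourier.
Context {R : realType}.
Notation leb := (@lebesgue_measure R).
Notation muL := (@lebR R).
Let muS := @lebesgue_frequency R.
Implicit Types (w u g : R -> R[i]) (A B c xi : R).

Definition cutoff A u x : R[i] := (\1_`[- A, A]%classic x)%:C * u x.

Lemma cutoffE A u x : cutoff A u x = if x \in `[- A, A] then u x else 0.
Proof.
by rewrite /cutoff indicE mem_setE; case: (x \in _); rewrite ?mul1r ?mul0r.
Qed.

Lemma cmeasurable_cutoff A u : cmeasurable u -> cmeasurable (cutoff A u).
Proof.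
by move=> mu; apply: cmeasurableM => //; apply: cmeasurable_real; exact: measurable_indic.
Qed.

Lemma nrm_cutoff A B u : cmeasurable u -> (forall x, nm (u x) <= B) ->
  nrm muL 0 B (B * expR A * 2) (cutoff A u).
Proof.
move=> mu uB; have B0 : 0 <= B by apply: le_trans (nm_ge0 (u 0)) (uB 0).
have mc := cmeasurable_cutoff A mu.
have wt0 (x : R) : wt 0 x = 1 by rewrite /wt mul0r expR0.
split => //.
  move=> x; rewrite wt0 mul1r cutoffE; case: ifP => _ //.
  by rewrite nm0.
have mE : measurable_fun setT (fun x : R => expR (- (1 * `|x|))).
  by have := measurable_wt (- 1 : R); rewrite /wt; under eq_fun do rewrite mulNr.
apply: (@le_trans _ _ (\int[muL]_x (B * expR A * expR (- (1 * `|x|)))%:E)%E).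
  apply: ge0_le_integral => //.
  - by move=> x _; rewrite lee_fin wt0 mul1r nm_ge0.
  - by apply/measurable_EFinP; under eq_fun do rewrite wt0 mul1r; exact: measurable_nm.
  - by apply/measurable_EFinP; exact: measurable_funM.
  move=> x _; rewrite lee_fin wt0 mul1r cutoffE -mulrA -expRD mul1r.
  case: ifP => [|_]; last by rewrite nm0 mulr_ge0 ?expR_ge0.
  rewrite in_itv /= -ler_norml => xA; apply: le_trans (uB x) _.
  by rewrite ler_peMr// -[leLHS]expR0 ler_expR subr_ge0.
rewrite integralZ_EFin ?mulr_ge0 ?expR_ge0//.
by rewrite integral_exp// divr1.
Qed.

Lemma truncated_fourierE A u xi : cmeasurable u ->
  truncated_fourier A u xi = phys muL (cutoff A u) (- xi).
Proof.
move=> mu; rewrite /truncated_fourier cintegralE//.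
  by apply: eq_cint => x; rewrite mulrA mulNr (mulrC xi).
apply: cmeasurableM => //; apply: cmeasurable_cexpi.
by apply: measurable_funN; exact: measurable_funM.
Qed.

Lemma Lnorm2_lt d (T : measurableType d) (mu : {measure set T -> \bar R}) (f : T -> R) e :
  (forall x, 0 <= f x) -> 0 < e ->
  ('N[mu]_2%:E [(fun x => (f x)%:E)] < e%:E)%E ->
  (\int[mu]_x (f x ^+ 2)%:E <= (e ^+ 2)%:E)%E.
Proof.
move=> f0 e0; rewrite LnormE//.
under eq_integral do rewrite powR_mulrn//.
have : (0 <= \int[mu]_x (f x ^+ 2)%:E)%E.
  by apply: integral_ge0 => x _; rewrite lee_fin sqr_ge0.
case: (integral _ _ _) => [r|_|//].
  rewrite !lee_fin poweR_EFin lte_fin => r0; rewrite powR12_sqrt// => /ltW h.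
  rewrite -(sqr_sqrtr r0) ler_pXn2r// nnegrE ?sqrtr_ge0//; exact: ltW.
by rewrite poweRyr ?invr_eq0 ?pnatr_eq0// ltNge leey.
Qed.

(** Two L2 limits of the same truncated transforms agree almost everywhere. *)
Lemma fourier_line_unique u g g' : cmeasurable u -> is_fourier_line u g ->
  is_fourier_line u g' -> {ae leb, forall xi, g xi = g' xi}.
Proof.
move=> mu [mg cg] [mg' cg'].
have md : cmeasurable (fun xi => g xi - g' xi) by exact: cmeasurableB.
have md2 : measurable_fun setT (fun xi => nm (g xi - g' xi) ^+ 2).
  by apply: measurable_funX; exact: measurable_nm.
have le_e e : 0 < e -> (\int[leb]_xi (nm (g xi - g' xi) ^+ 2)%:E <= (4 * e ^+ 2)%:E)%E.
  move=> e0.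
  have lt_e : nbhs (0%E : \bar R) [set x | (x < e%:E)%E].
    apply: open_nbhs_nbhs; split; first exact: open_ereal_lt_ereal.
    by rewrite /= lte_fin.
  pose n g1 A := ('N[leb]_2%:E
    [(fun xi => (nm (truncated_fourier A u xi - g1 xi))%:E)])%E.
  have h1 : \forall A \near +oo%R, (n g A < e%:E)%E by exact: cg _ lt_e.
  have h2 : \forall A \near +oo%R, (n g' A < e%:E)%E by exact: cg' _ lt_e.
  have [A [h h']] := filter_ex (filterI h1 h2).
  have mF : cmeasurable (truncated_fourier A u).
    rewrite (_ : truncated_fourier A u = (fun xi => phys muL (cutoff A u) (- xi))).
      apply: (cmeasurable_comp (f := phys muL (cutoff A u))) => //.
      exact/cmeasurable_phys/cmeasurable_cutoff.
    by apply/funext => xi; exact: truncated_fourierE.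
  have m1 (g1 : R -> R[i]) : cmeasurable g1 ->
      measurable_fun setT (fun xi => nm (truncated_fourier A u xi - g1 xi) ^+ 2).
    by move=> mg1; apply: measurable_funX; apply: measurable_nm; exact: cmeasurableB.
  apply: (@le_trans _ _ (\int[leb]_xi (2 * nm (truncated_fourier A u xi - g xi) ^+ 2)%:E +
     \int[leb]_xi (2 * nm (truncated_fourier A u xi - g' xi) ^+ 2)%:E)%E).
    rewrite -ge0_integralD//; first last.
    - by apply/measurable_EFinP; apply: measurable_funM => //; exact: m1.
    - by move=> x _; rewrite lee_fin mulr_ge0 ?sqr_ge0.
    - by apply/measurable_EFinP; apply: measurable_funM => //; exact: m1.
    - by move=> x _; rewrite lee_fin mulr_ge0 ?sqr_ge0.
    apply: ge0_le_integral => //.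
    - by move=> x _; rewrite lee_fin sqr_ge0.
    - exact/measurable_EFinP.
    - apply/measurable_EFinP; apply: measurable_funD; apply: measurable_funM => //; exact: m1.
    move=> x _; rewrite -EFinD lee_fin.
    set z := truncated_fourier A u x.
    have t : nm (g x - g' x) <= nm (z - g x) + nm (z - g' x).
      rewrite -nmN (_ : - (g x - g' x) = (z - g x) - (z - g' x)); last by ring.
      exact: nmB.
    apply: (@le_trans _ _ ((nm (z - g x) + nm (z - g' x)) ^+ 2)).
      by rewrite ler_pXn2r// nnegrE ?addr_ge0 ?nm_ge0.
    have := sqr_ge0 (nm (z - g x) - nm (z - g' x)).
    by rewrite sqrrB sqrrD; lra.
  rewrite !integralZ_EFin//; first last.
  - by move=> x; exact: sqr_ge0.
  - exact: m1.
  - by move=> x; exact: sqr_ge0.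
  - exact: m1.
  apply: (@le_trans _ _ (2%:E * (e ^+ 2)%:E + 2%:E * (e ^+ 2)%:E)%E).
    by apply: leeD; apply: lee_wpmul2l => //; apply: Lnorm2_lt => // x; exact: nm_ge0.
  by rewrite -!EFinM -EFinD lee_fin; lra.
have i0 : (\int[leb]_xi `|(nm (g xi - g' xi) ^+ 2)%:E| = 0)%E.
  under eq_integral do rewrite gee0_abs ?lee_fin ?sqr_ge0//.
  apply/eqP; rewrite eq_le integral_ge0 ?andbT; last by move=> x _; rewrite lee_fin sqr_ge0.
  apply/lee_addgt0Pr => e e0; rewrite add0e.
  have h0 : 0 < Num.sqrt (e / 4) by rewrite sqrtr_gt0 divr_gt0.
  apply: le_trans (le_e _ h0) _; rewrite lee_fin sqr_sqrtr; last by rewrite ltW// divr_gt0.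
  lra.
have mE : measurable_fun setT (fun xi : measurableTypeR R => (nm (g xi - g' xi) ^+ 2)%:E).
  exact/measurable_EFinP.
move/(ae_eq_integral_abs leb measurableT mE) : i0; apply: filterS => x /(_ I) [] /eqP.
rewrite sqrf_eq0 => /eqP h; apply/eqP; rewrite -subr_eq0; apply/eqP.
exact: Normc.eq0_normc.
Qed.


Variable w : R -> R[i].
Hypotheses (dw : edec w) (cw : seqc w).
Let u := phys muL w.

Lemma edec_nrm : exists A B, nrm muL 0 A B w.
Proof.
have [mw [k [C [k0 h]]]] := dw; have h1 := nrm_of_sup muS k0 mw h.
by do 2 eexists; apply: nrm_wt_le h1; rewrite divr_ge0// ltW.
Qed.

Let mu_ : cmeasurable u. Proof. exact: cmeasurable_phys dw.1. Qed.

Let L2 A := L2sqr (cutoff A u).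

Let L2E : exists B, forall A,
  (\int[muL]_x (nm (cutoff A u x) ^+ 2)%:E)%E = (L2 A)%:E /\
  nrm muL 0 B (B * expR A * 2) (cutoff A u).
Proof.
have [A0 [B hw]] := edec_nrm; exists B => A.
have hc := nrm_cutoff A mu_ (nm_phys_L1 hw).
by split => //; exact: L2sqrE hc.
Qed.

Let W := L2sqr w.

(** Parseval's identity, in the limit of large windows. *)
Lemma cutoff_L2_cvg e : 0 < e -> exists n : nat, forall A, n%:R <= A ->
  2 * pi * W - e <= L2 A.
Proof.
move=> e0; have [A0 [B0 hw]] := edec_nrm; have [B hB] := L2E.
have mc A : cmeasurable (cutoff A u) by exact: cmeasurable_cutoff.
have le_cut A A' x : A <= A' -> nm (cutoff A u x) ^+ 2 <= nm (cutoff A' u x) ^+ 2.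
  move=> AA'; rewrite !cutoffE; case: ifP => [xA|_]; last by rewrite nm0 expr0n sqr_ge0.
  case: ifP => //; move: xA; rewrite !in_itv /= -!ler_norml => xA.
  by rewrite (le_trans xA AA').
have mono A A' : A <= A' -> L2 A <= L2 A'.
  move=> AA'; rewrite -lee_fin -(hB A).1 -(hB A').1; apply: ge0_le_integral => //.
  - by move=> x _; rewrite lee_fin sqr_ge0.
  - by apply/measurable_EFinP; apply: measurable_funX; exact: measurable_nm.
  - by apply/measurable_EFinP; apply: measurable_funX; exact: measurable_nm.
  - by move=> x _; rewrite lee_fin le_cut.
have [n hn] : exists n : nat, 2 * pi * W - e <= L2 n%:R.
  apply: contrapT => /forallNP h.
  have : (\int[muL]_x (nm (u x) ^+ 2)%:E <= (2 * pi * W - e)%:E)%E.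
    apply: (@le_integral_mono _ _ _ _ (fun n x => nm (cutoff n%:R u x) ^+ 2)).
    - by move=> n; apply: measurable_funX; exact: measurable_nm.
    - by move=> n x; exact: sqr_ge0.
    - by move=> n x; apply: le_cut; rewrite ler_nat.
    - move=> x; apply: cvg_near_cst; near=> n; rewrite cutoffE ifT//.
      rewrite in_itv /= -ler_norml; near: n; exact: nbhs_infty_ger.
    - move=> n; rewrite (hB n%:R).1 lee_fin ltW// ltNge; apply/negP; exact: h.
  apply/negP; rewrite -ltNge; apply: lt_le_trans (plancherel_ge hw cw).
  by rewrite lte_fin ltrBlDr ltrDl.
by exists n => A nA; apply: le_trans hn (mono _ _ nA).
Unshelve. all: by end_near. Qed.

Lemma is_fourier_line_phys : is_fourier_line u (fun xi => (2 * pi)%:C * w xi).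
Proof.
have [A0 [B0 hw]] := edec_nrm; have [B hB] := L2E.
have mb : cmeasurable (fun xi => (2 * pi)%:C * w xi).
  by apply: cmeasurableM; [exact: cmeasurable_cst|exact: dw.1].
split => //.
have pi0 : 0 <= 2 * pi :> R := pi2_ge0.
pose d A xi := nm (truncated_fourier A u xi - (2 * pi)%:C * w xi).
have md A : measurable_fun setT (d A).
  apply: measurable_nm; apply: cmeasurableB => //.
  rewrite (_ : truncated_fourier A u = (fun xi => phys muL (cutoff A u) (- xi))).
    apply: (cmeasurable_comp (f := phys muL (cutoff A u))) => //.
    exact/cmeasurable_phys/cmeasurable_cutoff.
  by apply/funext => xi; exact: truncated_fourierE.
have dist A : (\int[leb]_xi (d A xi ^+ 2)%:E <= (2 * pi * (2 * pi * W - L2 A))%:E)%E.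
  rewrite -integral_lebR; last by apply/measurable_EFinP; exact: measurable_funX.
  rewrite /d; under eq_integral do rewrite truncated_fourierE//.
  apply: le_trans (integral_distance (hB A).2 hw pi0) _; rewrite lee_fin.
  have -> : cint muL (fun x => cutoff A u x * conjC (phys muL w x)) =
      cint muL (fun x => (nm (cutoff A u x) ^+ 2)%:C).
    apply: eq_cint => x; rewrite -mul_conj cutoffE; case: ifP => _ //.
    by rewrite !mul0r.
  have -> : complex.Re (cint muL (fun x => (nm (cutoff A u x) ^+ 2)%:C)) = L2 A by [].
  rewrite -/(L2 A) -/W; move: (2 * pi) (L2 A) W => p l w'; lra.
have d0 A : (0 <= \int[leb]_xi (d A xi ^+ 2)%:E)%E.
  by apply: integral_ge0 => x _; rewrite lee_fin sqr_ge0.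
pose I A := fine (\int[leb]_xi (d A xi ^+ 2)%:E)%E.
have IE A : (\int[leb]_xi (d A xi ^+ 2)%:E)%E = (I A)%:E.
  by rewrite fineK// ge0_fin_numE//; apply: le_lt_trans (dist A) _; rewrite ltry.
have I0 A : 0 <= I A by rewrite -lee_fin -IE.
rewrite (_ : (fun A => _) = (fun A => (Num.sqrt (I A))%:E)); last first.
  apply/funext => A; rewrite LnormE//; last by move=> x; exact: nm_ge0.
  rewrite -powR12_sqrt// -poweR_EFin -IE; congr (_ `^ _)%E; apply: eq_integral => x _.
  by rewrite powR_mulrn// nm_ge0.
apply: cvg_EFin; first exact: nearW.
apply/cvgrPdist_le => e e0.
have pi1 : 0 < 2 * pi :> R by rewrite mulr_gt0// pi_gt0.
have [n hn] := cutoff_L2_cvg (divr_gt0 (exprn_gt0 2 e0) pi1).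
near=> A; rewrite /= sub0r normrN ger0_norm ?sqrtr_ge0//.
rewrite -[leRHS]ger0_norm ?(ltW e0)// -sqrtr_sqr ler_wsqrtr//.
rewrite -lee_fin -IE; apply: le_trans (dist A) _; rewrite lee_fin.
rewrite mulrC -ler_pdivlMr// lerBlDr -lerBlDl; apply: hn; near: A.
exact: (nbhs_pinfty_ge (num_real _)).
Unshelve. all: by end_near. Qed.

End LineFourier.

Lemma line_admissible (R : realType) : admissible (line R) (@lebR R) setT.
Proof.
split.
- exact: lebesgue_frequency.
- exact: measurable_id_leb.
- by move=> f mf f0; rewrite integral_lebR.
- move=> w dw cw; have [A0 [B0 hw]] := edec_nrm dw.
  have mu := cmeasurable_phys (@lebR R) dw.1.
  have mu2 : measurable_fun setT (fun x => nm (phys (@lebR R) w x)) by exact: measurable_nm.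
  have ex := is_fourier_line_phys dw cw.
  have F : is_fourier_line (phys (@lebR R) w) (fourier (line R) (phys (@lebR R) w)).
    exact: (xgetPex (cst 0) (P := [set g | is_fourier_line (phys (@lebR R) w) g]) (ex_intro _ _ ex)).
  split => //.
  + rewrite /= patch_setT LnormE//; last by move=> x; exact: nm_ge0.
    apply: poweR_lty.
    under eq_integral do rewrite powR_mulrn ?nm_ge0//.
    rewrite -integral_lebR; last by apply/measurable_EFinP; exact: measurable_funX.
    by apply: le_lt_trans (bessel hw) _; rewrite ltry.
  + exact: F.1.
  + exact: (fourier_line_unique mu F ex).
- move=> n r r0; rewrite (_ : [set x | _] = `[n%:R, n%:R + r]%classic); last first.
    by apply/seteqP; split=> x /=; rewrite in_itv.
  rewrite /lebR /= /pushforward_leb /pushforward preimage_id lebesgue_measure_itv /= lte_fin.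
  rewrite ltrDl; case: ltP => r1; last by rewrite lee_fin.
  by rewrite -EFinD lee_fin addrAC subrr add0r.
- move=> n r r0; rewrite (_ : [set x | _] = `[n%:R - r, n%:R + r]%classic); last first.
    by apply/seteqP; split=> x /=; rewrite in_itv.
  rewrite /lebR /= /pushforward_leb /pushforward preimage_id lebesgue_measure_itv /= lte_fin.
  case: ifP => _; last by rewrite lee_fin addr_ge0// mulr_ge0.
  by rewrite -EFinD lee_fin; lra.
Qed.

(** * Counting measure on the integers as a frequency measure *)

Section CountingMeasure.
Context {R : realType}.
Notation cnt := (@counting int R).

Lemma counting_bij (h h' : int -> int) (A : set int) : cancel h h' -> cancel h' h ->
  cnt (h @^-1` A) = cnt A.
Proof.
move=> hK h'K; have e : h @` (h @^-1` A) = A.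
  by apply/seteqP; split=> [_ [x hx <-]//|x Ax]; exists (h' x) => //=; rewrite h'K.
rewrite /counting; have [fA|iA] := pselect (finite_set A).
  have fhA : finite_set (h @^-1` A).
    by apply: finite_preimage => // x y _ _; exact: can_inj hK x y.
  rewrite !asboolT// -[in RHS]e fset_set_image//.
  by rewrite finmap.card_imfset//; exact: can_inj hK.
rewrite !asboolF//; apply: contra_not iA => fhA; rewrite -e; exact: finite_image.
Qed.

Lemma counting1 (k : int) : cnt [set k] = 1%E.
Proof. by rewrite /counting asboolT// fset_set1 finmap.cardfs1. Qed.

Definition int_val : int -> R := fun k => k%:~R.

Lemma measurable_int_fun d (T : measurableType d) (f : int -> T) : measurable_fun setT f.
Proof. by move=> _ A _; exact: I. Qed.

Definition pushforward_cnt : set R -> \bar R := pushforward cnt int_val.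

HB.instance Definition _ := Measure.copy pushforward_cnt
  (measure_function_pushforward__canonical__measure_function_Measure cnt
    (@measurable_int_fun _ _ int_val)).

(** A half-open unit interval contains exactly one integer. *)
Lemma cnt_unit (x : R) : pushforward_cnt `]x - 1, x]%classic = 1%E.
Proof.
rewrite /pushforward_cnt /pushforward (_ : _ @^-1` _ = [set Num.floor x]) ?counting1//.
have /andP[h1 h2] := floor_itv x.
apply/seteqP; split=> k; rewrite /int_val /= in_itv /=.
  move=> /andP[k1 k2]; apply/esym/floor_def; rewrite k2/= intrD.
  by move: k1; rewrite ltrBlDr.
by move=> ->; rewrite h1 andbT; move: h2; rewrite intrD ltrBlDr.
Qed.

Lemma cnt_units (x : R) (m : nat) : pushforward_cnt `]x, x + m%:R]%classic = m%:R%:E.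
Proof.
elim: m => [|m IH].
  by rewrite addr0 set_itv_ge ?measure0// -leNgt bnd_simp.
rewrite (_ : `]x, x + m.+1%:R]%classic =
    `]x, x + m%:R]%classic `|` `](x + m.+1%:R) - 1, x + m.+1%:R]%classic).
  rewrite measureU//.
    - by apply: (eq_trans (f_equal2 _ IH (cnt_unit _))); rewrite -EFinD natr1.
    - rewrite -natr1 addrA addrK; apply/seteqP; split => // y /=.
      by rewrite !in_itv /= => -[/andP[_ h1] /andP[h2 _]]; move: (lt_le_trans h2 h1); rewrite ltxx.
rewrite -natr1 addrA addrK -itv_bndbnd_setU// bnd_simp ?lerDl//.
Qed.

Lemma pushforward_cnt_itv (x y : R) : (pushforward_cnt `[x, y]%classic < +oo)%E.
Proof.
pose m := Num.bound `|y - x + 1|.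
apply: (@le_lt_trans _ _ (pushforward_cnt `]x - 1, x - 1 + m%:R]%classic)); last first.
  by rewrite cnt_units ltry.
apply: le_measure; rewrite ?inE//.
move=> z /=; rewrite !in_itv /= => /andP[h1 h2].
have : y - x + 1 < m%:R.
  by apply: le_lt_trans (ler_norm _) (archi_boundP (normr_ge0 _)).
by move=> h; apply/andP; split; lra.
Qed.

Lemma sigma_finite_pushforward_cnt : sigma_finite setT pushforward_cnt.
Proof.
exists (fun n : nat => `[- n%:R, n%:R]%classic : set R).
  apply/seteqP; split=> // x _; exists (Num.bound `|x|) => //=.
  rewrite in_itv /= -ler_norml ltW//; exact: (archi_boundP (normr_ge0 _)).
by move=> n; split; [exact: measurable_itv|exact: pushforward_cnt_itv].
Qed.

HB.instance Definition _ := @Measure_isSigmaFinite.Build _ _ _ pushforward_cnt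
  sigma_finite_pushforward_cnt.

Definition cntR : {sigma_finite_measure set R -> \bar R} := pushforward_cnt.

Lemma integral_cntR (f : R -> \bar R) : measurable_fun setT f -> (forall x, 0 <= f x)%E ->
  (\int[cntR]_x f x = \int[cnt]_k f k%:~R)%E.
Proof.
move=> mf f0; rewrite (ge0_integral_pushforward (@measurable_int_fun _ _ int_val))//.
Qed.

End CountingMeasure.
Section CountingFrequency.
Context {R : realType}.
Notation cnt := (@counting int R).
Notation muT := (@cntR R).
Notation muL := (@lebR R).

Definition integers : set R := range (@int_val R).

Lemma measurable_integers : measurable integers.
Proof.
rewrite (_ : integers = \bigcup_n ([set (n%:R : R)] `|` [set - (n%:R : R)])).
  by apply: bigcupT_measurable => n; apply: measurableU; exact: measurable_set1.
apply/seteqP; split=> x.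
  by case=> -[n|n] _ <-; [exists n => //; left|exists n.+1 => //; right; rewrite /int_val /= NegzE mulrNz].
by case=> n _ [] ->; [exists n%:Z|exists (- n%:Z); rewrite // /int_val mulrNz].
Qed.

Lemma integral_cnt_bij (h h' : int -> int) (f : int -> \bar R) :
  cancel h h' -> cancel h' h -> (forall k, 0 <= f k)%E ->
  (\int[cnt]_k f (h k) = \int[cnt]_k f k)%E.
Proof.
move=> hK h'K f0; have mh := @measurable_int_fun _ _ h.
pose nu : {measure set int -> \bar R} :=
  measure_function_pushforward__canonical__measure_function_Measure cnt mh.
rewrite [RHS](@eq_measure_integral _ _ _ setT nu); last first.
  by move=> A _ _; rewrite /= /pushforward (counting_bij _ hK h'K).
by rewrite ge0_integral_pushforward// ; exact: measurable_int_fun.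
Qed.

(** Each unit interval carries as much mass as for Lebesgue measure, which
    bounds exponential sums by exponential integrals. *)
Lemma cnt_exp (k : R) : 0 < k -> (\int[muT]_x (expR (- (k * `|x|)))%:E < +oo)%E.
Proof.
move=> k0; have mE : measurable_fun setT (fun x : R => expR (- (k * `|x|))).
  by have := measurable_wt (- k); rewrite /wt; under eq_fun do rewrite mulNr.
have m1 : measurable_fun setT (\1_`[0, 1[%classic : R -> R) by exact: measurable_indic.
pose f (p : R * R) : R := expR k * expR (- (k * `|p.2|)) * \1_`[0, 1[%classic (p.2 - p.1).
have mf : measurable_fun setT f.
  apply: measurable_funM; first by apply: measurable_funM => //; exact: (measurableT_comp mE).
  apply: (measurableT_comp m1).
  exact: measurable_funB.
have f0 p : 0 <= f p by rewrite !mulr_ge0 ?expR_ge0.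
apply: (@le_lt_trans _ _ (\int[muT]_y \int[muL]_x (f (y, x))%:E)%E).
  apply: ge0_le_integral => //.
  - exact/measurable_EFinP.
  - apply: (@measurable_integral2 _ _ _ _ _ muL (fun p => (f p)%:E)); exact/measurable_EFinP.
  move=> y _.
  apply: (@le_trans _ _ (\int[muL]_x (expR (- (k * `|y|)) * \1_`[0, 1[%classic (x - y))%:E)%E).
    rewrite integralZ_EFin ?expR_ge0//; last first.
      by apply: (measurableT_comp m1); exact: measurable_funB.
    have := freq_shift lebesgue_frequency (c := y) (f := fun x => (\1_`[0, 1[%classic x)%:E) I.
    move=> ->; last 2 first.
    - by apply/measurable_EFinP.
    - by move=> x; rewrite lee_fin.
    rewrite integral_lebR; last by apply/measurable_EFinP.
    rewrite integral_indic// setIT /= lebesgue_measure_itv /= lte_fin ltr01 -EFinD subr0 mule1.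
    exact: lexx.
  apply: ge0_le_integral => //.
  - apply/measurable_EFinP; apply: measurable_funM => //.
    by apply: (measurableT_comp m1); exact: measurable_funB.
  - apply/measurable_EFinP; exact: (measurableT_comp mf (measurable_pair1 _)).
  move=> x _; rewrite lee_fin /f /= indicE mem_setE in_itv /=.
  case: (boolP (0 <= x - y < 1)) => [/andP[h1 h2]|_]; last by rewrite !mulr0.
  rewrite !mulr1 -expRD ler_expR.
  have : `|x| <= `|y| + 1.
    rewrite -(subrK y x) addrC; apply: le_trans (ler_normD _ _) _; rewrite lerD2l ger0_norm// ltW//.
  by move=> /(ler_wpM2l (ltW k0)); lra.
have mfE : measurable_fun setT (fun p => (f p)%:E) by exact/measurable_EFinP.
rewrite (fubini_tonelli _ mfE)/=; last by move=> p; rewrite lee_fin.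
apply: (@le_lt_trans _ _ (\int[muL]_x (expR k * expR (- (k * `|x|)))%:E)%E); last first.
  rewrite integralZ_EFin ?expR_ge0// integral_exp// -EFinM ltry//.
apply: ge0_le_integral => //.
- by move=> x _; apply: integral_ge0 => y _; rewrite lee_fin.
- apply: (@measurable_integral2 _ _ _ _ _ muT (fun p => (f (p.2, p.1))%:E)).
  by apply/measurable_EFinP; exact: (measurableT_comp mf (@measurable_swap _ _ _ _)).
- by apply/measurable_EFinP; exact: measurable_funM.
move=> x _; pose c := expR k * expR (- (k * `|x|)).
have c0 : 0 <= c by rewrite mulr_ge0 ?expR_ge0.
apply: (@le_trans _ _ (\int[muT]_y (c * \1_(`]x - 1, x]%classic : set R) y)%:E)%E).
  rewrite le_eqVlt; apply/orP; left; apply/eqP; apply: eq_integral => y _.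
  by rewrite /f !indicE !mem_setE !in_itv /= subr_ge0 ltrBlDr ltrBlDl andbC.
have m2 : measurable_fun setT (\1_`]x - 1, x]%classic : R -> R) by exact: measurable_indic.
have i0 y : 0 <= (\1_`]x - 1, x]%classic : R -> R) y by rewrite indicE.
rewrite (integralZ_EFin _ c0 m2 i0).
rewrite integral_indic// setIT -[leRHS]mule1; apply: lee_wpmul2l; first by rewrite lee_fin.
by rewrite /= cnt_unit.
Qed.

Lemma counting_frequency : frequency_measure muT integers.
Proof.
have mi (f : R -> \bar R) (g : R -> R) : measurable_fun setT f -> measurable_fun setT g -> measurable_fun setT (fun x => f (g x)).
  by move=> mf mg; exact: measurableT_comp.
split.
- exists (~` integers); split => //; first by apply: measurableC; exact: measurable_integers.
  rewrite /= /pushforward_cnt /pushforward (_ : _ @^-1` _ = set0) ?measure0//.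
  by apply/seteqP; split => // k; apply; exists k.
- move=> c f [m _ <-] mf f0.
  rewrite !integral_cntR//; last by apply: mi => //; exact: measurable_funB.
  rewrite -(@integral_cnt_bij (fun k => k - m) (fun k => k + m) (fun k => f k%:~R))//.
  + by apply: eq_integral => k _; rewrite /int_val intrB.
  + by move=> k; rewrite subrK.
  + by move=> k; rewrite addrK.
- move=> f mf f0; rewrite !integral_cntR//; last by apply: mi => //; exact: oppr_measurable.
  rewrite -(@integral_cnt_bij (fun k => - k) (fun k => - k) (fun k => f k%:~R))//.
  + by apply: eq_integral => k _; rewrite intrN.
  + by move=> k; rewrite opprK.
  + by move=> k; rewrite opprK.
- exact: cnt_exp.
Qed.

End CountingFrequency.
Section TorusFourier.
Context {R : realType}.
Notation leb := (@lebesgue_measure R).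
Notation cnt := (@counting int R).
Notation muT := (@cntR R).
Notation muL := (@lebR R).
Let muS := @counting_frequency R.
Implicit Types (k m : int) (x : R).
Let D : set R := `[0, 2 * pi[%classic.
Let measD : measurable D. Proof. exact: measurable_itv. Qed.
Let mD : measurable_fun setT (\1_D : R -> R). Proof. exact: measurable_indic. Qed.

Lemma cexpi_2pi k : cexpi (2 * pi * k%:~R) = 1 :> R[i].
Proof.
have nat_case (n : nat) : cexpi (2 * pi * n%:R) = 1 :> R[i].
  elim: n => [|n IH]; first by rewrite mulr0 cexpi0.
  have -> : 2 * pi * n.+1%:R = 2 * pi * n%:R + pi *+ 2 :> R.
    by rewrite -[n.+1%:R]natr1 -mulr_natl; ring.
  by rewrite cexpiD IH mul1r /cexpi cos2pi sin2pi.
case: k => n; first exact: nat_case.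
by rewrite NegzE mulrNz mulrN -conj_cexpi nat_case conjc1.
Qed.

Lemma integral_trig (F f : R -> R) : F 0 = F (2 * pi) -> continuous f ->
  (forall x, is_derive x (1 : R) F (f x)) -> Rintegral leb D f = 0.
Proof.
move=> F02 cf dF; have pi1 : 0 < 2 * pi :> R by rewrite mulr_gt0// pi_gt0.
have cF : continuous F.
  by move=> x; apply: differentiable_continuous; apply/derivable1_diffP; case: (dF x).
rewrite /Rintegral integral_itv_bndo_bndc; last first.
  apply/measurable_EFinP; apply: measurable_funTS; exact: continuous_measurable_fun.
rewrite (@continuous_FTC2 _ _ F)//.
- by rewrite -F02 -EFinB subrr.
- exact: continuous_subspaceT.
- split.
  + by move=> x _; case: (dF x).
  + by apply: cvg_at_right_filter; exact: cF.
  + by apply: cvg_at_left_filter; exact: cF.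
- by move=> x _; rewrite derive1E; case: (dF x).
Qed.

Lemma character_orthogonality m :
  cint muL (fun x => (\1_D x)%:C * cexpi (x * m%:~R)) = (if m == 0 then 2 * pi else 0)%:C.
Proof.
case: eqP => [->|/eqP m0].
  under eq_cint do rewrite mulr0 cexpi0 mulr1.
  rewrite /cint /= /Rintegral integral0 integral_lebR; last first.
    by apply/measurable_EFinP; exact: mD.
  rewrite integral_indic// setIT /= lebesgue_measure_itv /= lte_fin mulr_gt0 ?pi_gt0//.
  by rewrite -EFinB subr0.
have m0' : (m%:~R : R) != 0 by rewrite intr_eq0.
rewrite -cintegralE//; last by apply: cmeasurable_cexpi; exact: measurable_funM.
have [c2 s2] : cos (2 * pi * m%:~R) = 1 :> R /\ sin (2 * pi * m%:~R) = 0 :> R.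
  by have [] := cexpi_2pi m.
have cm : continuous (fun x : R => x * m%:~R) by exact: mulrr_continuous.
rewrite /cintegral /=; congr (_ +i* _).
  apply: (@integral_trig (fun x => (m%:~R)^-1 * sin (x * m%:~R))).
  - by rewrite s2 mul0r sin0.
  - by move=> x; apply: continuous_comp; [exact: cm|exact: continuous_cos].
  - move=> x; apply: is_derive_eq; rewrite /GRing.scale /=.
    by field.
apply: (@integral_trig (fun x => - (m%:~R)^-1 * cos (x * m%:~R))).
- by rewrite c2 mul0r cos0.
- by move=> x; apply: continuous_comp; [exact: cm|exact: continuous_sin].
- move=> x; apply: is_derive_eq; rewrite /GRing.scale /=.
  by field.
Qed.

Variable w : R -> R[i].
Hypotheses (dw : edec w).
Let u := phys muT w.

Lemma phys_periodic x : u (x + 2 * pi) = u x.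
Proof.
apply: cint_ae; [by apply: cmeasurableM; [exact: dw.1|exact: cmeasurable_character]..|].
apply: filterS (freq_null muS) => _ [k _ <-]; rewrite mulrDl cexpiD.
by rewrite cexpi_2pi mulr1.
Qed.

Lemma nm_phys_bound : exists2 B : R, 0 <= B & (L1norm muT w <= B%:E)%E /\ forall x, nm (u x) <= B.
Proof.
have [mw wi] := edec_cintegrable muS dw.
have w0 := L1norm_ge0 muT w.
have fE : (fine (L1norm muT w))%:E = L1norm muT w by rewrite fineK// ge0_fin_numE.
exists (fine (L1norm muT w)); first by rewrite fine_ge0.
split; first by rewrite fE.
move=> x; apply: nm_cint_le; first by apply: cmeasurableM => //; exact: cmeasurable_character.
by rewrite fE /L1norm; under eq_integral do rewrite nmM nm_cexpi mulr1.
Qed.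

Lemma fourier_torus k : fourier (torus R) u k = (2 * pi)%:C * w k%:~R.
Proof.
have [mw wi] := edec_cintegrable muS dw.
have [B B0 [wB uB]] := nm_phys_bound.
have mu : cmeasurable u by exact: cmeasurable_phys.
rewrite /= cintegralE//; last first.
  apply: cmeasurableM => //; apply: cmeasurable_cexpi.
  by apply: measurable_funN; exact: measurable_funM.
pose f (p : R * R) := (\1_D p.1)%:C * (w p.2 * cexpi (p.1 * (p.2 - k%:~R))).
have mf : cmeasurable f.
  apply: cmeasurableM.
    by apply: cmeasurable_real; exact: (measurableT_comp mD).
  apply: cmeasurableM; first exact: (cmeasurable_comp mw).
  by apply: cmeasurable_cexpi; apply: measurable_funM => //; exact: measurable_funB.
transitivity (cint muL (fun x => cint muT (fun y => f (x, y)))).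
  apply: eq_cint => x; rewrite mulrC -mulrA mulrC -cintZ; last exact: phys_cintegrable.
  apply: eq_cint => y; rewrite /f /= mulrBr cexpiD -/D.
  by move: (cexpi (- (x * _))) (cexpi (x * y)) (w y) ((\1_D x)%:C) => a b c d; ring.
have nf x y : nm (f (x, y)) = (\1_D x : R) * nm (w y).
  by rewrite /f !nmM nm_cexpi mulr1 nm_real ger0_norm// indicE.
have iD : (\int[muL]_x (\1_D x : R)%:E = (2 * pi)%:E)%E.
  rewrite integral_lebR; last by apply/measurable_EFinP; exact: mD.
  rewrite integral_indic// setIT /= lebesgue_measure_itv /= lte_fin mulr_gt0 ?pi_gt0//.
  by rewrite -EFinB subr0.
have D0 x : 0 <= (\1_D x : R) by rewrite indicE.
rewrite cint_swap//; last first.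
  under eq_integral do under eq_integral do rewrite nf.
  under eq_integral => x _.
    rewrite integralZ_EFin//; last 2 first.
    - exact: measurable_nm.
    - by move=> y; exact: nm_ge0.
    over.
  apply: (@le_lt_trans _ _ (\int[muL]_x (B * (\1_D x : R))%:E)%E).
    apply: ge0_le_integral => //.
    - move=> x _; rewrite mule_ge0 ?lee_fin//; exact: L1norm_ge0.
    - apply: emeasurable_funM; last exact: measurable_cst.
      by apply/measurable_EFinP; exact: mD.
    - by apply/measurable_EFinP; exact: measurable_funM.
    by move=> x _; rewrite mulrC EFinM lee_wpmul2l ?lee_fin.
  by rewrite (integralZ_EFin _ B0 mD D0) iD -EFinM ltry.
transitivity (cint muT (fun y => ((2 * pi)%:C * w k%:~R) * (\1_[set (k%:~R : R)] y : R)%:C)).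
  apply: cint_ae.
  - apply: (cmeasurable_cint2 muL (f := fun p => f (p.2, p.1))).
    exact: (cmeasurable_comp mf (@measurable_swap _ _ _ _)).
  - apply: cmeasurableM; first exact: cmeasurable_cst.
    by apply: cmeasurable_real; exact: measurable_indic.
  apply: filterS (freq_null muS) => _ [m _ <-]; rewrite /f /=.
  transitivity (w m%:~R * cint muL (fun x => (\1_D x)%:C * cexpi (x * (m - k)%:~R))).
    rewrite -cintZ; last first.
      apply: (@cintegrable_le _ _ _ _ _ (\1_D : R -> R)) => //.
      - apply: cmeasurableM; first exact: cmeasurable_real.
        by apply: cmeasurable_cexpi; exact: measurable_funM.
      - by move=> x; rewrite nmM nm_cexpi mulr1 nm_real ger0_norm.
      - by rewrite iD ltry.
    by apply: eq_cint => x; rewrite mulrCA intrB.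
  rewrite character_orthogonality subr_eq0 indicE.
  rewrite (_ : (_ \in _) = (m == k)); last first.
    by apply/idP/eqP => [|->]; rewrite inE /= /int_val// => /intr_inj.
  by case: eqP => [->|_]; rewrite ?mulr1 ?mulr0// mulrC.
have m1 : measurable_fun setT (\1_[set (k%:~R : R)] : R -> R) by exact: measurable_indic.
have i1 : (\int[muT]_y (\1_[set (k%:~R : R)] y : R)%:E = 1)%E.
  rewrite integral_indic// setIT /= /pushforward_cnt /pushforward.
  rewrite (_ : _ @^-1` _ = [set k]) ?counting1//.
  by apply/seteqP; split=> m /=; rewrite /int_val; [move/intr_inj|move=> ->].
rewrite cintZ.
  by rewrite /cint /= /Rintegral integral0 i1 /= mulr1.
apply: (@cintegrable_le _ _ _ _ _ (\1_[set (k%:~R : R)] : R -> R)) => //.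
- by move=> y; rewrite nm_real ger0_norm// indicE.
- by rewrite i1 ltry.
Qed.

End TorusFourier.

Lemma torus_admissible (R : realType) : admissible (torus R) (@cntR R) integers.
Proof.
have sub (A B : set R) : measurable A -> measurable B ->
   (forall k : int, A k%:~R -> B k%:~R) -> (@cntR R A <= @cntR R B)%E.
  move=> mA mB AB; rewrite /= /pushforward_cnt /pushforward; apply: le_measure; rewrite ?inE//.
split.
- exact: counting_frequency.
- exact: measurable_int_fun.
- by move=> f mf f0; rewrite integral_cntR.
- move=> w dw cw; have [B B0 [wB uB]] := nm_phys_bound dw.
  split.
  + exact: phys_periodic.
  + have mu := cmeasurable_phys (@cntR R) dw.1.
    pose D : set R := `[0, 2 * pi[%classic.
    have measD : measurable D by exact: measurable_itv.
    have mD : measurable_fun setT (\1_D : R -> R).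
      by apply: measurable_indic; exact: measurable_itv.
    rewrite (_ : _ \_ _ = (fun x : R => (\1_D x * nm (phys (@cntR R) w x))%:E)); last first.
      by apply/funext => x; rewrite /= /patch indicE -/D; case: (x \in D); rewrite ?mul1r ?mul0r.
    rewrite LnormE//; last by move=> x; rewrite mulr_ge0 ?nm_ge0.
    apply: poweR_lty.
    apply: (@le_lt_trans _ _ (\int[@lebesgue_measure R]_x (B ^+ 2 * (\1_D x : R))%:E)%E).
      apply: ge0_le_integral => //.
      - by move=> x _; rewrite lee_fin powR_ge0.
      - apply/measurable_EFinP; apply: (measurableT_comp (measurable_powR 2)).
        by apply: measurable_funM => //; exact: measurable_nm.
      - by apply/measurable_EFinP; exact: measurable_funM.
      move=> x _; rewrite lee_fin powR_mulrn ?mulr_ge0 ?nm_ge0// exprMn mulrC.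
      rewrite indicE; case: (x \in D); rewrite /= ?expr1n ?mulr1 ?expr0n ?mulr0//.
      by rewrite ler_pXn2r// nnegrE ?nm_ge0.
    rewrite integralZ_EFin ?sqr_ge0//.
    rewrite integral_indic// setIT /= lebesgue_measure_itv /= lte_fin mulr_gt0 ?pi_gt0//.
    by rewrite -EFinB subr0 -EFinM ltry.
  + by split; exact: measurable_int_fun.
  + by apply: aeW => k; exact: fourier_torus.
- move=> n r r0; pose m := Num.trunc r.
  have /andP[m1 m2] := truncn_itv r0.
  apply: (@le_trans _ _ (@cntR R `]n%:R - 1, n%:R - 1 + m.+1%:R]%classic)).
    by rewrite /= cnt_units lee_fin ltW.
  rewrite (_ : [set x : R | (n%:R <= x <= n%:R + r)%R] = `[n%:R, n%:R + r]%classic); last first.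
    by apply/seteqP; split=> x /=; rewrite in_itv.
  apply: sub => // k /=; rewrite !in_itv /= => /andP[k1 k2].
  have {}k1 : n%:R <= k%:~R :> R.
    have : ((n%:Z - 1)%:~R < k%:~R :> R) by rewrite intrB.
    by rewrite ltr_int ltrBlDr -[n%:R]/(n%:~R) ler_int -ltzD1.
  by rewrite k1; move: k2; rewrite -[m.+1%:R]natr1; lra.
- move=> n r r0; pose m := Num.trunc r.
  have /andP[m1 m2] := truncn_itv r0.
  apply: (@le_trans _ _ (@cntR R `]n%:R - m%:R - 1, n%:R - m%:R - 1 + (2 * m + 1)%:R]%classic)).
    rewrite (_ : [set x : R | (n%:R - r <= x <= n%:R + r)%R] = `[n%:R - r, n%:R + r]%classic); last first.
      by apply/seteqP; split=> x /=; rewrite in_itv.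
    apply: sub => // k /=; rewrite !in_itv /= => /andP[k1 k2].
    rewrite -[m.+1%:R]natr1 in m2.
    apply/andP; split; first by lra.
    have : (k%:~R < (n%:Z + m%:Z + 1)%:~R :> R) by rewrite !intrD; lra.
    rewrite ltr_int ltzD1 -(ler_int R) intrD => h; apply: le_trans h _.
    by rewrite -!pmulrn natrD natrM; lra.
  have h := cnt_units (n%:R - m%:R - 1 : R) (2 * m + 1).
  apply: (@le_trans _ _ (2 * m + 1)%:R%:E); first by rewrite -h.
  by rewrite lee_fin natrD natrM lerD2r ler_wpM2l.
Qed.

(** * The first Picard iterate transfers mass to low frequencies *)

Section Tent.
Context {R : realType}.
Implicit Types x : R.

Definition tent x : R := Num.max 0 (1 - `|x|).

Lemma tent_ge0 x : 0 <= tent x. Proof. by rewrite le_max lexx. Qed.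

Lemma tent_le1 x : tent x <= 1.
Proof. by rewrite ge_max ler01 gerBl normr_ge0. Qed.

Lemma tent_ge x : 1 - `|x| <= tent x. Proof. by rewrite le_max lexx orbT. Qed.

Lemma tent_eq0 x : 1 <= `|x| -> tent x = 0.
Proof. by move=> h; apply: max_l; rewrite subr_le0. Qed.

Lemma continuous_tent : continuous tent.
Proof.
move=> x; apply: (@continuous_max _ _ (fun=> 0) (fun x => 1 - `|x|)); first exact: cvg_cst.
by apply: cvgB; [exact: cvg_cst|exact: norm_continuous].
Qed.

Lemma seqc_real (h : R -> R) : continuous h -> seqc (fun x => (h x)%:C).
Proof.
move=> ch x_ x xx; apply/ccvgP => /=; split; last exact: cvg_cst.
exact: (cvg_comp _ _ xx (ch x)).
Qed.

Lemma expR_le_inv x : x < 1 -> expR x <= (1 - x)^-1.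
Proof.
move=> x1; rewrite -[expR x]invrK -expRN lef_pV2 ?posrE ?expR_gt0 ?subr_gt0//.
exact: expR_ge1Dx.
Qed.

End Tent.

Lemma Re_cint_ge (R : realType) d (T : measurableType d)
    (mu : {measure set T -> \bar R}) (f : T -> R[i]) (g : T -> R) :
  cintegrable mu f -> measurable_fun setT g -> (forall x, 0 <= g x) ->
  (forall x, g x <= complex.Re (f x)) ->
  (\int[mu]_x (g x)%:E <= (complex.Re (cint mu f))%:E)%E.
Proof.
move=> fi mg g0 gf; have [i1 _] := cintegrable_ReIm fi.
have -> : (complex.Re (cint mu f))%:E = (\int[mu]_x (complex.Re (f x))%:E)%E.
  by rewrite /cint /= /Rintegral fineK//; exact: integrable_fin_num i1.
apply: ge0_le_integral => //.
- by move=> x _; rewrite lee_fin.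
- exact/measurable_EFinP.
- by apply/measurable_EFinP; exact: fi.1.1.
- by move=> x _; rewrite lee_fin.
Qed.

Section Data.
Context {R : realType}.
Variables (Z : domain R) (mu : {sigma_finite_measure set R -> \bar R}) (S : set R).
Hypothesis adm : admissible Z mu S.
Let muS := adm_freq adm.
Variables (n : nat) (rho r : R).
Hypotheses (rho1 : 1 <= rho) (rhoN : 4 * rho <= n%:R) (r0 : 0 < r).
Notation N := (n%:R : R).

Let rho0 : 0 < rho. Proof. exact: lt_le_trans rho1. Qed.
Let N0 : 0 < N. Proof. by move: rho0 rhoN; lra. Qed.

Definition bump (c x : R) : R := tent ((x - c) / rho).
Definition height (x : R) : R := r * (bump N x + bump (2 * N) x).

(** Two bumps, of width [rho], around the frequencies N and 2N: the resonance
    0 = N - 2N + N feeds the frequencies near 0. *)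
Definition data (x : R) : R[i] := (height x)%:C.

Lemma bump_supp c x : rho <= `|x - c| -> bump c x = 0.
Proof.
move=> h; apply: tent_eq0; rewrite normrM normfV (gtr0_norm rho0).
by rewrite ler_pdivlMr// mul1r.
Qed.

Lemma bump_ge c x y : `|x - c| <= y * rho -> 1 - y <= bump c x.
Proof.
move=> h; apply: le_trans (tent_ge _); rewrite lerD2l lerN2 normrM normfV (gtr0_norm rho0).
by rewrite ler_pdivrMr.
Qed.

Let bump01 c x : 0 <= bump c x <= 1. Proof. by rewrite tent_ge0 tent_le1. Qed.

Lemma height_ge0 x : 0 <= height x.
Proof. by rewrite mulr_ge0 ?addr_ge0 ?tent_ge0// ltW. Qed.

Lemma height_le x : height x <= 2 * r.
Proof.
rewrite /height mulrC ler_wpM2r ?(ltW r0)//.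
by have /andP[_ h1] := bump01 N x; have /andP[_ h2] := bump01 (2 * N) x; lra.
Qed.

Lemma height_supp x : height x != 0 -> N - rho <= x <= 2 * N + rho.
Proof.
have [h1|h1] := ltP `|x - N| rho.
  move=> _; move: h1; rewrite ltr_norml => /andP[h1 h2]; move: N0 rho0; lra.
have [h2|h2] := ltP `|x - 2 * N| rho.
  move=> _; move: h2; rewrite ltr_norml => /andP[h2 h3]; move: N0 rho0; lra.
by rewrite /height !bump_supp// addr0 mulr0 eqxx.
Qed.

Lemma continuous_height : continuous height.
Proof.
have cb c : continuous (bump c).
  move=> x; apply: (@continuous_comp _ _ _ (fun x => (x - c) / rho) tent);
    last exact: continuous_tent.
  apply: cvgM; last exact: cvg_cst.
  by apply: cvgB; [exact: cvg_id|exact: cvg_cst].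
by move=> x; apply: cvgM; [exact: cvg_cst|apply: cvgD; exact: cb].
Qed.

Lemma measurable_data_height : measurable_fun setT height.
Proof. by apply: continuous_measurable_fun; exact: continuous_height. Qed.

Lemma seqc_data : seqc data.
Proof. exact: seqc_real continuous_height. Qed.

Let k : R := (5 * N)^-1.
Let k0 : 0 < k. Proof. by rewrite invr_gt0 mulr_gt0. Qed.

Lemma wt_height x : wt k x * height x <= 2 * height x.
Proof.
have [->|/height_supp/andP[h1 h2]] := eqVneq (height x) 0; first by rewrite !mulr0.
rewrite ler_wpM2r ?height_ge0// /wt.
have xN : `|x| <= 9 / 4 * N by rewrite ger0_norm; move: rho0 N0 rhoN; lra.
have kx : k * `|x| <= 9 / 20.
  by rewrite /k mulrC ler_pdivrMr ?mulr_gt0//; move: xN; lra.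
apply: (@le_trans _ _ (expR (9 / 20))); first by rewrite ler_expR.
apply: le_trans (expR_le_inv _) _; first by lra.
by rewrite invf_ple ?posrE; lra.
Qed.

Lemma integral_height : (\int[mu]_x (height x)%:E <= (6 * r * rho)%:E)%E.
Proof.
pose I (m : nat) : set R := [set x | (m%:R - rho <= x <= m%:R + rho)%R].
have mI m : measurable (I m).
  by rewrite (_ : I m = `[m%:R - rho, m%:R + rho]%classic)//.
have m1 m : measurable_fun setT (\1_(I m) : R -> R) by exact: measurable_indic.
have i1 m : (\int[mu]_x (\1_(I m) x : R)%:E <= (3 * rho)%:E)%E.
  rewrite integral_indic// setIT; apply: le_trans (adm_upper adm m (ltW rho0)) _.
  by rewrite lee_fin; move: rho1; lra.
apply: (@le_trans _ _ (\int[mu]_x (r * (\1_(I n) x + \1_(I (2 * n)) x))%:E)%E).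
  apply: ge0_le_integral => //.
  - by move=> x _; rewrite lee_fin height_ge0.
  - by apply/measurable_EFinP; exact: measurable_data_height.
  - by apply/measurable_EFinP; apply: measurable_funM => //; exact: measurable_funD.
  move=> x _; rewrite lee_fin /height ler_wpM2l ?(ltW r0)//.
  have h m : bump m%:R x <= \1_(I m) x.
    have [hx|hx] := ltP `|x - m%:R| rho; last by rewrite bump_supp// indicE.
    rewrite indicE mem_set ?tent_le1//.
    by move: hx; rewrite /I /= ltr_norml => /andP[h1 h2]; lra.
  by rewrite lerD// -natrM h.
rewrite integralZ_EFin ?(ltW r0)//; last exact: measurable_funD.
under eq_integral do rewrite EFinD.
rewrite ge0_integralD//; last 2 first.
- exact/measurable_EFinP.
- exact/measurable_EFinP.
apply: (@le_trans _ _ (r%:E * ((3 * rho)%:E + (3 * rho)%:E))%E).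
  by apply: lee_wpmul2l; [rewrite lee_fin ltW|exact: leeD].
by rewrite -EFinD -EFinM lee_fin; lra.
Qed.

Lemma cmeasurable_data : cmeasurable data.
Proof. exact: cmeasurable_real measurable_data_height. Qed.

Lemma nrm_data : nrm mu k (4 * r) (12 * r * rho) data.
Proof.
have nd x : nm (data x) = height x by rewrite nm_real ger0_norm// height_ge0.
split; first exact: cmeasurable_data.
  by move=> x; rewrite nd; apply: le_trans (wt_height x) _; have := height_le x; lra.
apply: (@le_trans _ _ (\int[mu]_x (2 * height x)%:E)%E).
  apply: ge0_le_integral => //.
  - by move=> x _; rewrite lee_fin wnm_ge0.
  - by apply/measurable_EFinP; apply: measurable_wnm; exact: cmeasurable_data.
  - by apply/measurable_EFinP; apply: measurable_funM => //; exact: measurable_data_height.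
  by move=> x _; rewrite lee_fin nd wt_height.
rewrite integralZ_EFin//; first last.
- exact: height_ge0.
- exact: measurable_data_height.
apply: (@le_trans _ _ (2%:E * (6 * r * rho)%:E)%E).
  by apply: lee_wpmul2l => //; exact: integral_height.
by rewrite -EFinM lee_fin; lra.
Qed.



Variables (T : R).
Hypotheses (T0 : 0 < T) (TN : 32 * T * N ^+ 2 <= 1).

Let g s x : R[i] := ph s x * data x.
Let nrm_g s : nrm mu k (4 * r) (12 * r * rho) (g s).
Proof. by apply: nrm_ph; exact: nrm_data. Qed.

(** At the times considered all the phases stay below 1/2, so that the trilinear
    integral has no cancellation. *)
Lemma phase_ge s x a b : 0 <= s <= T -> 0 <= x <= rho / 4 ->
  2^-1 * (height (x - b - a) * height a * height (- b)) <=
  complex.Re (conjC (ph s x) * tilde (g s) b * (g s (x - b - a) * g s a)).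
Proof.
move=> /andP[s0 sT] /andP[x0 x1]; set c := x - b - a.
set P := _ * _ * _; pose th := s * x ^+ 2 + s * (- b) ^+ 2 - s * c ^+ 2 - s * a ^+ 2.
have -> : conjC (ph s x) * tilde (g s) b * (g s c * g s a) = cexpi th * P%:C.
  rewrite /tilde /g /ph !conjM !conj_cexpi !opprK conjc_real /th !cexpiD /data /P.
  rewrite !rmorphM /=; move: (cexpi (s * x ^+ 2)) (cexpi (s * _)) (cexpi (- _)) (cexpi (- _)).
  by move=> e1 e2 e3 e4; ring.
rewrite cReM /= mulr0 subr0.
have [->|P0] := eqVneq P 0; first by rewrite !mulr0.
have := P0; rewrite /P mulf_eq0 negb_or mulf_eq0 negb_or => /andP[/andP[hc ha] hb].
have P_ge : 0 <= P by apply: mulr_ge0; [apply: mulr_ge0|]; exact: height_ge0.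
rewrite ler_wpM2r//.
have sq y : `|y| <= 9 / 4 * N -> 0 <= s * y ^+ 2 <= 1 / 6.
  move=> hy; rewrite mulr_ge0 ?sqr_ge0//=.
  apply: (@le_trans _ _ (T * (9 / 4 * N) ^+ 2)); last by move: TN; rewrite exprMn; lra.
  apply: ler_pM => //; first exact: sqr_ge0.
  by rewrite -real_normK ?num_real// ler_pXn2r// nnegrE mulr_ge0// ltW.
have su y : height y != 0 -> `|y| <= 9 / 4 * N.
  by move=> /height_supp/andP[h1 h2]; rewrite ger0_norm; move: rho0 N0 rhoN; lra.
have /andP[x2 x3] : 0 <= s * x ^+ 2 <= 1 / 6.
  by apply: sq; rewrite ger0_norm//; move: rho0 N0 rhoN; lra.
have /andP[a2 a3] := sq a (su a ha).
have /andP[b2 b3] := sq (- b) (su _ hb).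
have /andP[c2 c3] := sq c (su c hc).
have th1 : `|th| <= 2^-1 by rewrite ler_norml /th; apply/andP; split; lra.
have := cos_sub_le th; rewrite ler_norml => /andP[h _].
have : th ^+ 2 <= (2^-1) ^+ 2.
  by rewrite -real_normK ?num_real// ler_pXn2r// nnegrE.
by move: h; lra.
Qed.

Let I : set R := [set x | (N <= x <= N + rho / 4)%R].
Let J : set R := [set x | ((2 * n)%:R <= x <= (2 * n)%:R + rho / 4)%R].
Let mI : measurable I.
Proof. by rewrite (_ : I = `[N, N + rho / 4]%classic)//. Qed.
Let mJ : measurable J.
Proof. by rewrite (_ : J = `[(2 * n)%:R, (2 * n)%:R + rho / 4]%classic)//. Qed.
Let m1I : measurable_fun setT (\1_I : R -> R). Proof. exact: measurable_indic. Qed.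
Let m1J : measurable_fun setT (\1_J : R -> R). Proof. exact: measurable_indic. Qed.
Let rho4 : 0 <= rho / 4. Proof. by rewrite divr_ge0 ?(ltW rho0). Qed.

Let height_prod x a b : 0 <= x <= rho / 4 ->
  r ^+ 3 / 4 * ((\1_J (- b) : R) * (\1_I a : R)) <= height (x - b - a) * height a * height (- b).
Proof.
move=> /andP[x0 x1]; have P_ge : 0 <= height (x - b - a) * height a * height (- b).
  by apply: mulr_ge0; [apply: mulr_ge0|]; exact: height_ge0.
have [/= bJ|bJ] := pselect (J (- b)); last first.
  by rewrite [\1_J _]indicE memNset// mul0r mulr0.
have [/= aI|aI] := pselect (I a); last first.
  by rewrite [\1_I _]indicE memNset// !mulr0.
rewrite !indicE !mem_set// !mulr1.
move: aI bJ; rewrite /I /J /= natrM => /andP[a1 a2] /andP[b1 b2].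
have hN y c : 0 <= c -> `|y - N| <= c * rho -> (1 - c) * r <= height y.
  move=> c0 /bump_ge h; rewrite mulrC /height ler_wpM2l ?(ltW r0)//.
  by apply: le_trans h _; rewrite lerDl tent_ge0.
have h2N y c : 0 <= c -> `|y - 2 * N| <= c * rho -> (1 - c) * r <= height y.
  move=> c0 /bump_ge h; rewrite mulrC /height ler_wpM2l ?(ltW r0)//.
  by apply: le_trans h _; rewrite lerDr tent_ge0.
have h1 : (1 - 1 / 2) * r <= height (x - b - a).
  by apply: hN => //; rewrite ler_norml; apply/andP; split; lra.
have h2 : (1 - 1 / 4) * r <= height a.
  by apply: hN => //; rewrite ler_norml; apply/andP; split; lra.
have h3 : (1 - 1 / 4) * r <= height (- b).
  by apply: h2N => //; rewrite ler_norml; apply/andP; split; lra.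
have r' := ltW r0.
apply: (@le_trans _ _ ((1 - 1 / 2) * r * ((1 - 1 / 4) * r) * ((1 - 1 / 4) * r))).
  have r3 : 0 <= r ^+ 3 by rewrite exprn_ge0.
  rewrite (_ : (1 - 1 / 2) * r * ((1 - 1 / 4) * r) * ((1 - 1 / 4) * r) = 9 / 32 * r ^+ 3); last by field.
  by rewrite mulrC ler_wpM2r//; lra.
have c1 : 0 <= (1 - 1 / 2) * r by rewrite mulr_ge0//; lra.
have c2 : 0 <= (1 - 1 / 4) * r by rewrite mulr_ge0//; lra.
apply: ler_pM => //; first by rewrite (mulr_ge0 c1 c2).
exact: ler_pM.
Qed.

Lemma tri_data_ge s x : 0 <= s <= T -> 0 <= x <= rho / 4 ->
  r ^+ 3 * rho ^+ 2 / 128 <= complex.Re (conjC (ph s x) * tri mu (g s) x).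
Proof.
move=> sT x01; have k00 := ltW k0; have r' := ltW r0.
have r3 : 0 <= r ^+ 3 by rewrite exprn_ge0.
have ng := nrm_g s; have nt := nrm_tilde muS ng; have ngg := nrm_conv muS k00 ng ng.
have [mg _ _] := ng; have [mt _ _] := nt.
rewrite /tri /convol -cintZ; last exact: conv_integrable k00 ngg nt.
rewrite -lee_fin.
have fi : cintegrable mu (fun b => conjC (ph s x) *
    (cint mu (fun a => g s (x - b - a) * g s a) * tilde (g s) b)).
  by apply: cintegrableZ; exact: (conv_integrable x k00 ngg nt).
pose G (b : R) : R := r ^+ 3 * rho / 32 * \1_J (- b).
have G0 b : 0 <= G b by rewrite mulr_ge0 ?divr_ge0 ?mulr_ge0 ?(ltW rho0)// indicE.
have m1J' : measurable_fun setT (fun b : R => \1_J (- b) : R).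
  by apply: (measurableT_comp m1J); exact: oppr_measurable.
have mG : measurable_fun setT G by exact: measurable_funM.
apply: le_trans (Re_cint_ge fi mG G0 _).
  rewrite /G integralZ_EFin//; last by rewrite divr_ge0 ?mulr_ge0 ?(ltW rho0).
  have -> : (\int[mu]_b (\1_J (- b) : R)%:E = mu J)%E.
    rewrite (freq_refl muS (f := fun b => (\1_J b : R)%:E))//; last exact/measurable_EFinP.
    by rewrite integral_indic// setIT.
  apply: (@le_trans _ _ ((r ^+ 3 * rho / 32)%:E * (rho / 4)%:E)%E).
    by rewrite -EFinM lee_fin; lra.
  apply: lee_wpmul2l; first by rewrite lee_fin divr_ge0 ?mulr_ge0 ?(ltW rho0).
  exact: (adm_lower adm (2 * n) rho4).
move=> b.
have ci := conv_integrable (x - b) k00 ng ng.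
rewrite mulrA mulrAC -cintZ//.
pose H (a : R) : R := r ^+ 3 / 8 * \1_J (- b) * \1_I a.
have c0 : 0 <= r ^+ 3 / 8 * \1_J (- b) :> R by rewrite mulr_ge0 ?divr_ge0// indicE.
have H0 a : 0 <= H a by rewrite mulr_ge0// indicE.
have mH : measurable_fun setT H by exact: measurable_funM.
rewrite -lee_fin; apply: le_trans (Re_cint_ge _ mH H0 _).
- rewrite /H integralZ_EFin// integral_indic// setIT.
  apply: (@le_trans _ _ ((r ^+ 3 / 8 * \1_J (- b))%:E * (rho / 4)%:E)%E).
    by rewrite -EFinM lee_fin /G; lra.
  by apply: lee_wpmul2l; [rewrite lee_fin|exact: (adm_lower adm n rho4)].
- exact: cintegrableZ.
- move=> a; apply: le_trans (phase_ge a b sT x01).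
  by apply: le_trans (ler_wpM2l _ (height_prod a b x01)) => //; rewrite /H; lra.
Qed.

Variable eps : R[i].
Hypothesis eps1 : nm eps = 1.

Let leT : 0 <= T. Proof. exact: ltW T0. Qed.
Let eps1' : nm eps <= 1. Proof. by rewrite eps1. Qed.

Lemma height0 x : 0 <= x <= rho / 4 -> height x = 0.
Proof.
move=> /andP[x0 x1]; apply/eqP; apply: contraT => /height_supp/andP[h _].
by move: rho0 rhoN h; lra.
Qed.

Lemma picard1_ge x : 0 <= x <= rho / 4 ->
  r * (T * r ^+ 2 * rho ^+ 2) / 128 <= nm (picard mu T eps data 1 T x).
Proof.
move=> x01; rewrite picardS {1}/data height0// add0r.
set h := rhs mu eps _ ^~ x; pose kappa := conjC (- 'i%C * eps).
have mh : cmeasurable h.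
  have md : cmeasurable (fun p : R * R => data p.2).
    by apply: (cmeasurable_comp cmeasurable_data).
  apply: (cmeasurable_comp (cmeasurable_rhs mu eps md) (h := fun s : R => (s, x))).
  exact: measurable_fun_pair.
have nr s := nrm_rhs muS eps1' (v := fun=> data) (s := s) (ltW k0) nrm_data.
have hK s : nm (h s) <= 4 * r * (12 * r * rho) * (12 * r * rho).
  exact: (nrm_sup (ltW k0) (nr s)).
have K0 := nrm_A0 (nr 0).
have nk : nm kappa = 1 by rewrite nm_conj nmM nmN nm_i eps1 mulr1.
have hi := tint_cintegrable leT T mh K0 hK.
have <- : nm (kappa * tint T T h) = nm (tint T T h) by rewrite nmM nk mul1r.
rewrite /tint -cintZ//.
apply: le_trans (le_trans (ler_norm _) (Re_le_nm _)).
pose c := r ^+ 3 * rho ^+ 2 / 128; have c0 : 0 <= c.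
  by rewrite divr_ge0// mulr_ge0 ?exprn_ge0 ?(ltW r0) ?(ltW rho0).
have wE : (\int[@lebesgue_measure R]_s (win T T s)%:E = T%:E)%E.
  rewrite win_indic integral_indic// setIT /= lebesgue_measure_itv /= lte_fin minxx T0.
  by rewrite -EFinB subr0.
have w0 s : 0 <= win T T s by case/andP: (win01 T T s).
set X := complex.Re _.
suff : (\int[@lebesgue_measure R]_s (c * win T T s)%:E <= X%:E)%E.
  rewrite integralZ_EFin//; last exact: measurable_win.
  by rewrite wE -EFinM lee_fin /c; apply: le_trans; lra.
apply: Re_cint_ge.
- exact: cintegrableZ.
- by apply: measurable_funM => //; exact: measurable_win.
- by move=> s; rewrite mulr_ge0.
move=> s; rewrite winE minxx; case: (boolP (0 <= s <= T)) => [sT|_]; last first.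
  by rewrite mulr0 mul0r mulr0.
rewrite mulr1 mul1r.
have -> : kappa * h s = conjC (ph s x) * tri mu (g s) x.
  rewrite /h /rhs /kappa; move: (- 'i%C * eps) (esym (nmM (- 'i%C) eps)) => z nz.
  have zz : conjC z * z = 1.
    by rewrite mulrC mul_conj -nz nmN nm_i eps1 mulr1 expr1n.
  transitivity ((conjC z * z) * (conjC (ph s x) * tri mu (g s) x)).
    by rewrite -!mulrA.
  by rewrite zz mul1r.
exact: tri_data_ge.
Qed.

Lemma tint0 (f : R -> R[i]) (K : R) : cmeasurable f -> 0 <= K ->
  (forall s, nm (f s) <= K) -> tint T 0 f = 0.
Proof.
move=> mf K0 fK; have -> : tint T 0 f = tint 0 0 f by rewrite /tint /win !min_l.
by apply: Normc.eq0_normc; apply/eqP; rewrite eq_le nm_ge0 andbT;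
  have := nm_tint (lexx 0) 0 mf K0 fK; rewrite mul0r.
Qed.

(** The first iterate dominates the solution as long as T r^2 rho^2 is small. *)
Lemma inflated_solution : T * r ^+ 2 * rho ^+ 2 <= (10 ^+ 11)^-1 ->
  exists (u : R -> R -> R[i]) (w : R -> R[i]),
  [/\ smooth_solution Z eps T (phys mu data) u, u T = phys mu w, edec w, seqc w &
      forall x, 0 <= x <= rho / 4 ->
        r * (T * r ^+ 2 * rho ^+ 2) / 256 <= nm (w x)].
Proof.
set z := T * r ^+ 2 * rho ^+ 2 => zs.
have z0 : 0 <= z by exact: (mulr_ge0 (mulr_ge0 leT (sqr_ge0 r)) (sqr_ge0 rho)).
have q2 : 12 * T * (12 * r * rho) ^+ 2 = 1728 * z by rewrite /z; ring.
have q1 : 12 * T * (12 * r * rho) ^+ 2 <= 2^-1 by rewrite q2; move: zs; lra.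
have [v [mv va cv veq v1]] :=
  interaction_solution muS leT eps1' k0 nrm_data seqc_data q1.
have v0 : v 0 = data.
  apply/funext => x; rewrite veq.
  have mr : cmeasurable (rhs mu eps v ^~ x).
    apply: (cmeasurable_comp (cmeasurable_rhs mu eps mv) (h := fun s : R => (s, x))).
    exact: measurable_fun_pair.
  have nv s := nrm_of_sup muS k0 (cmeasurable_section s mv) (va s).
  have k2 : 0 <= k / 2 by rewrite divr_ge0 ?(ltW k0).
  have nr s := nrm_rhs muS eps1' k2 (nv s).
  by rewrite (tint0 mr (nrm_A0 (nr 0)) (fun s => nrm_sup k2 (nr s) x)) addr0.
exists (solution mu v), (amplitude v T); split => //.
- exact: (smooth_solution_solution adm leT eps1' k0 mv va cv veq v0).
- exact: (edec_amplitude adm k0 mv va).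
- exact: seqc_amplitude.
move=> x x01; rewrite /amplitude nmM nm_ph mul1r.
have h1 := picard1_ge x01.
have h2 : nm (v T x - picard mu T eps data 1 T x) <= 4 * (4 * r) * (1728 * z) ^+ 2.
  apply: le_trans (nm_le_wt (fun=> v T x - picard mu T eps data 1 T x) x (ltW k0)) _.
  by rewrite -q2; exact: v1.
have h3 : nm (picard mu T eps data 1 T x) <=
    nm (v T x - picard mu T eps data 1 T x) + nm (v T x).
  by have := nmB (v T x) (v T x - picard mu T eps data 1 T x); rewrite subKr addrC.
have h4 : 4 * (4 * r) * (1728 * z) ^+ 2 <= r * z / 256.
  rewrite (_ : 4 * (4 * r) * (1728 * z) ^+ 2 = r * z * (16 * 1728 ^+ 2 * z)); last by ring.
  rewrite ler_wpM2l ?(mulr_ge0 (ltW r0) z0)//.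
  by move: zs; lra.
by move: h1 h2 h3 h4; rewrite -/z; lra.
Qed.

End Data.

(** * Sequence norms *)

Section SequenceNorms.
Context {R : realType}.
Notation cnt := (@counting nat R).
Implicit Types (q : \bar R) (b : nat -> \bar R) (K M : R) (a m : nat).

Lemma measurable_nat_fun d (T : measurableType d) (f : nat -> T) : measurable_fun setT f.
Proof. by move=> _ A _; exact: I. Qed.

Definition block a m : set nat := [set j | (a <= j < a + m)%N].

Lemma counting_block a m : cnt (block a m) = m%:R%:E.
Proof.
elim: m => [|m IH].
  rewrite (_ : block a 0 = set0) ?measure0//.
  by apply/seteqP; split => // j; rewrite /block /= addn0 => /andP[h1 h2]; move: (leq_ltn_trans h1 h2); rewrite ltnn.
rewrite (_ : block a m.+1 = block a m `|` [set (a + m)%N]).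
  rewrite measureU//.
  - rewrite -natr1 EFinD -IH; congr (_ + _)%E.
    by rewrite /= /counting asboolT// fset_set1 finmap.cardfs1.
  - by apply/seteqP; split => // j [/= /andP[_ h] jE]; move: h; rewrite jE ltnn.
apply/seteqP; split => j; rewrite /block /= addnS ltnS.
  by rewrite [(j <= _)%N]leq_eqVlt => /andP[-> /orP[/eqP->|->]]; [right|left].
by case=> [/andP[-> /ltnW]|->]//; rewrite leq_addr leqnn.
Qed.

Lemma ae_counting (P : nat -> Prop) : {ae cnt, forall j, P j} -> forall j, P j.
Proof.
move=> [A [mA A0 PA]] j; apply: contrapT => nP.
have : (cnt [set j] <= cnt A)%E.
  by apply: le_measure; rewrite ?inE// => _ ->; exact: PA.
rewrite A0 /counting asboolT// fset_set1 finmap.cardfs1 lee_fin.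
by rewrite ler10.
Qed.

Lemma counting_gt0 : (0 < cnt [set: nat])%E.
Proof.
apply: (@lt_le_trans _ _ (cnt (block 0 1))); first by rewrite counting_block.
by apply: le_measure; rewrite ?inE.
Qed.

Lemma lq_ge q b a m K : (1 <= q)%E -> 0 <= K -> (0 < m)%N ->
  (forall j, (0 <= b j)%E) -> (forall j, block a m j -> (K%:E <= b j)%E) ->
  ((K * m%:R `^ (2 * inv_double q))%:E <= 'N[cnt]_q [b])%E.
Proof.
case: q => [r| |//] q1 K0 m0 b0 bK; rewrite unlock /=.
  have r0 : 0 < r by apply: lt_le_trans ltr01 _.
  have -> : 2 * (2 * r)^-1 = r^-1 by rewrite invfM mulrA divff// mul1r.
  have m1 : measurable_fun setT (\1_(block a m) : nat -> R) by exact: measurable_nat_fun.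
  have -> : (K * m%:R `^ r^-1)%:E = ((K `^ r * m%:R)%:E `^ r^-1)%E.
    by rewrite poweR_EFin powRM ?powR_ge0// -powRrM divff ?powRr1// gt_eqF.
  apply: gt0_ler_poweR; rewrite ?invr_ge0 ?(ltW r0)//.
  - by rewrite in_itv /= leey andbT lee_fin mulr_ge0 ?powR_ge0.
  - by rewrite in_itv /= leey andbT integral_ge0// => j _; exact: poweR_ge0.
  apply: (@le_trans _ _ (\int[cnt]_j (K `^ r * (\1_(block a m) j : R))%:E)%E).
    rewrite integralZ_EFin ?powR_ge0//.
    by rewrite integral_indic// setIT [X in (_ <= _ * X)%E](counting_block a m).
  apply: ge0_le_integral => //.
  - by move=> j _; rewrite lee_fin mulr_ge0 ?powR_ge0.
  move=> j _; have [/[dup] jA /bK h|jA] := pselect (block a m j); last first.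
    by rewrite indicE memNset// mulr0 poweR_ge0.
  rewrite indicE mem_set// mulr1 -poweR_EFin gee0_abs//.
  by apply: gt0_ler_poweR; rewrite ?(ltW r0)// in_itv /= leey ?lee_fin ?K0 ?b0.
rewrite counting_gt0 mulr0 powRr0 mulr1.
have := ae_counting (ess_sup_inf.ess_sup_ge cnt (abse \o b)) a; apply: le_trans.
by rewrite /= gee0_abs//; apply: bK; rewrite /block /= leqnn -{1}(addn0 a) ltn_add2l.
Qed.

Lemma lq_le q b a m M : (1 <= q)%E -> 0 <= M -> (0 < m)%N ->
  (forall j, (0 <= b j)%E) -> (forall j, block a m j -> (b j <= M%:E)%E) ->
  (forall j, ~ block a m j -> b j = 0%E) ->
  ('N[cnt]_q [b] <= (M * m%:R)%:E)%E.
Proof.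
case: q => [r| |//] q1 M0 m0 b0 bM bN; rewrite unlock /=.
  have r1 : 1 <= r by [].
  have r0 : 0 < r by apply: lt_le_trans ltr01 _.
  have m1 : 1 <= (m%:R : R) by rewrite ler1n.
  have m2 : measurable_fun setT (\1_(block a m) : nat -> R) by exact: measurable_nat_fun.
  apply: (@le_trans _ _ ((M `^ r * m%:R)%:E `^ r^-1)%E); last first.
    rewrite poweR_EFin lee_fin powRM ?powR_ge0// -powRrM divff ?gt_eqF// powRr1// ler_wpM2l//.
    by rewrite -[leRHS]powRr1// ler_powR// invf_le1.
  apply: gt0_ler_poweR; rewrite ?invr_ge0 ?(ltW r0)//.
  - by rewrite in_itv /= leey andbT integral_ge0// => j _; exact: poweR_ge0.
  - by rewrite in_itv /= leey andbT lee_fin mulr_ge0 ?powR_ge0.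
  apply: (@le_trans _ _ (\int[cnt]_j (M `^ r * (\1_(block a m) j : R))%:E)%E); last first.
    rewrite integralZ_EFin ?powR_ge0//.
    by rewrite integral_indic// setIT [X in (_ * X <= _)%E](counting_block a m).
  apply: ge0_le_integral => //.
  - by move=> j _; exact: poweR_ge0.
  move=> j _; have [/[dup] jA /bM h|/[dup] jA /bN ->] := pselect (block a m j).
    rewrite indicE mem_set// mulr1 -poweR_EFin gee0_abs//.
    by apply: gt0_ler_poweR; rewrite ?(ltW r0)// in_itv /= leey ?lee_fin ?M0 ?b0.
  by rewrite indicE memNset// mulr0 abse0 poweR0r// gt_eqF.
rewrite counting_gt0; apply/ess_sup_inf.ess_supP; apply: aeW => j /=; rewrite gee0_abs//.
have [/bM h|/bN ->] := pselect (block a m j); last by rewrite lee_fin mulr_ge0.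
by apply: le_trans h _; rewrite lee_fin ler_peMr// ler1n.
Qed.

End SequenceNorms.

(** * Norms of the data and of the output *)

Section Shells.
Context {R : realType}.
Variables (Z : domain R) (mu : {sigma_finite_measure set R -> \bar R}) (S : set R).
Hypothesis adm : admissible Z mu S.
Implicit Types (w : R -> R[i]) (p r rho : R) (j : nat).

Definition frequency_shell j : set R := [set x | 2 ^+ j <= jap x < 2 * 2 ^+ j].
Local Notation chi j := (\1_(frequency_shell j) : R -> R).

Let chi01 j x : 0 <= chi j x <= 1.
Proof. by rewrite indicE; case: (x \in _); rewrite /= ?lexx ?ler01. Qed.

Let measurable_chi j : measurable_fun setT (chi j).
Proof.
apply: measurable_indic.
rewrite (_ : frequency_shell j = (@jap R) @^-1` `[2 ^+ j, 2 * 2 ^+ j[%classic).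
  by rewrite -[X in measurable X]setTI; exact: measurable_jap.
by apply/seteqP; split=> x; rewrite /frequency_shell /= in_itv.
Qed.

Lemma shell_LnormE p j w : 0 < p -> edec w -> seqc w ->
  ('N[freq_measure Z]_(p%:E)
     [(fun xi => (nm (fourier Z (phys mu w) xi))%:E) \_ (@shell R Z (2 ^+ j))] =
   'N[mu]_(p%:E) [(fun x => (chi j x * (2 * pi * nm (w x)))%:E)])%E.
Proof.
move=> p0 dw cw; rewrite -(Lnorm_fourier adm p0 (measurable_chi j) _ dw cw); last first.
  by move=> x; case/andP: (chi01 j x).
apply: eq_Lnorm => xi; rewrite /patch indicE.
have -> : (freq_val Z xi \in frequency_shell j) = (xi \in @shell R Z (2 ^+ j)).
  by apply/idP/idP; rewrite !inE.
by case: (xi \in _); rewrite ?mul1r ?mul0r.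
Qed.

Lemma shell_Lnorm_ge p j w n l L : 0 < p -> edec w -> seqc w -> 0 <= l -> 0 <= L ->
  (forall x, n%:R <= x <= n%:R + l -> L <= nm (w x)) ->
  (forall x, n%:R <= x <= n%:R + l -> frequency_shell j x) ->
  ((L * l `^ p^-1)%:E <= 'N[freq_measure Z]_(p%:E)
     [(fun xi => (nm (fourier Z (phys mu w) xi))%:E) \_ (@shell R Z (2 ^+ j))])%E.
Proof.
move=> p0 dw cw l0 L0 hL hj; rewrite shell_LnormE// LnormE//; last first.
  by move=> x; rewrite !mulr_ge0 ?pi_ge0 ?nm_ge0.
have -> : (L * l `^ p^-1)%:E = ((L `^ p * l)%:E `^ p^-1)%E.
  by rewrite poweR_EFin powRM ?powR_ge0// -powRrM divff ?powRr1// gt_eqF.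
pose A : set R := [set x | (n%:R <= x <= n%:R + l)%R].
have mA : measurable A by rewrite (_ : A = `[n%:R, n%:R + l]%classic).
have m1 : measurable_fun setT (\1_A : R -> R) by exact: measurable_indic.
have mw : measurable_fun setT (fun x => chi j x * (2 * pi * nm (w x))).
  by apply: measurable_funM => //; apply: measurable_funM => //; exact: measurable_nm dw.1.
apply: gt0_ler_poweR; rewrite ?invr_ge0 ?(ltW p0)//.
- by rewrite in_itv /= leey andbT lee_fin mulr_ge0 ?powR_ge0.
- by rewrite in_itv /= leey andbT integral_ge0// => x _; rewrite lee_fin powR_ge0.
apply: (@le_trans _ _ (\int[mu]_x (L `^ p * (\1_A x : R))%:E)%E).
  rewrite integralZ_EFin ?powR_ge0// integral_indic// setIT EFinM.
  by apply: lee_wpmul2l; [rewrite lee_fin powR_ge0|exact: (adm_lower adm n l0)].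
apply: ge0_le_integral => //.
- by move=> x _; rewrite lee_fin mulr_ge0 ?powR_ge0.
- by apply/measurable_EFinP; exact: measurable_funM.
- by apply/measurable_EFinP; exact: (measurableT_comp (measurable_powR p)).
move=> x _; rewrite lee_fin; have [Ax|nAx] := pselect (A x); last first.
  by rewrite [\1_A _]indicE memNset// mulr0 powR_ge0.
rewrite [\1_A _]indicE mem_set// mulr1 indicE mem_set ?mul1r; last exact: hj.
rewrite ge0_ler_powR ?nnegrE ?(ltW p0)//; first by rewrite !mulr_ge0 ?pi_ge0 ?nm_ge0.
apply: le_trans (hL x Ax) _; rewrite ler_peMl ?nm_ge0//.
by have := pi_ge2 R; lra.
Qed.

Variables (J : nat) (rho r p : R).
Hypotheses (J0 : (0 < J)%N) (rho1 : 1 <= rho) (rhoN : 4 * rho <= (2 ^ J)%:R) (r0 : 0 < r).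
Hypothesis p1 : 1 <= p.
Notation phi := (data (2 ^ J) rho r).

Let p0 : 0 < p. Proof. exact: lt_le_trans ltr01 p1. Qed.
Let rho0 : 0 < rho. Proof. exact: lt_le_trans rho1. Qed.
Let edec_data : edec phi.
Proof.
apply: nrm_edec (nrm_data adm rho1 rhoN r0).
by rewrite invr_gt0 mulr_gt0// (lt_le_trans _ rhoN)// mulr_gt0.
Qed.
Let seqc_phi : seqc phi. Proof. exact: seqc_data. Qed.
Let nm_data x : nm (phi x) = height (2 ^ J) rho r x.
Proof. by rewrite nm_real ger0_norm// height_ge0. Qed.

Lemma shell_data_le j : ('N[freq_measure Z]_(p%:E)
     [(fun xi => (nm (fourier Z (phys mu phi) xi))%:E) \_ (@shell R Z (2 ^+ j))]
   <= (12 * pi * r * rho `^ p^-1)%:E)%E.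
Proof.
have pi0 : 0 <= pi :> R := pi_ge0 R.
rewrite shell_LnormE// LnormE//; last by move=> x; rewrite !mulr_ge0 ?nm_ge0.
have c0 : 0 <= 4 * pi * r by rewrite !mulr_ge0// ltW.
apply: (@le_trans _ _ (((4 * pi * r) `^ p * (3 * rho))%:E `^ p^-1)%E); last first.
  have rr : 0 <= 3 * rho by rewrite mulr_ge0// ltW.
  rewrite poweR_EFin lee_fin powRM ?powR_ge0// -powRrM divff ?gt_eqF// powRr1//.
  rewrite powRM ?(ltW rho0)//.
  have : 3 `^ p^-1 <= 3 :> R.
    by rewrite -[leRHS]powRr1// ler_powR ?invf_le1// ler1n.
  move=> /(ler_wpM2l c0) /(ler_wpM2r (powR_ge0 rho p^-1)); lra.
have mh := measurable_data_height (2 ^ J) rho r.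
apply: gt0_ler_poweR; rewrite ?invr_ge0 ?(ltW p0)//.
- by rewrite in_itv /= leey andbT integral_ge0// => x _; rewrite lee_fin powR_ge0.
- by rewrite in_itv /= leey andbT lee_fin mulr_ge0 ?powR_ge0// mulr_ge0// ltW.
pose c := 2 * pi * (4 * pi * r) `^ (p - 1).
have cc0 : 0 <= c by rewrite !mulr_ge0 ?powR_ge0.
apply: (@le_trans _ _ (\int[mu]_x (c * height (2 ^ J) rho r x)%:E)%E).
  apply: ge0_le_integral => //.
  - by move=> x _; rewrite lee_fin powR_ge0.
  - apply/measurable_EFinP; apply: (measurableT_comp (measurable_powR p)).
    apply: measurable_funM => //; apply: measurable_funM => //.
    exact: measurable_nm edec_data.1.
  - by apply/measurable_EFinP; exact: measurable_funM.
  move=> x _; rewrite lee_fin nm_data.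
  have h0 := height_ge0 (2 ^ J) rho r0 x; have h2 := height_le (2 ^ J) rho r0 x.
  move: (height _ _ _ x) h0 h2 => y y0 y2.
  apply: (@le_trans _ _ ((2 * pi * y) `^ p)).
    rewrite ge0_ler_powR ?nnegrE ?(ltW p0)//.
    - by have /andP[h1 _] := chi01 j x; rewrite !mulr_ge0.
    - by rewrite !mulr_ge0.
    by have /andP[_ h1] := chi01 j x; rewrite ler_piMl// !mulr_ge0.
  have [->|y1] := eqVneq y 0; first by rewrite !mulr0 powR0// gt_eqF.
  have yp : 0 < 2 * pi * y by rewrite !mulr_gt0 ?pi_gt0// lt_neqAle eq_sym y1.
  have sp z : 0 < z -> z `^ p = z * z `^ (p - 1).
    move=> z0; rewrite -[X in X * _]powRr1 ?(ltW z0)// -powRD; last first.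
      by apply/implyP => _; rewrite gt_eqF.
    by congr (_ `^ _); ring.
  rewrite sp// /c [leRHS]mulrAC ler_wpM2l ?(ltW yp)//.
  rewrite ge0_ler_powR ?nnegrE ?subr_ge0 ?(ltW yp)//.
  rewrite -!mulrA (_ : 4 * (pi * r) = 2 * (pi * (2 * r))); last by ring.
  by rewrite !ler_wpM2l.
rewrite integralZ_EFin//; last exact: height_ge0.
apply: (@le_trans _ _ (c%:E * (6 * r * rho)%:E)%E).
  by apply: lee_wpmul2l; [rewrite lee_fin|exact: (integral_height adm _ rho1 r0)].
rewrite -EFinM lee_fin /c; have c1 : 0 < 4 * pi * r by rewrite !mulr_gt0 ?pi_gt0.
have -> : (4 * pi * r) `^ p = 4 * pi * r * (4 * pi * r) `^ (p - 1).
  rewrite -[X in _ = X * _]powRr1 ?(ltW c1)// -powRD; last first.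
    by apply/implyP => _; rewrite gt_eqF.
  by congr (_ `^ _); ring.
by lra.
Qed.

Lemma shell_data_eq0 j : ~ block J.-1 3 j -> ('N[freq_measure Z]_(p%:E)
     [(fun xi => (nm (fourier Z (phys mu phi) xi))%:E) \_ (@shell R Z (2 ^+ j))] = 0)%E.
Proof.
move=> jJ; rewrite shell_LnormE//.
rewrite (_ : (fun x => _) = cst 0%E); first by rewrite Lnorm0// eqe gt_eqF.
apply/funext => x; rewrite /= nm_data.
have [->|hx] := eqVneq (height (2 ^ J) rho r x) 0; first by rewrite !mulr0.
have /andP[h1 h2] := height_supp rho1 rhoN hx.
have NJ : (2 ^ J)%:R = 2 ^+ J :> R by rewrite natrX.
have hrN := rhoN; rewrite NJ in h1 h2 hrN.
have J2 : 2 ^+ J = 2 * 2 ^+ J.-1 :> R by rewrite -exprS prednK.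
have P1 : 1 <= 2 ^+ J.-1 :> R by rewrite exprn_ege1// ler1n.
rewrite indicE memNset ?mul0r// => -[/andP[k1 k2]]; apply: jJ.
rewrite /block /= addnS addn2 prednK// ltnS; apply/andP; split.
  rewrite leqNgt; apply/negP => jJ.
  have : 2 ^+ j.+1 <= 2 ^+ J.-1 :> R by rewrite ler_eXn2l ?ltr1n.
  have : x <= jap x.
    rewrite /jap -[leLHS]ger0_norm; last by move: rho0 h1 hrN; lra.
    by rewrite -sqrtr_sqr ler_wsqrtr// lerDr.
  by rewrite exprS; move: k2 h1 hrN; rewrite J2; lra.
rewrite leqNgt; apply/negP => jJ.
have : 2 ^+ J.+2 <= 2 ^+ j :> R by rewrite ler_eXn2l ?ltr1n.
have := jap_le x; rewrite ger0_norm; last by move: rho0 h1 hrN; lra.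
by rewrite !exprS; move: k1 h2 hrN; rewrite J2; lra.
Qed.

Lemma Dnorm_data_le (W : R -> R) q M : (1 <= q)%E -> (forall j, 0 <= W (2 ^+ j)) -> 0 <= M ->
  (forall j, block J.-1 3 j -> W (2 ^+ j) * (12 * pi * r * rho `^ p^-1) <= M) ->
  (Dnorm Z W p q (phys mu phi) <= (M * 3)%:E)%E.
Proof.
move=> q1 W0 M0 hM; apply: (lq_le (a := J.-1) (m := 3)) => //.
- by move=> j; rewrite mule_ge0 ?lee_fin ?Lnorm_ge0.
- move=> j /hM h; apply: le_trans (lee_wpmul2l _ (shell_data_le j)) _.
    by rewrite lee_fin.
  by rewrite -EFinM lee_fin.
- by move=> j /shell_data_eq0 ->; rewrite mule0.
Qed.

End Shells.

(** * Choice of the parameters *)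

Section Growth.
Context {R : realType}.
Implicit Types (a A B : R) (u : R^nat).

Lemma powR_small u a A B : (forall n, n%:R <= u n) -> a < 0 -> 0 < B ->
  \forall n \near \oo, A * u n `^ a < B.
Proof.
move=> un a0 B0; have [A0|A0] := leP A 0.
  near=> n; apply: le_lt_trans B0; exact: mulr_le0_ge0 A0 (powR_ge0 _ _).
have na0 : 0 < - a by rewrite oppr_gt0.
pose K := (A / B) `^ (- a)^-1; near=> n.
have Kn : K < u n.
  apply: lt_le_trans (un n); near: n; exact: nbhs_infty_gtr.
have K0 : 0 < K by rewrite powR_gt0// divr_gt0.
have : K `^ (- a) < u n `^ (- a).
  by rewrite gt0_ltr_powR// nnegrE ltW// (lt_trans K0).
rewrite /K -powRrM mulVf ?gt_eqF// powRr1 ?divr_ge0 ?(ltW A0) ?(ltW B0)//.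
rewrite powRN ltr_pdivrMr// => h.
by rewrite -ltr_pdivlMr ?powR_gt0 ?(lt_trans K0)// mulrC.
Unshelve. all: by end_near. Qed.

Lemma powR_large u a A B : (forall n, n%:R <= u n) -> 0 < a -> 0 < A ->
  \forall n \near \oo, B < A * u n `^ a.
Proof.
move=> un a0 A0; have na : - a < 0 by rewrite oppr_lt0.
have h := powR_small (Num.max B 1) un na A0.
near=> n; have hn : Num.max B 1 * u n `^ (- a) < A by near: n; exact: h.
have u0 : 0 < u n.
  by apply: lt_le_trans (un n); rewrite ltr0n; near: n; exact: nbhs_infty_gt.
apply: (@le_lt_trans _ _ (Num.max B 1)); first by rewrite le_max lexx.
by move: hn; rewrite powRN ltr_pdivrMr// powR_gt0.
Unshelve. all: by end_near. Qed.

Lemma le_exp2 (n : nat) : n%:R <= 2 ^+ n :> R.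
Proof. by rewrite -natrX ler_nat ltnW// ltn_expl. Qed.

Lemma ln2_bounds : 2^-1 <= ln 2 :> R /\ ln 2 <= 1 :> R.
Proof.
have h : (0 : R) < 2 by [].
split.
  rewrite -[leLHS]expRK ler_ln ?posrE ?expR_gt0//.
  apply: le_trans (expR_le_inv _) _; first by lra.
  by rewrite invf_ple ?posrE; lra.
rewrite -[leRHS]expRK ler_ln ?posrE ?expR_gt0//.
by have := expR_ge1Dx (1 : R); lra.
Qed.

Lemma jap_ln_exp2 (j : nat) : j%:R / 2 <= jap (ln (2 ^+ j : R)) <= 1 + j%:R.
Proof.
have [l1 l2] := ln2_bounds; have j0 : 0 <= j%:R :> R by [].
have lj : ln (2 ^+ j : R) = j%:R * ln 2 by rewrite lnXn// mulr_natl.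
have l0 : 0 <= j%:R * ln 2 :> R by rewrite mulr_ge0//; lra.
rewrite lj; apply/andP; split.
  apply: (@le_trans _ _ (j%:R * ln 2)); first by rewrite ler_wpM2l.
  by rewrite /jap -[leLHS]ger0_norm// -sqrtr_sqr ler_wsqrtr// lerDr.
apply: le_trans (jap_le _) _; rewrite lerD2l ger0_norm//.
by rewrite -[leRHS]mulr1 ler_wpM2l.
Qed.

End Growth.

Section Inflation.
Context {R : realType}.
Variables (Z : domain R) (mu : {sigma_finite_measure set R -> \bar R}) (S : set R).
Hypothesis adm : admissible Z mu S.
Variable eps : R[i].
Hypothesis eps1 : nm eps = 1.
Implicit Types (p s alpha : R) (q : \bar R) (W : R -> R).

Lemma norm_inflation_data X :
  (forall delta : R, 0 < delta -> exists J (rho r T : R),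
    [/\ [/\ 1 <= rho, 4 * rho <= (2 ^ J)%:R, 0 < r & 32 * T * ((2 ^ J)%:R) ^+ 2 <= 1],
        T * r ^+ 2 * rho ^+ 2 <= (10 ^+ 11)^-1, 0 < T < delta,
        (X (phys mu (data (2 ^ J) rho r)) < delta%:E)%E &
        forall w, edec w -> seqc w ->
          (forall x, 0 <= x <= rho / 4 ->
             r * (T * r ^+ 2 * rho ^+ 2) / 256 <= nm (w x)) ->
          ((delta^-1)%:E < X (phys mu w))%E]) ->
  norm_inflation Z eps X.
Proof.
move=> h delta /h[J [rho [r [T [[rho1 rhoN r0 TN] zs /andP[T0 Td] Xd Xw]]]]].
have [u [w [su uT dw cw hw]]] := inflated_solution adm rho1 rhoN r0 T0 TN eps1 zs.
exists (phys mu (data (2 ^ J) rho r)), T, u; split => //.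
- split => //; apply: (in_Hinfty_phys adm); last exact: seqc_data.
  apply: nrm_edec (nrm_data adm rho1 rhoN r0).
  by rewrite invr_gt0 mulr_gt0// (lt_le_trans _ rhoN)// mulr_gt0// (lt_le_trans ltr01).
- by rewrite T0.
- by rewrite uT; exact: Xw.
Qed.

Lemma low_output W p q w (rho L : R) : 1 <= p -> (1 <= q)%E -> 0 <= L ->
  (forall j, 0 <= W (2 ^+ j)) -> W 1 = 1 -> edec w -> seqc w -> 4 <= rho ->
  (forall x, 0 <= x <= rho / 4 -> L <= nm (w x)) ->
  (L%:E <= Dnorm Z W p q (phys mu w))%E.
Proof.
move=> p1 q1 L0 W0 W1 dw cw rho4 hL; have p0 : 0 < p := lt_le_trans ltr01 p1.
have e1 (z : R) : L * 1%:R `^ z = L by rewrite powR1 mulr1.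
rewrite -[L in (L%:E <= _)%E](e1 (2 * inv_double q)).
apply: (lq_ge (a := 0) (m := 1)) => //.
  by move=> j; rewrite mule_ge0 ?lee_fin ?Lnorm_ge0.
move=> j; rewrite /block /= add0n ltnS leqn0 => /eqP ->.
rewrite (_ : W (2 ^+ 0) = 1); last by rewrite expr0.
rewrite mul1e.
rewrite -[L in (L%:E <= _)%E](e1 p^-1).
apply: (shell_Lnorm_ge adm (n := 0)) => // x; rewrite add0r => /andP[x0 x1].
  by apply: hL; rewrite x0; lra.
rewrite /frequency_shell /= expr0 mulr1 jap_ge1 /=.
rewrite -[ltRHS]ger0_norm// -sqrtr_sqr /jap ltr_sqrt//.
have : x ^+ 2 <= 1 by rewrite expr_le1.
by rewrite expr2; lra.
Qed.

End Inflation.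

Section Regimes.
Context {R : realType}.
Variables (Z : domain R) (mu : {sigma_finite_measure set R -> \bar R}) (S : set R).
Hypothesis adm : admissible Z mu S.
Variable eps : R[i].
Hypothesis eps1 : nm eps = 1.
Implicit Types (p s alpha : R) (q : \bar R) (W : R -> R).

Let c : R := (10 ^+ 11)^-1.
Let c0 : 0 < c. Proof. by rewrite invr_gt0 exprn_gt0. Qed.
Let cs : 1000 * c <= 1.
Proof. by rewrite /c; lra. Qed.
Let P (J : nat) : R := 2 ^+ J.
Let PE J : (2 ^ J)%:R = P J. Proof. by rewrite natrX. Qed.
Let P0 J : 0 < P J. Proof. exact: exprn_gt0. Qed.
Let P1 J : 1 <= P J. Proof. by apply: exprn_ege1; rewrite ler1n. Qed.
Let leP J : J%:R <= P J. Proof. exact: le_exp2. Qed.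
Let pi0 : 0 < pi :> R. Proof. exact: pi_gt0. Qed.

Lemma inflation_negative_power W p q s C : 1 <= p -> (1 <= q)%E -> s < - (2 / 3) ->
  0 <= C -> (forall j, 0 <= W (2 ^+ j)) -> W 1 = 1 ->
  (forall j, W (2 ^+ j) <= C * (2 ^+ j) `^ s) ->
  norm_inflation Z eps (Dnorm Z W p q).
Proof.
move=> p1 q1 s23 C0 W0 W1 Ws; apply: (norm_inflation_data adm eps1) => delta delta0.
pose s' := Num.max s (-1); pose th := (2 / 3 - s') / 2.
have s1 : -1 <= s' by rewrite le_max lexx orbT.
have s2 : s' < - (2 / 3) by rewrite gt_max s23; lra.
have ss : s <= s' by rewrite le_max lexx.
have a1 : s' + th < 0 by rewrite /th; lra.
have a2 : 0 < 3 * th - 2 by rewrite /th; lra.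
have h1 := powR_small (96 * pi * C * 3) leP a1 delta0.
have a3 : (-2 : R) < 0 by lra.
have h2 := powR_small (c / 16) leP a3 delta0.
have c16 : 0 < c / 256 by rewrite divr_gt0.
have h3 := powR_large (delta^-1) leP a2 c16.
near \oo => J.
have J4 : (4 <= J)%N by near: J; exact: nbhs_infty_ge.
exists J, 4, (P J `^ th), (c / 16 * P J `^ (-2)); rewrite PE.
have r0 : 0 < P J `^ th by exact: powR_gt0.
have P16 : 16 <= P J.
  by apply: (@le_trans _ _ (2 ^+ 4)); [lra|rewrite ler_eXn2l ?ltr1n].
have P2 : P J `^ (-2) * P J ^+ 2 = 1.
  rewrite powRN powR_mulrn ?(ltW (P0 J))// mulVf//.
  by rewrite expf_eq0 /= gt_eqF.
have T0 : 0 < c / 16 * P J `^ (-2) by rewrite mulr_gt0 ?powR_gt0// divr_gt0.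
have zE : c / 16 * P J `^ (-2) * (P J `^ th) ^+ 2 * 4 ^+ 2 = c * P J `^ (2 * th - 2).
  rewrite -[(P J `^ th) ^+ 2]powR_mulrn ?powR_ge0// -powRrM.
  have -> : 2 * th - 2 = -2 + th * 2 by ring.
  rewrite [in RHS]powRD; last by apply/implyP => _; rewrite gt_eqF.
  by field.
split.
- split => //; first by rewrite ler1n.
  + by lra.
  + rewrite (_ : 32 * _ * _ = 2 * c * (P J `^ (-2) * P J ^+ 2)); last by field.
    by rewrite P2; move: cs c0; lra.
- rewrite zE -/c -[leRHS]mulr1 ler_wpM2l ?(ltW c0)//.
  rewrite -[leRHS](powRr0 (P J)) ler_powR//.
  by rewrite /th; lra.
- by rewrite T0 /=; near: J; exact: h2.
- apply: le_lt_trans (Dnorm_data_le adm _ _ _ r0 p1 q1 W0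
    (M := 96 * pi * C * P J `^ (s' + th)) _ _) _ => //.
  + by case: (J) J4.
  + by rewrite ler1n.
  + by rewrite PE; lra.
  + by rewrite !mulr_ge0 ?powR_ge0 ?(ltW pi0).
  + move=> j /andP[jJ _].
    have e1 : W (2 ^+ j) <= C * (2 * P J `^ s').
      apply: le_trans (Ws j) _; rewrite ler_wpM2l//.
      apply: (@le_trans _ _ (P j `^ s')); first exact: ler_powR.
      have Pj : P J / 2 <= P j.
        rewrite ler_pdivrMr// /P -exprSr ler_eXn2l ?ltr1n//.
        by move: jJ; case: (J) => //= J'; rewrite ltnS.
      have PJ2 : 0 < P J / 2 by rewrite divr_gt0.
      apply: (@le_trans _ _ ((P J / 2) `^ s')).
        rewrite -[s']opprK !(powRN _ (- s')) lef_pV2 ?posrE ?powR_gt0//.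
        by rewrite ge0_ler_powR ?nnegrE ?(ltW PJ2) ?(ltW (P0 j))//; lra.
      rewrite powRM ?(ltW (P0 J))// mulrC ler_wpM2r ?powR_ge0//.
      rewrite -powR_inv1// -powRrM -[leRHS]powRr1// ler_powR//; last by lra.
      by rewrite ler1n.
    have e2 : 4 `^ p^-1 <= 4 :> R.
      by rewrite -[leRHS]powRr1// ler_powR ?ler1n// invf_le1// (lt_le_trans ltr01).
    rewrite powRD; last by apply/implyP => _; rewrite gt_eqF.
    apply: (@le_trans _ _ (C * (2 * P J `^ s') * (12 * pi * P J `^ th * 4))).
      apply: ler_pM => //.
        by rewrite !mulr_ge0 ?powR_ge0 ?(ltW pi0).
      by rewrite ler_wpM2l// !mulr_ge0 ?powR_ge0 ?(ltW pi0).
    by lra.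
  + rewrite lte_fin (_ : _ * 3 = 96 * pi * C * 3 * P J `^ (s' + th)); last by ring.
    by near: J; exact: h1.
- move=> w dw cw hw; apply: lt_le_trans (low_output adm p1 q1 _ W0 W1 dw cw _ hw) => //.
  + rewrite lte_fin zE.
    have -> : P J `^ th * (c * P J `^ (2 * th - 2)) / 256 = c / 256 * P J `^ (3 * th - 2).
      have -> : 3 * th - 2 = th + (2 * th - 2) by ring.
      rewrite [in RHS]powRD; last by apply/implyP => _; rewrite gt_eqF.
      by field.
    by near: J; exact: h3.
  + by rewrite zE !mulr_ge0 ?powR_ge0 ?(ltW c0).
Unshelve. all: by end_near. Qed.

End Regimes.

Section LogRegimes.
Context {R : realType}.
Variables (Z : domain R) (mu : {sigma_finite_measure set R -> \bar R}) (S : set R).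
Hypothesis adm : admissible Z mu S.
Variable eps : R[i].
Hypothesis eps1 : nm eps = 1.
Implicit Types (p s alpha : R) (q : \bar R) (W : R -> R).

Let c : R := (10 ^+ 11)^-1.
Let c0 : 0 < c. Proof. by rewrite invr_gt0 exprn_gt0. Qed.
Let cs : 1000 * c <= 1.
Proof. by rewrite /c; lra. Qed.
Let P (J : nat) : R := 2 ^+ J.
Let PE J : (2 ^ J)%:R = P J. Proof. by rewrite natrX. Qed.
Let P0 J : 0 < P J. Proof. exact: exprn_gt0. Qed.
Let P1 J : 1 <= P J. Proof. by apply: exprn_ege1; rewrite ler1n. Qed.
Let leP J : J%:R <= P J. Proof. exact: le_exp2. Qed.
Let pi0 : 0 < pi :> R. Proof. exact: pi_gt0. Qed.


Let wlog p alpha (N : R) : R := N `^ (- p^-1) * jap (ln N) `^ alpha.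

Let wlog_ge0 p alpha j : 0 <= wlog p alpha (2 ^+ j).
Proof. by rewrite mulr_ge0 ?powR_ge0. Qed.

Let wlog1 p alpha : wlog p alpha 1 = 1.
Proof.
by rewrite /wlog ln1 powR1 mul1r /jap expr0n addr0 sqrtr1 powR1.
Qed.



Let c16 : 0 < 16 * c. Proof. by rewrite mulr_gt0. Qed.

(* The data of height r and width 2^J / 4, at the time 16 c / (4^J r'^2). *)
Let wide_data_le p alpha J r j : 1 <= p -> (0 < J)%N -> 0 < r -> block J.-1 3 j ->
  wlog p alpha (2 ^+ j) * (12 * pi * r * (P J / 4) `^ p^-1) <=
  12 * pi * r * jap (ln (2 ^+ j)) `^ alpha.
Proof.
move=> p1 J0 r0 /andP[jJ _]; have p0 : 0 < p := lt_le_trans ltr01 p1.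
have h : P j `^ (- p^-1) * (P J / 4) `^ p^-1 <= 1.
  rewrite powRN mulrC ler_pdivrMr ?powR_gt0// mul1r.
  rewrite ge0_ler_powR ?nnegrE ?invr_ge0 ?(ltW p0) ?divr_ge0 ?(ltW (P0 _))//.
  rewrite ler_pdivrMr//.
  have : P J <= P j.+1.
    by rewrite ler_eXn2l ?ltr1n//; move: jJ J0; case: (J) => //= J'.
  by rewrite /P exprS; have := P0 j; rewrite /P; lra.
rewrite /wlog -/(P j); have := powR_ge0 (jap (ln (P j))) alpha.
move: h; move: (P j `^ _) ((P J / 4) `^ _) (jap _ `^ _) => x y g h g0.
rewrite (_ : x * g * _ = x * y * (12 * pi * r * g)); last by ring.
by rewrite ler_piMl// !mulr_ge0// ltW.
Qed.

Lemma inflation_log_neg p q alpha : 1 <= p -> (1 <= q)%E -> alpha < 0 ->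
  norm_inflation Z eps (Dlog_norm Z alpha p q).
Proof.
move=> p1 q1 a0; apply: (norm_inflation_data adm eps1) => delta delta0.
have leN (J : nat) : J%:R <= J%:R :> R by [].
have b0 : alpha / 2 < 0 by lra.
have b1 : 0 < - alpha / 2 by lra.
have h1 := powR_small (12 * pi * 4 `^ (- alpha) * 3) leN b0 delta0.
have a3 : (-2 : R) < 0 by lra.
have h2 := powR_small (16 * c) leP a3 delta0.
have c256 : 0 < c / 256 by rewrite divr_gt0.
have h3 := powR_large (delta^-1) leN b1 c256.
near \oo => J.
have J4 : (4 <= J)%N by near: J; exact: nbhs_infty_ge.
have J0 : (0 < J)%N by case: (J) J4.
have Jr : 0 < J%:R :> R by rewrite ltr0n.
pose r : R := J%:R `^ (- alpha / 2).
exists J, (P J / 4), r, (16 * c * P J `^ (-2) / r ^+ 2); rewrite PE.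
have r0 : 0 < r by exact: powR_gt0.
have r1 : 1 <= r.
  have e : (J%:R : R) `^ 0 = 1 by rewrite powRr0.
  by rewrite /r -[leLHS]e ler_powR ?ler1n// ltW.
have r21 : 1 <= r ^+ 2 by exact: exprn_ege1.
have r20 : 0 < r ^+ 2 by exact: exprn_gt0.
have P16 : 16 <= P J.
  by apply: (@le_trans _ _ (2 ^+ 4)); [lra|rewrite ler_eXn2l ?ltr1n].
have P2 : P J `^ (-2) * P J ^+ 2 = 1.
  rewrite powRN powR_mulrn ?(ltW (P0 J))// mulVf//.
  by rewrite expf_eq0 /= gt_eqF.
have P20 : 0 < P J `^ (-2) by rewrite powR_gt0.
have T0 : 0 < 16 * c * P J `^ (-2) / r ^+ 2 by rewrite divr_gt0// mulr_gt0.
have zE : 16 * c * P J `^ (-2) / r ^+ 2 * r ^+ 2 * (P J / 4) ^+ 2 = c.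
  rewrite mulfVK ?gt_eqF// exprMn mulrA -[_ * _ * P J ^+ 2]mulrA P2.
  by field.
have Tle : 16 * c * P J `^ (-2) / r ^+ 2 <= 16 * c * P J `^ (-2).
  by rewrite ler_pdivrMr// ler_peMr// ltW// mulr_gt0.
split.
- split => //; [lra|lra|].
  apply: (@le_trans _ _ (32 * (16 * c * P J `^ (-2)) * P J ^+ 2)).
    by rewrite ler_wpM2r ?sqr_ge0// ler_wpM2l.
  rewrite (_ : 32 * _ * _ = 512 * c * (P J `^ (-2) * P J ^+ 2)); last by ring.
  by rewrite P2; move: cs c0; lra.
- by rewrite zE.
- by rewrite T0 /=; apply: le_lt_trans Tle _; near: J; exact: h2.
- apply: le_lt_trans (Dnorm_data_le adm J0 _ _ r0 p1 q1 (wlog_ge0 p alpha)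
    (M := 12 * pi * r * (J%:R / 4) `^ alpha) _ _) _ => //.
  + lra.
  + by rewrite PE; lra.
  + by rewrite !mulr_ge0 ?powR_ge0 ?(ltW pi0) ?(ltW r0).
  + move=> j jJ; apply: le_trans (wide_data_le alpha p1 J0 r0 jJ) _.
    rewrite ler_wpM2l//; first by rewrite !mulr_ge0 ?(ltW pi0) ?(ltW r0).
    have /andP[l1 _] := @jap_ln_exp2 R j.
    have l2 : J%:R / 4 <= j%:R / 2 :> R.
      have : J%:R <= j%:R + 1 :> R.
        by rewrite natr1 ler_nat; case/andP: jJ => + _; case: (J) => //.
      have : 4 <= J%:R :> R by rewrite ler_nat.
      by lra.
    have J40 : 0 < J%:R / 4 :> R by rewrite divr_gt0.
    rewrite -[alpha]opprK !(powRN _ (- alpha)) lef_pV2 ?posrE ?powR_gt0 ?jap_gt0//.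
    rewrite ge0_ler_powR ?nnegrE ?(ltW J40) ?(ltW (jap_gt0 _))//; first by lra.
    exact: le_trans l2 l1.
  rewrite lte_fin powRM ?(ltW Jr)//.
  have -> : 12 * pi * r * (J%:R `^ alpha * 4^-1 `^ alpha) * 3 =
      12 * pi * 4 `^ (- alpha) * 3 * J%:R `^ (alpha / 2).
    rewrite -powR_inv1// -powRrM mulN1r /r.
    have -> : alpha / 2 = - alpha / 2 + alpha by field.
    rewrite [in RHS]powRD; last by apply/implyP => _; rewrite gt_eqF.
    by ring.
  by near: J; exact: h1.
- move=> w dw cw hw; apply: lt_le_trans (low_output adm p1 q1 _ (wlog_ge0 p alpha)
    (wlog1 p alpha) dw cw _ hw) => //.
  + rewrite lte_fin zE (_ : r * c / 256 = c / 256 * r); last by ring.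
    by rewrite /r; near: J; exact: h3.
  + by rewrite zE divr_ge0// mulr_ge0 ?(ltW c0) ?(ltW r0).
  + lra.
Unshelve. all: by end_near. Qed.

Lemma inflation_log_nonneg p (q alpha : R) : 1 <= p -> 1 <= q -> 0 <= alpha ->
  alpha < (2 * q)^-1 -> norm_inflation Z eps (Dlog_norm Z alpha p q%:E).
Proof.
move=> p1 q1 a0 aq; apply: (norm_inflation_data adm eps1) => delta delta0.
have p0 : 0 < p := lt_le_trans ltr01 p1.
have q0 : 0 < q := lt_le_trans ltr01 q1.
have qE : 2 * (2 * q)^-1 = q^-1 by rewrite invfM mulrA divff// mul1r.
pose b := (alpha + (alpha + q^-1) / 3) / 2.
have b1 : alpha < b by rewrite /b -qE; lra.
have b2 : 0 < alpha + q^-1 - 3 * b by rewrite /b -qE; lra.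
have leN (m : nat) : m%:R <= m%:R :> R by [].
have ab : alpha - b < 0 by lra.
have h1 := powR_small (12 * pi * 9 `^ alpha * 3) leN ab delta0.
have leP' (m : nat) : m%:R <= P (2 * m + 5) :> R.
  by apply: le_trans (leP _); rewrite ler_nat -{1}[m]mul1n; apply: leq_trans (leq_addr _ _); rewrite leq_mul2r orbT.
have a3 : (-2 : R) < 0 by lra.
have h2 := powR_small (16 * c) leP' a3 delta0.
have cb : 0 < c / 512 * (2^-1) `^ alpha by rewrite mulr_gt0 ?divr_gt0 ?powR_gt0.
have h3 := powR_large (delta^-1) leN b2 cb.
near \oo => m.
have m1 : (1 <= m)%N by near: m; exact: nbhs_infty_ge.
have mr : 0 < m%:R :> R by rewrite ltr0n.
have mr1 : 1 <= m%:R :> R by rewrite ler1n.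
have [J JE] : exists J, J = (2 * m + 5)%N by eexists.
pose r : R := m%:R `^ (- b).
have J0 : (0 < J)%N by rewrite JE addnS.
exists J, (P J / 4), r, (16 * c * P J `^ (-2)); rewrite PE.
have r0 : 0 < r by exact: powR_gt0.
have r1 : r <= 1.
  have e : (m%:R : R) `^ 0 = 1 by rewrite powRr0.
  by rewrite /r -[leRHS]e ler_powR//; lra.
have r21 : r ^+ 2 <= 1 by rewrite expr_le1// ltW.
have P16 : 16 <= P J.
  by apply: (@le_trans _ _ (2 ^+ 4)); [lra|rewrite ler_eXn2l ?ltr1n// JE; exact: (@leq_trans 5 _ _ _ (leq_addl _ _))].
have P2 : P J `^ (-2) * P J ^+ 2 = 1.
  rewrite powRN powR_mulrn ?(ltW (P0 J))// mulVf//.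
  by rewrite expf_eq0 /= gt_eqF.
have P20 : 0 < P J `^ (-2) by rewrite powR_gt0.
have T0 : 0 < 16 * c * P J `^ (-2) by rewrite mulr_gt0.
have zE : 16 * c * P J `^ (-2) * r ^+ 2 * (P J / 4) ^+ 2 = c * r ^+ 2.
  rewrite exprMn (_ : _ * _ = c * r ^+ 2 * (P J `^ (-2) * P J ^+ 2)); last by field.
  by rewrite P2 mulr1.
split.
- split => //; [lra|lra|].
  rewrite (_ : 32 * _ * _ = 512 * c * (P J `^ (-2) * P J ^+ 2)); last by ring.
  by rewrite P2; move: cs c0; lra.
- by rewrite zE -/c ler_piMr// ltW.
- by rewrite T0 /= JE; near: m; exact: h2.
- apply: le_lt_trans (Dnorm_data_le adm J0 _ _ r0 p1 _ (wlog_ge0 p alpha)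
    (M := 12 * pi * r * (9 * m%:R) `^ alpha) _ _) _ => //.
  + lra.
  + by rewrite PE; lra.
  + by rewrite !mulr_ge0 ?powR_ge0 ?(ltW pi0) ?(ltW r0).
  + move=> j jJ; apply: le_trans (wide_data_le alpha p1 J0 r0 jJ) _.
    rewrite ler_wpM2l//; first by rewrite !mulr_ge0 ?(ltW pi0) ?(ltW r0).
    have /andP[_ l1] := @jap_ln_exp2 R j.
    rewrite ge0_ler_powR ?nnegrE ?(ltW (jap_gt0 _)) ?mulr_ge0//.
    apply: le_trans l1 _.
    have : j%:R <= (2 * m + 6)%:R :> R.
      have e : ((2 * m + 5).-1 + 3 = (2 * m + 6).+1)%N by rewrite (addnS _ 4) /= -addnA -addnS.
      by rewrite ler_nat; case/andP: jJ => _; rewrite JE e ltnS.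
    by rewrite natrD natrM; lra.
  rewrite lte_fin powRM//.
  have -> : 12 * pi * r * (9 `^ alpha * m%:R `^ alpha) * 3 =
      12 * pi * 9 `^ alpha * 3 * m%:R `^ (alpha - b).
    rewrite powRD; last by apply/implyP => _; rewrite gt_eqF.
    rewrite /r; move: (9 `^ alpha) (m%:R `^ alpha) (m%:R `^ (- b)) => x y z; ring.
  by near: m; exact: h1.
- move=> w dw cw; rewrite zE => hw.
  pose L := r * (c * r ^+ 2) / 256.
  have L0 : 0 <= L by rewrite divr_ge0// !mulr_ge0 ?(ltW r0) ?(ltW c0).
  pose K := L * ((m%:R / 2) `^ alpha / 2).
  have K0 : 0 <= K by rewrite mulr_ge0// divr_ge0 ?powR_ge0.
  apply: (@lt_le_trans _ _ (K * m%:R `^ (2 * inv_double q%:E))%:E).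
    rewrite lte_fin /= qE.
    have -> : K * m%:R `^ q^-1 = c / 512 * (2^-1) `^ alpha * m%:R `^ (alpha + q^-1 - 3 * b).
      rewrite /K /L powRM//.
      have -> : alpha + q^-1 - 3 * b = alpha + q^-1 + ((- b) + ((- b) + (- b))) by ring.
      rewrite !(powRD (x := m%:R)); try by apply/implyP => _; rewrite gt_eqF.
      by rewrite -/r; move: (m%:R `^ alpha) (m%:R `^ q^-1) (2^-1 `^ alpha) => *; field.
    by near: m; exact: h3.
  apply: (lq_ge (a := m) (m := m)) => //.
    move=> j; apply: mule_ge0; last exact: Lnorm_ge0.
    by rewrite lee_fin; exact: wlog_ge0.
  move=> j /andP[mj jm].
  have Pj2 : 0 <= P j / 2 by rewrite divr_ge0// ltW.
  have j1 : (1 <= j)%N by exact: leq_trans mj.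
  have PJj : P j * 16 <= P J / 4.
    have -> : P j * 16 = P (j + 6) / 4 by rewrite /P exprD; field.
    rewrite ler_wpM2r// ler_eXn2l ?ltr1n// JE.
    by rewrite mul2n -addnn -(addSnnS j 5) leq_add2r.
  have hj : ((L * (P j / 2) `^ p^-1)%:E <= 'N[freq_measure Z]_(p%:E)
     [(fun xi => (nm (fourier Z (phys mu w) xi))%:E) \_ (@shell R Z (2 ^+ j))])%E.
    have Pn : (2 ^ j)%:R = P j := PE j.
    apply: (shell_Lnorm_ge adm (n := (2 ^ j)%N)) => // x; rewrite Pn => /andP[x0 x1].
      apply: hw; have := P0 j; rewrite ler_pdivlMr//; move: x0 x1 PJj.
      by move=> *; apply/andP; split; lra.
    have Pj : 2 <= P j by rewrite /P -[leLHS]expr1 ler_eXn2l ?ltr1n.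
    have x00 : 0 <= x by lra.
    rewrite /frequency_shell /= -/(P j); apply/andP; split.
      apply: le_trans x0 _.
      by rewrite /jap -[leLHS]ger0_norm// -sqrtr_sqr ler_wsqrtr// lerDr.
    rewrite -[ltRHS]ger0_norm; last by rewrite mulr_ge0//; lra.
    rewrite -sqrtr_sqr /jap ltr_sqrt; last by rewrite exprn_gt0// mulr_gt0.
    apply: (@le_lt_trans _ _ (1 + (3 / 2 * P j) ^+ 2)).
      by rewrite lerD2l ler_pXn2r// ?nnegrE; lra.
    have : 2 * 2 <= P j ^+ 2 by rewrite expr2 ler_pM.
    by rewrite !exprMn; lra.
  apply: le_trans (lee_wpmul2l _ hj); last by rewrite lee_fin; exact: wlog_ge0.
  rewrite -EFinM lee_fin /wlog -/(P j).
  have /andP[l1 _] := @jap_ln_exp2 R j.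
  have g1 : (m%:R / 2) `^ alpha <= jap (ln (P j)) `^ alpha.
    rewrite ge0_ler_powR ?nnegrE ?(ltW (jap_gt0 _)) ?divr_ge0//.
    by apply: le_trans l1; rewrite ler_wpM2r// ler_nat.
  have g2 : 2^-1 <= P j `^ (- p^-1) * (P j / 2) `^ p^-1.
    rewrite powRM ?(ltW (P0 j))// mulrA -powRD; last by apply/implyP => _; rewrite gt_eqF.
    rewrite addNr powRr0 mul1r -powR_inv1// -powRrM mulN1r.
    rewrite ler_powR ?ler1n// lerN2 invf_le1//.
  rewrite (_ : _ * (L * _) = L * (jap (ln (P j)) `^ alpha * (P j `^ (- p^-1) * (P j / 2) `^ p^-1))); last by ring.
  by rewrite /K ler_wpM2l// ler_pM ?powR_ge0.
Unshelve. all: by end_near. Qed.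

End LogRegimes.

(** When [p] is less than 3/2, [-1/p] is less than -2/3, and the logarithm can
    be absorbed in a power that is still less than -2/3. *)
Lemma log_weight_le (R : realType) (p alpha s : R) : - p^-1 < s -> exists2 C : R,
  0 <= C & forall j, (2 ^+ j) `^ (- p^-1) * jap (ln (2 ^+ j)) `^ alpha <= C * (2 ^+ j) `^ s.
Proof.
move=> ps; have k0 : 0 < s + p^-1 by lra.
have [C C0 hC] := jap_powR_wt alpha k0; exists C => // j.
have P0 : 0 < 2 ^+ j :> R by exact: exprn_gt0.
have l0 : 0 <= ln (2 ^+ j) :> R by rewrite ln_ge0// exprn_ege1// ler1n.
have e : (2 ^+ j : R) `^ s = (2 ^+ j) `^ (- p^-1) * wt (s + p^-1) (ln (2 ^+ j)).
  have -> : wt (s + p^-1) (ln (2 ^+ j)) = (2 ^+ j) `^ (s + p^-1).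
    by rewrite /wt /powR gt_eqF// ger0_norm.
  rewrite -powRD; last by apply/implyP => _; rewrite gt_eqF.
  by congr (_ `^ _); ring.
by rewrite e mulrCA ler_wpM2l ?powR_ge0.
Qed.

Theorem propositionB3 (R : realType) (Z : domain R) (eps : R[i])
    (hZ : Z = line R \/ Z = torus R) (heps : eps = 1 \/ eps = -1) :
  (forall (p alpha : R) (q : \bar R),
      3 / 2 <= p -> (1 <= q)%E -> alpha < inv_double q ->
      norm_inflation Z eps (Dlog_norm Z alpha p q)) /\
  (forall (p : R) (q : \bar R), 1 <= p < 3 / 2 -> (1 <= q)%E ->
      (forall alpha : R, norm_inflation Z eps (Dlog_norm Z alpha p q)) /\
      (forall s : R, s < - (2 / 3) ->
         norm_inflation Z eps (Dpow_norm Z s p q))).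
Proof.
have e1 : nm eps = 1 by case: heps => ->; rewrite ?nmN nm1.
have [mu [S adm]] : exists (mu : {sigma_finite_measure set R -> \bar R}) (S : set R),
    admissible Z mu S.
  case: hZ => ->; last by exists (@cntR R), (@integers R); exact: torus_admissible.
  by exists (@lebR R), setT; exact: line_admissible.
split.
- move=> p alpha q p32 q1 aq; have p1 : 1 <= p by lra.
  have [a0|a0] := ltP alpha 0; first exact: (inflation_log_neg adm e1).
  case: q q1 aq => [q| |] //=; last by move=> _; rewrite ltNge a0.
  by rewrite lee_fin => q1 aq; exact: (inflation_log_nonneg adm e1).
- move=> p q /andP[p1 p32] q1; have p0 : 0 < p by lra.
  split=> [alpha|s s23].
  + have pV : 2 / 3 < p^-1 by rewrite -[2 / 3]invf_div ltf_pV2 ?posrE//; lra.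
    pose s := (- p^-1 - 2 / 3) / 2.
    have s1 : - p^-1 < s by rewrite /s; lra.
    have s2 : s < - (2 / 3) by rewrite /s; lra.
    have [C C0 hC] := log_weight_le alpha s1.
    apply: (inflation_negative_power adm e1 p1 q1 s2 C0) => //.
    * by move=> j; rewrite mulr_ge0 ?powR_ge0.
    * by rewrite ln1 powR1 mul1r /jap expr0n addr0 sqrtr1 powR1.
  + apply: (inflation_negative_power adm e1 p1 q1 s23 ler01).
    * by move=> j; exact: powR_ge0.
    * by rewrite powR1.
    * by move=> j; rewrite mul1r.
Qed.
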